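(* The cheapest insertion heuristic for the traveling salesman problem on $n$ sites can be implemented in time $O(n^2)$. It can also be implemented in time $O(n^2\log^2 n)$ and space $O(n)$.
   Context: The input is a set of $n$ sites with a (symmetric) numerical distance function $d$, not necessarily satisfying the triangle inequality; each site is stored in constant space, $d$ is evaluated in constant time, and distances are compared and added in constant time. The cheapest insertion heuristic maintains a tour of a subset of the sites, starting from the trivial tour on one arbitrary site (regarded as one loop edge of length zero). At each step it adds one not yet included site $s$ to the tour by replacing an edge $(a,b)$ of the tour by the two edges $(a,s)$ and $(s,b)$; among all choices of uninserted site and tour edge, it chooses one causing the least additional length $d(a,s)+d(s,b)-d(a,b)$ in the augmented tour (ties broken arbitrarily). It ends when all sites are in the tour. *)

(* Defs.v *)
From mathcomp Require Import all_boot all_order all_algebra.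

Set Implicit Arguments.
Unset Strict Implicit.
Unset Printing Implicit Defensive.

Import GRing.Theory Num.Theory.

(** * The cheapest insertion heuristic *)

Section Heuristic.
Variables (R : realDomainType) (n : nat) (d : 'I_n -> 'I_n -> R).
Implicit Types (a b s : 'I_n) (t : seq 'I_n).

(* A tour is the duplicate-free sequence of its sites in cyclic order; its
   edges are the pairs (a, next t a) for a \in t.  Thus [:: a] has the single
   loop edge (a, a), and [:: a; b] has the two edges (a, b) and (b, a). *)

(* The loop edge has length zero, whatever d says on the diagonal. *)
Definition edge_length a b : R := if a == b then 0%R else d a b.

Definition insertion_cost a b s : R := (d a s + d s b - edge_length a b)%R.

(* For a \in t, replaces the edge (a, next t a) by (a, s) and (s, next t a). *)
Definition insert_after t a s : seq 'I_n :=
  take (index a t).+1 t ++ s :: drop (index a t).+1 t.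

Definition cheapest_step t t' : Prop :=
  exists a s,
    [/\ a \in t, s \notin t,
        forall a' s', a' \in t -> s' \notin t ->
          (insertion_cost a (next t a) s <= insertion_cost a' (next t a') s')%R
      & t' = insert_after t a s].

Inductive heuristic_reaches s0 : seq 'I_n -> Prop :=
| Heuristic_start : heuristic_reaches s0 [:: s0]
| Heuristic_step t t' :
    heuristic_reaches s0 t -> cheapest_step t t' -> heuristic_reaches s0 t'.

(* Any resolution of the ties is admitted. *)
Definition cheapest_insertion_tour s0 t : Prop :=
  heuristic_reaches s0 t /\ forall s, s \in t.

End Heuristic.

(** * The machine model

    A unit-cost random access machine with a structured program.  Its memory
    consists of arrays of machine words (natural numbers below [W]) and arrays
    of distances (elements of R); both kinds of arrays are named by literal
    numbers, and a scalar variable is a cell at index 0.  Distances can only be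
    queried, copied, added and compared; in particular they cannot be converted
    to words.  Sites are words below n.  Running time is the number of nodes of
    the syntax trees evaluated. *)

Inductive word_op := Add | Sub | Mul | Div.

Inductive wexp :=
| WConst of nat
| WGet of nat & wexp              (* array name, index *)
| WOp of word_op & wexp & wexp.

Inductive dexp :=
| DGet of nat & wexp
| DDist of wexp & wexp            (* the distance between two sites *)
| DAdd of dexp & dexp.

Inductive test :=
| WLe of wexp & wexp
| DLe of dexp & dexp
| TNot of test.

Inductive cmd :=
| Skip
| WSet of nat & wexp & wexp       (* array name, index, value *)
| DSet of nat & wexp & dexp
| Seq of cmd & cmd
| If of test & cmd & cmd
| While of test & cmd.

Fixpoint wcost (e : wexp) : nat :=
  match e with
  | WConst _ => 1
  | WGet _ i => (wcost i).+1
  | WOp _ e1 e2 => (wcost e1 + wcost e2).+1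
  end.

Fixpoint dcost (e : dexp) : nat :=
  match e with
  | DGet _ i => (wcost i).+1
  | DDist e1 e2 => (wcost e1 + wcost e2).+1
  | DAdd e1 e2 => (dcost e1 + dcost e2).+1
  end.

Fixpoint tcost (b : test) : nat :=
  match b with
  | WLe e1 e2 => (wcost e1 + wcost e2).+1
  | DLe e1 e2 => (dcost e1 + dcost e2).+1
  | TNot b1 => (tcost b1).+1
  end.

Definition eval_op (o : word_op) : nat -> nat -> nat :=
  match o with
  | Add => addn
  | Sub => subn
  | Mul => muln
  | Div => divn
  end.

Record state (R : Type) := State {
  words : nat -> nat -> nat;      (* array name, index *)
  dists : nat -> nat -> R
}.

Definition upd (T : Type) (m : nat -> nat -> T) (x i : nat) (v : T) :
    nat -> nat -> T :=
  fun y j => if (y == x) && (j == i) then v else m y j.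

Section Semantics.
Variables (R : realDomainType) (n : nat) (d : 'I_n -> 'I_n -> R).

(* [mw] and [md] list the lengths of the word arrays and of the distance arrays
   (arrays not listed have length 0).  A word that is not below [W], an index
   outside its array and a distance query outside the set of sites are faults:
   evaluation gives None, and [exec] then has no derivation. *)
Variables (W : nat) (mw md : seq nat).

Definition word (v : nat) : option nat := if v < W then Some v else None.

Fixpoint weval (st : state R) (e : wexp) : option nat :=
  match e with
  | WConst v => word v
  | WGet x e1 =>
      if weval st e1 is Some i then
        if i < nth 0 mw x then word (words st x i) else None
      else None
  | WOp o e1 e2 =>
      if (weval st e1, weval st e2) is (Some u, Some v)
      then word (eval_op o u v) else None
  end.

Fixpoint deval (st : state R) (e : dexp) : option R :=
  match e with
  | DGet x e1 =>
      if weval st e1 is Some i then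
        if i < nth 0 md x then Some (dists st x i) else None
      else None
  | DDist e1 e2 =>
      if (weval st e1, weval st e2) is (Some i, Some j) then
        if (insub i, insub j) is (Some a, Some b) then Some (d a b) else None
      else None
  | DAdd e1 e2 =>
      if (deval st e1, deval st e2) is (Some u, Some v)
      then Some (u + v)%R else None
  end.

Fixpoint teval (st : state R) (b : test) : option bool :=
  match b with
  | WLe e1 e2 =>
      if (weval st e1, weval st e2) is (Some u, Some v)
      then Some (u <= v) else None
  | DLe e1 e2 =>
      if (deval st e1, deval st e2) is (Some u, Some v)
      then Some (u <= v)%R else None
  | TNot b1 => omap negb (teval st b1)
  end.

(* exec c st k st': from st, the command c halts in st' after time k. *)
Inductive exec : cmd -> state R -> nat -> state R -> Prop :=
| Exec_skip st : exec Skip st 1 st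
| Exec_wset st x ei e i v :
    weval st ei = Some i -> weval st e = Some v -> i < nth 0 mw x ->
    exec (WSet x ei e) st (wcost ei + wcost e).+1
      (State (upd (words st) x i v) (dists st))
| Exec_dset st x ei e i v :
    weval st ei = Some i -> deval st e = Some v -> i < nth 0 md x ->
    exec (DSet x ei e) st (wcost ei + dcost e).+1
      (State (words st) (upd (dists st) x i v))
| Exec_seq c1 c2 st1 st2 st3 k1 k2 :
    exec c1 st1 k1 st2 -> exec c2 st2 k2 st3 ->
    exec (Seq c1 c2) st1 (k1 + k2).+1 st3
| Exec_if b c1 c2 st1 st2 v k :
    teval st1 b = Some v -> exec (if v then c1 else c2) st1 k st2 ->
    exec (If b c1 c2) st1 (tcost b + k).+1 st2
| Exec_while_stop b c st :
    teval st b = Some false ->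
    exec (While b c) st (tcost b).+1 st
| Exec_while_loop b c st1 st2 st3 k1 k2 :
    teval st1 b = Some true ->
    exec c st1 k1 st2 -> exec (While b c) st2 k2 st3 ->
    exec (While b c) st1 (tcost b + k1 + k2).+1 st3.

Lemma exec_deterministic c st k1 st1 k2 st2 :
  exec c st k1 st1 -> exec c st k2 st2 -> k1 = k2 /\ st1 = st2.
Proof.
move=> E; elim: E k2 st2 => {c st k1 st1}.
- by move=> st k2 st2 E; inversion E.
- by move=> st x ei e i v Hi Hv _ k2 st2 E; inversion E; subst; split; congruence.
- by move=> st x ei e i v Hi Hv _ k2 st2 E; inversion E; subst; split; congruence.
- move=> c1 c2 sa sb sc ka kb _ IH1 _ IH2 k2 st2 E.
  inversion E as [| | |? ? ? ? ? ? ? E1 E2| | |]; subst.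
  have [? ?] := IH1 _ _ E1; subst.
  by have [? ?] := IH2 _ _ E2; subst.
- move=> b c1 c2 sa sb v k Hb _ IH k2 st2 E.
  inversion E as [| | | |? ? ? ? ? w ? Hw E1| |]; subst.
  have ? : v = w by congruence.
  by subst; have [? ?] := IH _ _ E1; subst.
- by move=> b c st Hb k2 st2 E; inversion E; subst => //; congruence.
- move=> b c sa sb sc ka kb Hb _ IH1 _ IH2 k2 st2 E.
  inversion E as [| | | | | |? ? ? ? ? ? ? ? E1 E2]; subst; first by congruence.
  have [? ?] := IH1 _ _ E1; subst.
  by have [? ?] := IH2 _ _ E2; subst.
Qed.

End Semantics.

(* The input words are the number of sites and the starting site; all other
   cells are 0.  The distance function is not stored: it is queried. *)
Definition initial_state (R : realDomainType) (n s0 : nat) : state R :=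
  State (upd (upd (fun _ _ => 0) 0 0 n) 1 0 s0) (fun _ _ => 0%R).

(* The output is the tour stored in the first n cells of word array 2. *)
Definition output (R : Type) (n : nat) (st : state R) : seq nat :=
  [seq words st 2 i | i <- iota 0 n].

(* Words of b * (floor (log2 n) + 1) bits. *)
Definition word_bound (b n : nat) : nat := 2 ^ (b * (trunc_log 2 n).+1).

(* p implements the heuristic on n sites in time T n and space S n, with words
   of O(log n) bits.  Space is the total number of cells of all arrays.  The
   same program serves every number n of sites and every domain R of numerical
   distances. *)
Definition implements_cheapest_insertion (p : cmd) (T S : nat -> nat) : Prop :=
  exists b : nat,
  forall (R : realDomainType) (n : nat) (d : 'I_n -> 'I_n -> R) (s0 : 'I_n),
    (forall x y, d x y = d y x) ->
    exists (mw md : seq nat) (k : nat) (st : state R) (t : seq 'I_n),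
      [/\ exec d (word_bound b n) mw md p (initial_state R n s0) k st,
          k <= T n,
          sumn mw + sumn md <= S n,
          n <= nth 0 mw 2 /\ output n st = [seq val s | s <- t]
        & cheapest_insertion_tour d s0 t].

Definition big_O (f g : nat -> nat) : Prop :=
  exists c N, forall m, N <= m -> f m <= c * g m.

(* Main.v *)
Require Import Defs.
From mathcomp Require Import all_boot all_order all_algebra.
From mathcomp Require Import zify lra.

Set Implicit Arguments.
Unset Strict Implicit.
Unset Printing Implicit Defensive.

Import Order.TTheory GRing.Theory Num.Theory.

(* A site x of the tour stands for the edge (x, next x), so a candidate for
   insertion is a pair (a, s) with a inside and s outside the tour, and one
   insertion changes the role of two sites only.  The heuristic thus amounts to
   maintaining a closest pair between two classes of elements, two of which
   change per step.

   Time O(n^2): a quadtree over the n x n table of candidates stores a best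
   candidate per cell; a changed site touches one row and one column of cells
   per level, which is O(n + n/2 + n/4 + ...) cells.

   Space O(n): conga lines, after Eppstein.  The elements are divided into
   levels.  The line of level l is a path from an element to its nearest unused
   partner, on to the nearest unused partner of that one, and so on, where each
   link involves a member of level l.  As every element is entered at most once, a
   changed site breaks at most one link per level; the origins of the broken
   links fall back to level 0, and the least l such that at most 2^l elements
   have level at most l is rebuilt, which lifts about half of its new members by a
   level or more.  A step loses O(log n) levels for each of O(log n) elements, so
   there are O(n log^2 n) searches for a partner, each in time O(n). *)

(** * A program logic for the machine *)

(** Take two elements of opposite classes, at least one of them a member of the level of a line.
    Hence a pair is guarded by a link that starts at one of its two elements, and losing a link
    harms only pairs of its origin: demoting that origin is enough to get them covered again. The
    potential is the sum of the levels. A line on at most 2^l elements costs O(n 2^l), and for l > 1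
    the minimality of l says that more than 2^(l-1) elements lie below level l. Each of them rises,
    so the potential grows in proportion to the cost, and only the demotions, O(log^2 n) levels per
    step, remain to be paid. Two features of the machine shape the programs. Distances cannot be
    subtracted, so costs are compared with the removed edges moved to opposite sides. Memory starts
    at 0 and a pair (x, x) is never a candidate, so the zero state is already an empty data
    structure that needs no initialization. *)

Fixpoint writes (c : cmd) : seq nat :=
  match c with
  | Skip => [::]
  | WSet x _ _ => [:: x]
  | DSet _ _ _ => [::]
  | Seq c1 c2 => writes c1 ++ writes c2
  | If _ c1 c2 => writes c1 ++ writes c2
  | While _ c1 => writes c1
  end.

(* Meaningful for commands without [While] only. *)
Fixpoint loopfree_cost (c : cmd) : nat :=
  match c with
  | Skip => 1
  | WSet _ ei e => (wcost ei + wcost e).+1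
  | DSet _ ei e => (wcost ei + dcost e).+1
  | Seq c1 c2 => (loopfree_cost c1 + loopfree_cost c2).+1
  | If b c1 c2 => (tcost b + maxn (loopfree_cost c1) (loopfree_cost c2)).+1
  | While b c1 => 0
  end.

Notation Var x := (WGet x (WConst 0)).
Notation "x ::= e" := (WSet x (WConst 0) e) (at level 60).
Notation "c1 ;; c2" := (Seq c1 c2) (at level 61, right associativity).

Definition For (i : nat) (bound : wexp) (c : cmd) : cmd :=
  i ::= WConst 0 ;;
  While (TNot (WLe bound (Var i))) (c ;; i ::= WOp Add (Var i) (WConst 1)).

Section Agree.
Variable R : Type.
Implicit Types st : state R.

(** Arrays are compared as functions, so that a frame condition rewrites inside predicates that take
    a whole array, such as a successor map. *)
Definition agree (xs : seq nat) st st' : Prop :=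
  forall x, x \notin xs -> words st' x = words st x.

Lemma agree_refl xs st : agree xs st st.
Proof. by []. Qed.

Lemma agree_trans xs st1 st2 st3 :
  agree xs st1 st2 -> agree xs st2 st3 -> agree xs st1 st3.
Proof. by move=> A B x xP; rewrite B // A. Qed.

Lemma agree_sub xs ys st st' :
  {subset xs <= ys} -> agree xs st st' -> agree ys st st'.
Proof. by move=> sub A x xP; apply: A; apply: contra xP; apply: sub. Qed.

End Agree.

Lemma upd_neq (T : Type) (m : nat -> nat -> T) x i v y :
  y != x -> upd m x i v y = m y.
Proof. by move=> /negbTE yx; rewrite /upd yx. Qed.

Lemma upd_same (T : Type) (m : nat -> nat -> T) x i v j :
  upd m x i v x j = if j == i then v else m x j.
Proof. by rewrite /upd eqxx. Qed.

Section Logic.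
Variables (R : realDomainType) (n : nat) (d : 'I_n -> 'I_n -> R).
Variables (W : nat) (mw md : seq nat).
Implicit Types (st : state R) (c : cmd).

(** Under this invariant the value read from a cell within its array never faults; [exec_small]
    shows that execution preserves it. *)
Definition small st : Prop := forall x i, words st x i < W.

(** A total extension of [d] to words, so that costs can be stated on memory contents without
    ordinals. A safe expression never reaches the default value. *)
Definition dist (i j : nat) : R :=
  if (insub i, insub j) is (Some a, Some b) then d a b else 0%R.

Lemma dist_ord (a b : 'I_n) : dist a b = d a b.
Proof. by rewrite /dist !valK. Qed.

(** Partial evaluation is split into a total value and a safety predicate; values can then be
    rewritten without carrying options along. *)
Fixpoint wval st e : nat :=
  match e with
  | WConst v => v
  | WGet x e1 => words st x (wval st e1)
  | WOp o e1 e2 => eval_op o (wval st e1) (wval st e2)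
  end.

(** A difference or quotient is at most its first operand, so only sums and products can
    overflow. *)
Fixpoint wsafe st e : Prop :=
  match e with
  | WConst v => v < W
  | WGet x e1 => wsafe st e1 /\ wval st e1 < nth 0 mw x
  | WOp o e1 e2 =>
      [/\ wsafe st e1, wsafe st e2
        & match o with
          | Add | Mul => eval_op o (wval st e1) (wval st e2) < W
          | Defs.Sub | Div => True
          end]
  end.

Lemma wsafe_lt st e : small st -> wsafe st e -> wval st e < W.
Proof.
move=> sm; elim: e => [v|x e IH|o e1 IH1 e2 IH2] /=; first by [].
  by move=> _; apply: sm.
case: o => [] [/IH1 lt1 _ //] _.
- by apply: leq_ltn_trans lt1; apply: leq_subr.
- by apply: leq_ltn_trans lt1; apply: leq_div.
Qed.

Lemma wevalE st e : small st -> wsafe st e -> weval W mw st e = Some (wval st e).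
Proof.
move=> sm; elim: e => [v /= lt|x e IH|o e1 IH1 e2 IH2].
- by rewrite /word lt.
- by case=> /IH /= -> ->; rewrite /word sm.
- move=> safe; have lt := wsafe_lt sm safe; case: safe => /= /IH1 -> /IH2 -> _.
  by move: lt => /=; rewrite /word => ->.
Qed.

Fixpoint dval st (e : dexp) : R :=
  match e with
  | DGet x e1 => dists st x (wval st e1)
  | DDist e1 e2 => dist (wval st e1) (wval st e2)
  | DAdd e1 e2 => (dval st e1 + dval st e2)%R
  end.

Fixpoint dsafe st (e : dexp) : Prop :=
  match e with
  | DGet x e1 => wsafe st e1 /\ wval st e1 < nth 0 md x
  | DDist e1 e2 =>
      [/\ wsafe st e1, wsafe st e2, wval st e1 < n & wval st e2 < n]
  | DAdd e1 e2 => dsafe st e1 /\ dsafe st e2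
  end.

Lemma devalE st e :
  small st -> dsafe st e -> deval d W mw md st e = Some (dval st e).
Proof.
move=> sm; elim: e => [x e|e1 e2|e1 IH1 e2 IH2] /=.
- by case=> safe lt; rewrite wevalE // lt.
- case=> s1 s2 lt1 lt2; rewrite !wevalE //.
  by rewrite /dist (insubT (fun m => m < n) lt1) (insubT (fun m => m < n) lt2).
- by case=> /IH1 -> /IH2 ->.
Qed.

Fixpoint test_val st (b : test) : bool :=
  match b with
  | WLe e1 e2 => wval st e1 <= wval st e2
  | DLe e1 e2 => (dval st e1 <= dval st e2)%R
  | TNot b1 => ~~ test_val st b1
  end.

Fixpoint tsafe st (b : test) : Prop :=
  match b with
  | WLe e1 e2 => wsafe st e1 /\ wsafe st e2
  | DLe e1 e2 => dsafe st e1 /\ dsafe st e2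
  | TNot b1 => tsafe st b1
  end.

Lemma tevalE st b :
  small st -> tsafe st b -> teval d W mw md st b = Some (test_val st b).
Proof.
move=> sm; elim: b => [e1 e2|e1 e2|b IH] /=.
- by case=> s1 s2; rewrite !wevalE.
- by case=> s1 s2; rewrite !devalE.
- by move=> /IH ->.
Qed.

Lemma weval_lt st e v : weval W mw st e = Some v -> v < W.
Proof.
have word_lt u : word W u = Some v -> v < W by rewrite /word; case: ifP => // + [<-].
case: e => [u|x e|o e1 e2] /=; first exact: word_lt.
- by case: weval => // i; case: ifP => // _ /word_lt.
- by do 2 case: weval => // ?; apply: word_lt.
Qed.

Lemma exec_small c st k st' : exec d W mw md c st k st' -> small st -> small st'.
Proof.
elim=> {c st k st'} //; try by auto.
move=> st x ei e i v _ /weval_lt lt _ sm y j /=.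
by rewrite /upd; case: ifP.
Qed.

Lemma exec_agree c st k st' :
  exec d W mw md c st k st' -> agree (writes c) st st'.
Proof.
elim=> {c st k st'} //=.
- by move=> st x ei e i v _ _ _ y /=; rewrite inE => yx; rewrite upd_neq.
- move=> c1 c2 st1 st2 st3 k1 k2 _ A1 _ A2; apply: (@agree_trans _ _ _ st2).
    by apply: agree_sub A1 => x; rewrite mem_cat => ->.
  by apply: agree_sub A2 => x; rewrite mem_cat orbC => ->.
- move=> b c1 c2 st1 st2 v k _ _; apply: agree_sub => x; rewrite mem_cat.
  by case: v => ->; rewrite ?orbT.
- by move=> b c st1 st2 st3 k1 k2 _ _ A1 _ A2; apply: agree_trans A1 A2.
Qed.

(** Total correctness in which the postcondition sees the running time: an amortized bound has to
    weigh the time against a potential of the final state. *)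
Definition ends st c (Q : nat -> state R -> Prop) : Prop :=
  small st -> exists k st',
    [/\ exec d W mw md c st k st', small st', agree (writes c) st st' & Q k st'].

Definition ends_within st c (T : nat) (Q : state R -> Prop) : Prop :=
  ends st c (fun k st' => k <= T /\ Q st').

Lemma ends_weaken st c (Q Q' : nat -> state R -> Prop) :
  ends st c Q ->
  (forall k st', agree (writes c) st st' -> Q k st' -> Q' k st') ->
  ends st c Q'.
Proof.
by move=> E H sm; have [k [st' [E1 sm1 A q]]] := E sm; exists k, st'; split; auto.
Qed.

Lemma within_weaken st c T T' (Q Q' : state R -> Prop) :
  ends_within st c T Q -> T <= T' ->
  (forall st', agree (writes c) st st' -> Q st' -> Q' st') ->
  ends_within st c T' Q'.
Proof.
move=> E le H; apply: ends_weaken E _ => k st' A [kT q].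
by split; [apply: leq_trans kT le | apply: H].
Qed.

Lemma ends_intro st c (Q : nat -> state R -> Prop) :
  (small st -> exists k st', exec d W mw md c st k st' /\ Q k st') -> ends st c Q.
Proof.
move=> H sm; have [k [st' [E q]]] := H sm; exists k, st'; split=> //.
  exact: exec_small E sm.
exact: exec_agree E.
Qed.

Lemma ends_seq st c1 c2 (Q : nat -> state R -> Prop) :
  ends st c1 (fun k1 st1 => ends st1 c2 (fun k2 st2 => Q (k1 + k2).+1 st2)) ->
  ends st (c1 ;; c2) Q.
Proof.
move=> E; apply: ends_intro => sm.
have [k1 [st1 [E1 sm1 _ H]]] := E sm.
have [k2 [st2 [E2 _ _ q]]] := H sm1.
by exists (k1 + k2).+1, st2; split=> //; apply: Exec_seq E1 E2.
Qed.

Lemma within_seq st c1 c2 T1 T2 (Q : state R -> Prop) :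
  ends_within st c1 T1 (fun st1 => ends_within st1 c2 T2 Q) ->
  ends_within st (c1 ;; c2) (T1 + T2).+1 Q.
Proof.
move=> E; apply: ends_seq; apply: ends_weaken E _ => k1 st1 _ [le1 E2].
by apply: ends_weaken E2 _ => k2 st2 _ [le2 q]; split=> //; rewrite ltnS leq_add.
Qed.

Lemma ends_wset st x ei e (Q : nat -> state R -> Prop) :
  wsafe st ei -> wsafe st e -> wval st ei < nth 0 mw x ->
  Q (wcost ei + wcost e).+1
    (State (upd (words st) x (wval st ei) (wval st e)) (dists st)) ->
  ends st (WSet x ei e) Q.
Proof.
move=> s1 s2 lt q; apply: ends_intro => sm; eexists _, _; split; last exact: q.
by apply: Exec_wset => //; apply: wevalE.
Qed.

Lemma ends_if st b c1 c2 (Q : nat -> state R -> Prop) :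
  tsafe st b ->
  ends st (if test_val st b then c1 else c2) (fun k st' => Q (tcost b + k).+1 st') ->
  ends st (If b c1 c2) Q.
Proof.
move=> safe E; apply: ends_intro => sm.
have [k [st' [E1 _ _ q]]] := E sm.
by exists (tcost b + k).+1, st'; split=> //; apply: Exec_if E1; apply: tevalE.
Qed.

Lemma within_if st b c1 c2 T (Q : state R -> Prop) :
  tsafe st b ->
  (test_val st b -> ends_within st c1 T Q) ->
  (~~ test_val st b -> ends_within st c2 T Q) ->
  ends_within st (If b c1 c2) (tcost b + T).+1 Q.
Proof.
move=> safe H1 H2; apply: ends_if => //.
by case: (test_val st b) H1 H2 => [/(_ isT) H _|_ /(_ isT) H];
  apply: ends_weaken H _ => k st' _ [le q]; split=> //; rewrite ltnS leq_add2l.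
Qed.

(** Recursion on the program lets simplification turn a loop-free goal into its side conditions.
    Loops go through [within_while] instead, and no program below writes a distance. *)
Fixpoint wp c (Q : state R -> Prop) st : Prop :=
  match c with
  | Skip => Q st
  | WSet x ei e =>
      [/\ wsafe st ei, wsafe st e, wval st ei < nth 0 mw x
        & Q (State (upd (words st) x (wval st ei) (wval st e)) (dists st))]
  | DSet _ _ _ => False
  | Seq c1 c2 => wp c1 (wp c2 Q) st
  | If b c1 c2 => tsafe st b /\ if test_val st b then wp c1 Q st else wp c2 Q st
  | While _ _ => False
  end.

Lemma within_wp st c T (Q : state R -> Prop) :
  loopfree_cost c <= T -> wp c Q st -> ends_within st c T Q.
Proof.
move=> leT H; apply: (@within_weaken _ _ (loopfree_cost c) _ Q) => // {T leT}.
elim: c Q st H => [|x ei e|//|c1 IH1 c2 IH2|b c1 IH1 c2 IH2|//] Q st /=.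
- by move=> q; apply: ends_intro => _; exists 1, st; split=> //; apply: Exec_skip.
- by case=> s1 s2 lt q; apply: ends_wset.
- move=> H; apply: within_seq; apply: (within_weaken (IH1 _ _ H)) => // st1 _.
  exact: IH2.
- case=> safe H; apply: ends_if => //.
  by case: (test_val st b) H => [/IH1|/IH2] E; apply: ends_weaken E _ => k st' _ [le q];
    split=> //; rewrite ltnS leq_add2l (leq_trans le) ?leq_maxl ?leq_maxr.
Qed.

(* The variant [m] bounds the number of iterations, [T] the amortized time of
   one; time in excess of [T] is paid by an increase of the potential [P]. *)
Lemma ends_while (I : nat -> state R -> Prop) (P : state R -> nat) st b c m T
    (Q : state R -> Prop) :
  I m st ->
  (forall m' st', agree (writes c) st st' -> I m' st' ->
     tsafe st' b /\ if test_val st' b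
     then 0 < m' /\
       ends st' c (fun k st1 => k + P st' <= P st1 + T /\ I m'.-1 st1)
     else Q st') ->
  ends st (While b c)
    (fun k st1 => k + P st <= P st1 + m.+1 * (T + tcost b).+1 /\ Q st1).
Proof.
move=> Im H.
suff E m1 st1 : I m1 st1 -> agree (writes c) st st1 ->
    ends st1 (While b c) (fun k st2 =>
      k + P st1 <= P st2 + m1.+1 * (T + tcost b).+1 /\ Q st2) by apply: E.
elim: m1 st1 => [|m1 IH] st1 I1 A1; have [safe] := H _ _ A1 I1.
  case tb: (test_val st1 b); [by case | move=> q]; apply: ends_intro => sm.
  exists (tcost b).+1, st1.
  by split; [apply: Exec_while_stop; rewrite tevalE // tb | split=> //; nia].
case tb: (test_val st1 b); [move=> [_ E]|move=> q]; apply: ends_intro => sm; last first.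
  exists (tcost b).+1, st1.
  by split; [apply: Exec_while_stop; rewrite tevalE // tb | split=> //; nia].
have [k [st2 [E2 sm2 A2 [kT I2]]]] := E sm.
have [k3 [st3 [E3 _ _ [k3T q]]]] := IH _ I2 (agree_trans A1 A2) sm2.
exists (tcost b + k + k3).+1, st3; split; last by split=> //; nia.
by apply: Exec_while_loop E2 E3; rewrite tevalE // tb.
Qed.

Lemma within_while (I : nat -> state R -> Prop) st b c m T (Q : state R -> Prop) :
  I m st ->
  (forall m' st', agree (writes c) st st' -> I m' st' ->
     tsafe st' b /\
     if test_val st' b
     then 0 < m' /\ ends_within st' c T (I m'.-1)
     else Q st') ->
  ends_within st (While b c) (m.+1 * (T + tcost b).+1) Q.
Proof.
move=> Im H.
apply: (ends_weaken (@ends_while I (fun=> 0) st b c m T Q Im _)) => [m' st' A|k st' _].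
  case/(H _ _ A) => safe E; split=> //; case: (test_val st' b) E => // -[m0 E].
  split=> //; apply: ends_weaken E _ => k st1 _; by rewrite addn0 add0n.
by rewrite addn0 add0n.
Qed.

(** The body must establish the invariant in the state whose counter is already advanced, hence the
    explicit updates of the counter cell in the hypotheses. *)
Lemma within_for (I : nat -> state R -> Prop) st i bound c m T (Q : state R -> Prop) :
  0 < nth 0 mw i -> i \notin writes c -> 1 < W ->
  (forall j st', j <= m -> agree (i :: writes c) st st' -> I j st' ->
     wsafe st' bound /\ wval st' bound = m) ->
  I 0 (State (upd (words st) i 0 0) (dists st)) ->
  (forall j st', j < m -> agree (i :: writes c) st st' -> words st' i 0 = j ->
     I j st' ->
     ends_within st' c T
       (fun st1 => I j.+1 (State (upd (words st1) i 0 j.+1) (dists st1)))) ->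
  (forall st', agree (i :: writes c) st st' -> I m st' -> Q st') ->
  ends_within st (For i bound c) (m.+1 * (T + wcost bound + 16)) Q.
Proof.
move=> li iW W1 Hb I0 Hc HQ.
have W0 : 0 < W by lia.
(* The increment with its sequencing node costs 7 and the test [wcost bound + 4]. The 4 units of
   initialization are absorbed by the 16 of the statement. *)
apply: (@within_weaken _ _ (3 + (m.+1 * ((T + 7) + (wcost bound + 4)).+1)).+1 _ Q);
  [|lia|by []].
apply: within_seq; apply: within_wp; first by [].
split=> //.
set st0 := State _ _.
have A0 : agree (i :: writes c) st st0.
  by move=> x; rewrite inE negb_or /= => /andP[xi _]; rewrite upd_neq.
apply: (@within_weaken _ _ (m.+1 * ((T + 7) +
    tcost (TNot (WLe bound (Var i)))).+1) _ Q) => //;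
  last by rewrite leq_mul2l /=; lia.
apply: (@within_while (fun m' st' => [/\ m' <= m,
  agree (i :: writes c) st st', words st' i 0 = m - m' & I (m - m') st'])).
  by split; rewrite ?subnn //= upd_same.
move=> m' st' _ [le A' e' I'] /=.
have [sb eb] := Hb _ _ (leq_subr m' m) A' I'.
have lb (sm : small st') : m < W by rewrite -eb; apply: wsafe_lt.
rewrite eb e'; split; first by [].
case: (leqP m (m - m')) => [ge|lt] /=.
  have e : m - m' = m by lia.
  by apply: HQ => //; rewrite -e.
have m0 : 0 < m' by lia.
split=> // sm; move: sm {lb}(lb sm) => /[swap] lb.
rewrite addnS; apply: within_seq.
have jm : m - m' < m by lia.
apply: within_weaken (Hc _ _ jm A' e' I') _ _ => // st1 A1 I1.
have ej : (m - m').+1 = m - m'.-1 by lia.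
have e1 : words st1 i 0 = m - m' by rewrite A1.
apply: within_wp => //=; rewrite !upd_same ?e1 !addn1 ej; split=> //.
  by split=> //; lia.
split; rewrite ?upd_same //; first by lia.
  move=> x; rewrite inE negb_or /= => /andP[xi xc].
  by rewrite upd_neq // A1 // A' // inE negb_or xi.
by rewrite -ej.
Qed.

End Logic.

(** * Tours and candidates *)

Section Tours.
Variables (n : nat).
Implicit Types (a b s x : 'I_n) (t : seq 'I_n).

Lemma insert_afterE t1 t2 a s :
  a \notin t1 -> insert_after (t1 ++ a :: t2) a s = t1 ++ a :: s :: t2.
Proof.
move=> at1; rewrite /insert_after index_cat (negbTE at1) /= eqxx addn0.
by rewrite take_cat drop_cat ltnNge leqnSn subSnn /= take0 drop0 -catA.
Qed.

Lemma insert_after_props t a s : uniq t -> a \in t -> s \notin t ->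
  [/\ uniq (insert_after t a s), size (insert_after t a s) = (size t).+1,
      insert_after t a s =i s :: t &
      forall x0, head x0 (insert_after t a s) = head x0 t].
Proof.
move=> + /path.splitPr E; case: E => t1 t2 U sN.
have at1 : a \notin t1.
  by move: U; rewrite cat_uniq /= negb_or => /and3P[_ /andP[]].
rewrite insert_afterE //.
have P : perm_eq (t1 ++ a :: s :: t2) (s :: t1 ++ a :: t2).
  by apply/permP => p; rewrite /= !count_cat /= ; lia.
split.
- by rewrite (perm_uniq P) /= sN.
- by rewrite (perm_size P).
- exact: perm_mem.
- by case: (t1).
Qed.

(** A cycle of a function determines successors, so it suffices that the new tour is a cycle of the
    expected successor map [f]. *)
Lemma next_insert_after t a s x : uniq t -> a \in t -> s \notin t -> x \in t ->
  next (insert_after t a s) x = (if x == a then s else next t x) /\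
  next (insert_after t a s) s = next t a.
Proof.
move=> U at_ st xt; have [U' _ M' _] := insert_after_props U at_ st.
pose f y := if y == a then s else if y == s then next t a else next t y.
have sa : s != a by apply: contra st => /eqP ->.
suff F : fcycle f (insert_after t a s).
  have nf y : y \in s :: t -> next (insert_after t a s) y = f y.
    by rewrite -M' => yt; have /eqP <- := next_cycle F yt.
  rewrite !nf ?inE ?eqxx ?xt ?orbT // /f (negbTE sa) eqxx; split=> //.
  by case: eqP => // _; case: eqP => // E; rewrite -E xt in st.
have := cycle_next U; rewrite /f; case/path.splitPr: at_ U st {xt M' U' f} => t1 t2 U st.
set f := (f in fcycle f (insert_after _ _ _)).
rewrite insert_afterE; last first.
  by move: U; rewrite cat_uniq /= negb_or => /and3P[_ /andP[]].
(* Both cycles are rotated so that [a] comes first. They then differ only at the front, and [f] is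
   the old successor map on the common rest. *)
rewrite -(rot_cycle (size t1)) rot_size_cat -[in X in _ -> X](rot_cycle (size t1)).
rewrite rot_size_cat /=.
have : s \notin t2 ++ t1
  by apply: contra st; rewrite !(mem_cat, inE) => /orP[] ->; rewrite ?orbT.
have : a \notin t2 ++ t1.
  by move: U; rewrite -(rot_uniq (size t1)) rot_size_cat /= => /andP[].
have fa : f a = s by rewrite /f eqxx.
have fs : f s = next (t1 ++ a :: t2) a by rewrite /f (negbTE sa) eqxx.
move: (t2 ++ t1) => r ar sr; rewrite fa eqxx /=.
case: r ar sr => [|b r] ar sr /=; first by rewrite fs.
case/andP=> /eqP nb P; rewrite fs nb eqxx /=.
have {P} : path (frel (next (t1 ++ a :: t2))) b (rcons r a) by [].
have: all (fun y => (y != a) && (y != s)) (b :: r).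
  by apply/allP => y yr; apply/andP; split; apply: contraNneq (ar) => E;
    rewrite E in yr; rewrite ?yr //; rewrite yr in sr.
elim: r b {ar sr nb} => [|c r IH] b /= /andP[/andP[ba bs] H].
  by rewrite /f /= (negbTE ba) (negbTE bs).
case/andP=> e P; apply/andP; split; last exact: IH.
by rewrite /f /= (negbTE ba) (negbTE bs).
Qed.

(** Hence [edge_length] agrees with [d] on the edges of every tour with at least two sites. *)
Lemma next_neq t x : uniq t -> x \in t -> 1 < size t -> next t x != x.
Proof.
move=> U /rot_to[i t' E] sz; rewrite -(next_rot i U) E.
have : uniq (x :: t') by rewrite -E rot_uniq.
have : 1 < size (x :: t') by rewrite -E size_rot.
by case: t' {E} => [|b t'] //= _; rewrite eqxx inE negb_or eq_sym => /andP[/andP[]].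
Qed.

Lemma next_nth_mod t x0 i : uniq t -> i < size t ->
  next t (nth x0 t i) = nth x0 t (if i.+1 == size t then 0 else i.+1).
Proof.
case: t => // y t U it; rewrite next_nth mem_nth // index_uniq //= eqSS.
case: eqP => [e|ne]; first by rewrite nth_default // e.
by apply: set_nth_default; move: it => /=; lia.
Qed.

End Tours.

Section Candidates.
Variables (R : realDomainType) (n : nat) (d : 'I_n -> 'I_n -> R).
Implicit Types (inT nx : nat -> nat) (p q r : nat * nat).

(* The candidate (a, s) is the insertion of s into the tour edge leaving a;
   [inT] marks the sites of the tour and [nx] is the successor map.  [cost] does
   not set the length of the loop edge to 0: as long as there is a loop edge it
   is the only edge, and its length cancels in all comparisons. *)
Definition valid inT p : bool := (0 < inT p.1) && (inT p.2 == 0).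

Definition cost nx p : R :=
  (dist d p.1 p.2 + dist d p.2 (nx p.1) - dist d p.1 (nx p.1))%R.

(** A preorder in which an invalid pair is beaten by every pair and beats only invalid ones. An
    invalid pair can thus stand for the optimum of an empty set of candidates. *)
Definition better nx inT p q : bool :=
  valid inT q ==> valid inT p && (cost nx p <= cost nx q)%R.

Lemma better_refl nx inT p : better nx inT p p.
Proof. by rewrite /better lexx andbT implybb. Qed.

Lemma better_trans nx inT q p r :
  better nx inT p q -> better nx inT q r -> better nx inT p r.
Proof.
move=> /implyP pq /implyP qr; apply/implyP => /qr /andP[/pq /andP[-> le1] le2].
exact: le_trans le1 le2.
Qed.

Lemma better_invalid nx inT p q : ~~ valid inT q -> better nx inT p q.
Proof. by rewrite /better => /negbTE ->. Qed.

(** This makes (0, 0), the content of untouched memory, a neutral starting value in searches and an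
    empty entry in tables. *)
Lemma valid_diag inT x : ~~ valid inT (x, x).
Proof. by rewrite /valid /=; case: (inT x). Qed.

End Candidates.

(** * Comparing candidates on the machine *)

Notation aN := 0 (only parsing).
Notation aStart := 1 (only parsing).
Notation aOut := 2 (only parsing).
Notation aNext := 3 (only parsing).
Notation aIn := 4 (only parsing).
Notation aBestE := 5 (only parsing).
Notation aBestS := 6 (only parsing).
Notation aIter := 7 (only parsing).
Notation aCandE := 8 (only parsing).
Notation aCandS := 9 (only parsing).
Notation aNew1 := 10 (only parsing).
Notation aNew2 := 11 (only parsing).

(** Arrays 0 to 11 belong to the insertion loop; those from 12 on are private to the data structure
    plugged into it. *)
Notation layout n priv := [:: 1, 1, n, n, n, 1, 1, 1, 1, 1, 1, 1 & priv].

Definition detour (e s : wexp) : dexp :=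
  DAdd (DDist e s) (DDist s (WGet aNext e)).

Definition tour_edge (e : wexp) : dexp := DDist e (WGet aNext e).

Definition accept : cmd := aBestE ::= Var aCandE ;; aBestS ::= Var aCandS.

(** In the comparison of distances each candidate is charged the tour edge that the other one would
    remove, which replaces the missing subtraction. *)
Definition offer (e s : wexp) : cmd :=
  aCandE ::= e ;; aCandS ::= s ;;
  If (WLe (WConst 1) (WGet aIn (Var aCandE)))
    (If (WLe (WGet aIn (Var aCandS)) (WConst 0))
      (If (WLe (WConst 1) (WGet aIn (Var aBestE)))
        (If (WLe (WGet aIn (Var aBestS)) (WConst 0))
          (If (DLe
              (DAdd (detour (Var aCandE) (Var aCandS)) (tour_edge (Var aBestE)))
              (DAdd (detour (Var aBestE) (Var aBestS)) (tour_edge (Var aCandE))))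
            accept Skip)
          accept)
        accept)
      Skip)
    Skip.

Fixpoint offers (cs : seq (wexp * wexp)) : cmd :=
  if cs is c :: cs' then offer c.1 c.2 ;; offers cs' else Skip.

Definition best (R : Type) (st : state R) := (words st aBestE 0, words st aBestS 0).

Section Offer.
Variables (R : realDomainType) (n : nat) (d : 'I_n -> 'I_n -> R).
Variables (W : nat) (priv md : seq nat).
Hypothesis W1 : 1 < W.
Notation mw := (layout n priv).
Implicit Types (st : state R).

Definition in_range st : Prop :=
  forall x, x < n -> words st aNext x < n.

Notation better_in st := (better d (words st aNext) (words st aIn)).

(** A candidate expression in a list is evaluated after earlier offers have overwritten the best and
    the candidate cells. The bound 40 leaves room for the address of a quadtree child, the longest
    expression offered. *)
Definition stable st e : Prop :=
  [/\ wcost e <= 40, wval st e < n &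
      forall st1, agree [:: aBestE; aBestS; aCandE; aCandS] st st1 ->
        wsafe W mw st1 e /\ wval st1 e = wval st e].

Definition candidates st (cs : seq (wexp * wexp)) : seq (nat * nat) :=
  [seq (wval st c.1, wval st c.2) | c <- cs].

Lemma within_offer st e s :
  in_range st -> (best st).1 < n -> (best st).2 < n ->
  stable st e -> stable st s ->
  let c := (wval st e, wval st s) in
  ends_within d W mw md st (offer e s) 200 (fun st' =>
    [/\ best st' = best st \/ best st' = c,
        better_in st (best st') (best st) & better_in st (best st') c]).
Proof.
move=> rng; rewrite /best.
set p := words st aBestE 0; set q := words st aBestS 0 => /= pn qn.
case=> [ce xn He] [cs yn Hs]; set x := wval st e; set y := wval st s.
have [|se _] := He st; first exact: agree_refl.
have W0 : 0 < W by lia.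
apply: within_wp; first by rewrite /=; lia.
rewrite [offer]lock /= -lock; split=> //=; rewrite -/x.
set st1 := State _ _; have [] := Hs st1.
  by move=> z; rewrite !inE !negb_or => /and4P[_ _ zx _] /=; rewrite upd_neq.
move=> s1 v1; split=> //; rewrite v1 -/y /=.
rewrite -/p -/q.
have xx := rng x xn; have pp := rng p pn.
split=> //; case: ifP => inx; last first.
  split; first by left.
    exact: better_refl.
  by apply: better_invalid; rewrite /valid /= inx.
split=> //; case: ifP => iny; last first.
  split; first by left.
    exact: better_refl.
  by apply: better_invalid; rewrite /valid /= -leqn0 iny andbF.
have vxy : valid (words st 4) (x, y) by rewrite /valid /= inx -leqn0.
have Acc : ~~ valid (words st 4) (p, q) ->
   [/\ (x, y) = (p, q) \/ (x, y) = (x, y), better_in st (x, y) (p, q)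
     & better_in st (x, y) (x, y)].
  by move=> nv; split; [right | exact: better_invalid | exact: better_refl].
split=> //; case: ifP => inp; last first.
  by do 2![split=> //]; apply: Acc; rewrite /valid /= inp.
split=> //; case: ifP => inq; last first.
  by do 2![split=> //]; apply: Acc; rewrite /valid /= -leqn0 inq andbF.
have vpq : valid (words st 4) (p, q) by rewrite /valid /= inp -leqn0.
split.
  by do ?split.
(* Linear arithmetic moves the two tour edges back to their own sides, which turns the outcome of
   the test into a comparison of costs. *)
case: ifP => le.
  do 2![split=> //]; split; [by right | | exact: better_refl].
  by rewrite /better vpq vxy /= /cost /=; move: le; lra.
split; [by left | exact: better_refl |].
rewrite /better vpq vxy /= /cost /=; move/negbT: le; rewrite -ltNge; lra.
Qed.

Lemma within_offers st cs :
  in_range st -> (best st).1 < n -> (best st).2 < n ->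
  (forall c, List.In c cs -> stable st c.1 /\ stable st c.2) ->
  ends_within d W mw md st (offers cs) (201 * size cs + 1) (fun st' =>
    best st' \in best st :: candidates st cs /\
    all (better_in st (best st')) (best st :: candidates st cs)).
Proof.
elim: cs st => [|[e s] cs IH] st rng p1 p2 Hcs.
  apply: within_wp => //=; rewrite mem_head better_refl.
  by split.
have [He Hs] := Hcs (e, s) (or_introl erefl).
rewrite [size _]/= (_ : 201 * (size cs).+1 + 1 = (200 + (201 * size cs + 1)).+1); last by lia.
apply: within_seq; apply: within_weaken (within_offer rng p1 p2 He Hs) _ _ => //.
rewrite [fst _]/= [snd _]/= => st1 A1 [B1 b1 b2].
have {}A1 : agree [:: aBestE; aBestS; aCandE; aCandS] st st1.
  by apply: agree_sub A1; apply/allP.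
have E3 : words st1 aNext = words st aNext by apply: A1.
have E4 : words st1 aIn = words st aIn by apply: A1.
have stable1 e' : stable st e' -> stable st1 e'.
  case=> c' l' H; have [_ E'] := H _ A1; split; rewrite ?E' // => st2 A2.
  exact: H (agree_trans A1 A2).
have val1 e' : stable st e' -> wval st1 e' = wval st e' by case=> _ _ /(_ _ A1)[].
have Ec : candidates st1 cs = candidates st cs.
  rewrite /candidates; elim: (cs) Hcs => //= c cs' IHcs Hcs.
  have [] := Hcs c (or_intror (or_introl erefl)) => /val1 -> /val1 ->.
  by rewrite IHcs // => c' [<-|c'cs]; apply: Hcs; [left | right; right].
have [_ x1 _] := He; have [_ y1 _] := Hs.
have n1 : (best st1).1 < n by case: B1 => ->.
have n2 : (best st1).2 < n by case: B1 => ->.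
have rng1 : in_range st1 by move=> z zn; rewrite E3; apply: rng.
have Hcs1 c : List.In c cs -> stable st1 c.1 /\ stable st1 c.2.
  by move=> cin; have [] := Hcs c (or_intror cin); split; apply: stable1.
apply: within_weaken (IH st1 rng1 n1 n2 Hcs1) _ _ => // st2 _.
rewrite Ec E3 E4 /= => -[B2 /andP[b3 b4]]; split.
  move: B2; rewrite !inE; case/orP => [/eqP ->|->]; last by rewrite !orbT.
  by case: B1 => ->; rewrite eqxx ?orbT.
by rewrite b4 (better_trans b3 b1) (better_trans b3 b2).
Qed.

End Offer.

(** * The insertion loop *)

(** The successor of [aBestE] is copied before it is overwritten. Called with both ends equal to the
    start, the command creates the loop edge of the one-site tour. *)
Definition link : cmd :=
  WSet aNext (Var aBestS) (WGet aNext (Var aBestE)) ;;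
  WSet aNext (Var aBestE) (Var aBestS) ;;
  WSet aIn (Var aBestS) (WConst 1) ;;
  aNew1 ::= Var aBestE ;; aNew2 ::= Var aBestS.

Definition walk : cmd :=
  aBestE ::= Var aStart ;;
  For aIter (Var aN)
    (WSet aOut (Var aIter) (Var aBestE) ;; aBestE ::= WGet aNext (Var aBestE)).

Definition insertion_loop (find repair : cmd) : cmd :=
  While (TNot (WLe (Var aN) (Var aIter)))
    (find ;; link ;; repair ;; aIter ::= WOp Add (Var aIter) (WConst 1)).

Definition insertion_program (find repair : cmd) : cmd :=
  aBestE ::= Var aStart ;; aBestS ::= Var aStart ;; link ;; repair ;;
  aIter ::= WConst 1 ;; insertion_loop find repair ;; walk.

Section Main.
Variables (R : realDomainType) (n : nat) (d : 'I_n -> 'I_n -> R) (s0 : 'I_n).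
Variables (W : nat) (priv md : seq nat).
Hypothesis W1 : n.+1 < W.
Notation mw := (layout n priv).
Implicit Types (st : state R) (t : seq 'I_n).
Notation better_in st := (better d (words st aNext) (words st aIn)).

Definition optimal st p : Prop :=
  [/\ p.1 < n, p.2 < n, valid (words st aIn) p
    & forall a s, a < n -> s < n -> better_in st p (a, s)].

Lemma within_link st a s :
  best st = (a, s) -> a < n -> s < n -> in_range n st ->
  ends_within d W mw md st link 40 (fun st' =>
    [/\ words st' aNext = (fun x => if x == a then s else
          if x == s then words st aNext a else words st aNext x),
        words st' aIn = (fun x => if x == s then 1 else words st aIn x),
        words st' aNew1 0 = a & words st' aNew2 0 = s]).
Proof.
move=> [Ea Es] an sn rng; apply: within_wp; first by [].
have W0 : 0 < W by lia.
have W2 : 1 < W by lia.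
rewrite /= Ea Es; cbn; rewrite ?Ea ?Es.
by do 5![split=> //; cbn; rewrite ?Ea ?Es].
Qed.

(** The interface of a candidate structure. [repair] is called when successors and marks have
    changed at no more than two sites since a clean state. Increases of [pot] pay for long repairs,
    so the total time telescopes to the amortized costs plus the final potential, which [Pmax]
    bounds. *)
Variables (find repair : cmd) (Clean : state R -> Prop) (pot : state R -> nat).
Variables (Tf Tr Pmax : nat).
Hypothesis find_writes :
  all (fun x => x \notin writes find) [:: aN; aStart; aNext; aIn; aIter].
Hypothesis repair_writes :
  all (fun x => x \notin writes repair) [:: aN; aStart; aNext; aIn; aIter].
Hypothesis find_spec : forall st,
  words st aN 0 = n -> in_range n st -> Clean st ->
  (exists a s, [/\ a < n, s < n & valid (words st aIn) (a, s)]) ->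
  ends_within d W mw md st find Tf (fun st' =>
    [/\ Clean st', pot st' = pot st & optimal st (best st')]).
Hypothesis repair_spec : forall st st1 x1 x2,
  Clean st -> words st1 aN 0 = n -> in_range n st1 ->
  agree [:: aNext; aIn; aBestE; aBestS; aNew1; aNew2] st st1 ->
  words st1 aNew1 0 = x1 -> words st1 aNew2 0 = x2 -> x1 < n -> x2 < n ->
  (forall y, y != x1 -> y != x2 ->
     words st1 aNext y = words st aNext y /\ words st1 aIn y = words st aIn y) ->
  ends d W mw md st1 repair (fun k st' =>
    k + pot st <= pot st' + Tr /\ Clean st').
Hypothesis Clean_iter : forall st st',
  agree [:: aIter] st st' -> Clean st -> Clean st' /\ pot st' = pot st.
Hypothesis pot_max : forall st, Clean st -> pot st <= Pmax.

Definition tour_state t st : Prop :=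
  [/\ words st aN 0 = n /\ words st aStart 0 = s0, in_range n st,
      forall x : 'I_n, words st aIn x = (x \in t) &
      forall x : 'I_n, x \in t -> words st aNext x = next t x].

Definition reached t : Prop :=
  [/\ heuristic_reaches d s0 t, uniq t, s0 \in t & head s0 t = s0].

Lemma optimal_step t st a s : reached t -> tour_state t st ->
  optimal st (a, s) ->
  exists a' s' : 'I_n, [/\ a = a', s = s', a' \in t, s' \notin t &
    reached (insert_after t a' s')].
Proof.
move=> [reach U s0t hd] [_ _ inE_ nextE] [/= an sn v opt].
exists (Ordinal an), (Ordinal sn).
have v_ord (x y : 'I_n) : valid (words st aIn) (val x, val y) = (x \in t) && (y \notin t).
  by rewrite /valid /= !inE_ lt0b eqb0.
have /andP[at_ st_] : (Ordinal an \in t) && (Ordinal sn \notin t) by rewrite -v_ord.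
have [U' _ M' hd'] := insert_after_props U at_ st_.
split=> //; split; rewrite ?hd' // ?M' ?inE ?s0t ?orbT //.
apply: Heuristic_step reach _; exists (Ordinal an), (Ordinal sn); split=> //.
move=> a' s' a't s't.
have := opt _ _ (ltn_ord a') (ltn_ord s').
rewrite /better v_ord a't s't v /= /cost /=.
have := nextE _ at_; rewrite /= => ->; rewrite (nextE _ a't).
rewrite -[a]/(val (Ordinal an)) -[s]/(val (Ordinal sn)) !dist_ord.
rewrite /insertion_cost /edge_length; set A := Ordinal an; set S := Ordinal sn.
(* In the one-site tour all candidates remove the same loop edge. Its length, 0 in the specification
   and a value of [d] in [cost], cancels on both sides. *)
have [sz|sz] := leqP (size t) 1.
  have {sz} sz : size t = 1 by move: at_; case: (t) sz => [|? []].
  case: t sz {U s0t hd inE_ nextE v_ord U' M' hd' st_ s't opt} at_ a't => [|x [|]] //= _.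
  by rewrite -/A !inE => /eqP -> /eqP ->; rewrite !eqxx !subr0 lerD2r.
by rewrite ![_ == next _ _]eq_sym !(negbTE (next_neq U _ sz)).
Qed.

Lemma loop_iteration t st : reached t -> tour_state t st -> Clean st ->
  words st aIter 0 = size t -> size t < n ->
  ends d W mw md st
    (find ;; link ;; repair ;; aIter ::= WOp Add (Var aIter) (WConst 1))
    (fun k st' => k + pot st <= pot st' + (Tf + Tr + 70) /\
       exists t', [/\ reached t', tour_state t' st', Clean st',
                      words st' aIter 0 = size t' & size t' = (size t).+1]).
Proof.
move=> rt ts cl it szt; case: (ts) => [[nE sE] rng inE_ nextE].
have [fN fS fX fI fT] : [/\ aN \notin writes find, aStart \notin writes find,
   aNext \notin writes find, aIn \notin writes find & aIter \notin writes find].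
  by move: find_writes => /=; do 5?case/andP=> ? ; split.
have [rN rS rX rI rT] : [/\ aN \notin writes repair, aStart \notin writes repair,
   aNext \notin writes repair, aIn \notin writes repair & aIter \notin writes repair].
  by move: repair_writes => /=; do 5?case/andP=> ? ; split.
apply: ends_seq.
have ex : exists a s, [/\ a < n, s < n & valid (words st aIn) (a, s)].
  have s0t : s0 \in t by case: rt.
  have [s st_] : exists s, s \notin t.
    apply/existsP; rewrite -negb_forall; apply: contraL szt => /forallP al.
    have U : uniq t by case: rt.
    rewrite -leqNgt -(card_uniqP U) -[n in n <= _]card_ord; apply: subset_leq_card.
    by apply/subsetP => x _; apply: al.
  by exists s0, s; rewrite /valid /= !inE_ s0t (negbTE st_).
apply: ends_weaken (find_spec nE rng cl ex) _ => k1 st1 A1 [le1 [cl1 pe opt]].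
have E1 : [/\ words st1 aN = words st aN, words st1 aStart = words st aStart,
  words st1 aNext = words st aNext, words st1 aIn = words st aIn &
  words st1 aIter = words st aIter] by split; apply: A1.
case: E1 => e0 e1 e3 e4 e7.
have ts1 : tour_state t st1 by split=> [||x|x xt]; rewrite ?/in_range ?e0 ?e1 ?e3 ?e4 //; auto.
have opt1 : optimal st1 (best st1) by rewrite /optimal e3 e4.
have [a [s [Ea Es at_ st_ rt']]] := optimal_step rt ts1 opt1.
have rng1 : in_range n st1 by case: ts1.
have Eb : best st1 = (a : nat, s : nat) by rewrite /best Ea Es.
apply: ends_seq; apply: ends_weaken (within_link Eb (ltn_ord a) (ltn_ord s) rng1) _.
move=> k2 st2 A2 [le2 [n2 i2 x1 x2]].
have [_ U _ _] := rt.
have nst := next_insert_after U at_ st_.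
have [U' sz' M' _] := insert_after_props U at_ st_.
have rng2 : in_range n st2.
  by move=> x xn; rewrite n2; case: eqP => _ //; case: eqP => _; apply: rng1.
have RS : ends d W mw md st2 repair (fun k st' =>
    k + pot st1 <= pot st' + Tr /\ Clean st').
  apply: (repair_spec cl1 _ rng2 _ x1 x2) => //.
  - by rewrite A2 ?e0.
  - by apply: agree_sub A2; apply/allP.
  - by move=> y /negbTE y1 /negbTE y2; rewrite n2 i2 y1 y2.
apply: ends_seq; apply: ends_weaken RS _.
move=> k3 st3 A3 [le3 cl3].
have it3 : words st3 aIter 0 = size t by rewrite A3 // A2 // e7.
apply: (@ends_weaken _ _ _ _ _ _ _ _ (fun k st' => k <= 20 /\
   st' = State (upd (words st3) aIter 0 (size t).+1) (dists st3))).
  have lt : (size t).+1 < W by apply: leq_trans W1; rewrite !ltnS ltnW.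
  have W0 : 0 < W by apply: leq_trans lt.
  have W2 : 1 < W by apply: leq_trans lt; rewrite ltnS.
  by apply: within_wp => //=; rewrite it3 addn1; do 3?split.
move=> k4 st4 A4 [le4 E4].
have [cl4 pe4] := Clean_iter A4 cl3.
split; first by move: le1 le2 le3 le4 pe pe4; clear; lia.
exists (insert_after t a s); split=> //.
- have e (x : nat) : x \in [:: aN; aStart; aNext; aIn] -> words st4 x = words st2 x.
    by rewrite !inE => /or4P[] /eqP->; rewrite A4 // A3.
  split.
  + by rewrite !e // !A2 // e0 e1.
  + by rewrite /in_range e.
  + move=> x; rewrite e // i2 M' inE e4 inE_ val_eqE; case: eqP => //= ->.
  + move=> x; rewrite M' e // n2 !val_eqE inE e3 => /orP[/eqP->|xt].
      have [_ ->] := nst _ at_; rewrite eqxx; case: eqP => [sa|_].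
        by rewrite sa at_ in st_.
      exact: nextE.
    have [-> _] := nst _ xt; case: eqP => // xa; case: eqP => [xs|_].
      by rewrite -xs xt in st_.
    exact: nextE.
- by rewrite E4 /= upd_same eqxx sz'.
Qed.

Lemma within_insertion_loop st : reached [:: s0] -> tour_state [:: s0] st ->
  Clean st -> words st aIter 0 = 1 ->
  ends d W mw md st (insertion_loop find repair) (fun k st' =>
    k + pot st <= pot st' + n * (Tf + Tr + 80) /\
    exists t, [/\ reached t, tour_state t st', Clean st' & size t = n]).
Proof.
move=> r1 ts1 c1 it1; have n0 : 0 < n by apply: leq_ltn_trans (ltn_ord s0).
pose I m st' := exists t, [/\ reached t, tour_state t st', Clean st',
  words st' aIter 0 = size t & size t + m = n].
pose b := TNot (WLe (Var aN) (Var aIter)).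
have I1 : I n.-1 st by exists [:: s0]; split=> //=; rewrite add1n prednK.
apply: (ends_weaken (@ends_while _ _ _ _ _ _ I pot st b _ n.-1 (Tf + Tr + 70)
  (fun st' => I 0 st') I1 _)) => [m st' _ [t [rt ts cl it sz]]|k st' _ [le It]].
  have W0 : 0 < W by apply: leq_trans W1.
  split=> //=; case: (ts) => [[-> _] _ _ _]; rewrite it.
  case: (leqP n (size t)) => [le|lt] /=.
    exists t; split=> //; move: sz le; clear; lia.
  split; first by move: sz lt; clear; lia.
  apply: ends_weaken (loop_iteration rt ts cl it lt) _.
  move=> k st2 _ [le [t' [rt' ts' cl' it' sz']]]; split=> //; exists t'; split=> //.
  by move: sz sz' lt; clear; lia.
split; first by move: le n0; rewrite /b /=; clear; case: (n) => //= m; nia.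
by case: It => t [rt ts cl it sz]; exists t; split=> //; move: sz; rewrite addn0.
Qed.

Lemma within_walk st t : reached t -> tour_state t st -> size t = n ->
  ends_within d W mw md st walk (n * 60 + 60) (fun st' =>
    output n st' = [seq val s | s <- t]).
Proof.
move=> [_ U _ hd] [[nE sE] rng _ nextE] sz.
have W0 : 0 < W by apply: leq_trans W1.
have W2 : 1 < W by apply: leq_trans W1; rewrite !ltnS.
(* After the last site the cursor has wrapped around to the start. *)
pose cur j := nat_of_ord (nth s0 t (if j == n then 0 else j)).
have cur0 : cur 0 = s0.
  by rewrite /cur if_same; case: (t) hd => [|x r] //= ->.
apply: (@within_weaken _ _ _ _ _ _ _ _ (5 + n.+1 * (20 + 2 + 16)).+1 _ (fun st' =>
    output n st' = [seq val s | s <- t])) => //; last by clear; lia.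
apply: within_seq; apply: within_wp => //=; split=> //.
pose I j (st' : state R) := (forall i, i < j -> words st' aOut i = nth s0 t i) /\
  words st' aBestE 0 = cur j.
apply: (within_for (I := I) (m := n)) => //.
- move=> j st' _ A _ /=; split=> //.
  by rewrite A //= upd_neq.
- by split; rewrite //= upd_neq // upd_same eqxx sE cur0.
- move=> j st' jn A jE [out e5]; apply: within_wp => //=; rewrite jE e5.
  have cn : cur j < n by apply: ltn_ord.
  rewrite /I /upd /= e5; split=> //; split=> //; split.
    move=> i; rewrite ltnS leq_eqVlt => /orP[/eqP->|ij].
      by rewrite eqxx /cur; case: eqP jn => // ->; rewrite ltnn.
    by rewrite (ltn_eqF ij) out.
  rewrite A //= upd_neq // /cur (ltn_eqF jn) nextE ?mem_nth ?sz // (next_nth_mod s0) ?sz //.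
- move=> st' _ [out _]; rewrite /output.
  apply: (@eq_from_nth _ 0) => [|i]; first by rewrite !size_map size_iota.
  rewrite size_map size_iota => lt.
  by rewrite (nth_map 0) ?size_iota // (nth_map s0) ?sz // nth_iota // out.
Qed.

Hypothesis Clean_init : Clean (initial_state R n s0).

Theorem insertion_program_correct :
  exists k st t,
    [/\ exec d W mw md (insertion_program find repair) (initial_state R n s0) k st,
        k <= Pmax + n * (Tf + Tr + 200) + Tr + 200,
        output n st = [seq val s | s <- t] & cheapest_insertion_tour d s0 t].
Proof.
have W0 : 0 < W by apply: leq_trans W1.
have W2 : 1 < W by apply: leq_trans W1; rewrite !ltnS.
have nW : n < W by apply: ltn_trans W1.
have sn := ltn_ord s0.
pose st0 := initial_state R n s0.
have sm : small W st0.
  move=> x i; rewrite /st0 /= /upd; case: ifP => _; first exact: ltn_trans nW.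
  by case: ifP.
suff E : ends d W mw md st0 (insertion_program find repair) (fun k st =>
    k <= Pmax + n * (Tf + Tr + 200) + Tr + 200 /\
    exists t, output n st = [seq val s | s <- t] /\ cheapest_insertion_tour d s0 t).
  have [k [st [E1 _ _ [le [t [o c]]]]]] := E sm.
  by exists k, st, t.
apply: ends_seq; apply: ends_wset => //=.
apply: ends_seq; apply: ends_wset => //=.
set st2 := State _ _.
have b2 : best st2 = (s0 : nat, s0 : nat) by [].
have rng0 : in_range n st2 by move=> x _; rewrite /st2 /= /upd /=; apply: leq_ltn_trans sn.
apply: ends_seq; apply: ends_weaken (within_link b2 sn sn rng0) _.
move=> k3 st3 A3 [le3 [n3 i3 x1 x2]].
have A03 : agree [:: aNext; aIn; aBestE; aBestS; aNew1; aNew2] st0 st3.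
  apply: (@agree_trans _ _ _ st2); last by apply: agree_sub A3; apply/allP.
  move=> x; rewrite !inE !negb_or => /andP[_ /and4P[_ x5 x6 _]].
  exact: etrans (upd_neq _ _ _ x6) (upd_neq _ _ _ x5).
have rng3 : in_range n st3.
  by move=> x xn; rewrite n3; case: eqP => _ //; apply: rng0.
(* The trivial tour counts as a change at the single site [s0] relative to the clean zero state, so
   both changed sites are [s0]. *)
have RS : ends d W mw md st3 repair (fun k st' =>
    k + pot st0 <= pot st' + Tr /\ Clean st').
  apply: (repair_spec Clean_init _ rng3 _ x1 x2) => //.
    by rewrite A03.
  by move=> y /negbTE y1 _; rewrite n3 i3 y1.
have [rN rS rX rI rT] : [/\ aN \notin writes repair, aStart \notin writes repair,
   aNext \notin writes repair, aIn \notin writes repair & aIter \notin writes repair].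
  by move: repair_writes => /=; do 5?case/andP=> ? ; split.
apply: ends_seq; apply: ends_weaken RS _ => k4 st4 A4 [le4 cl4].
apply: ends_seq; apply: ends_wset => //=.
set st5 := State _ _.
have A5 : agree [:: aIter] st4 st5 by move=> x; rewrite inE => x7; rewrite /st5 /= upd_neq.
have [cl5 pe5] := Clean_iter A5 cl4.
have r1 : reached [:: s0] by split; rewrite ?inE //; apply: Heuristic_start.
have ts5 : tour_state [:: s0] st5.
  have e x : x \in [:: aN; aStart; aNext; aIn] -> words st5 x = words st3 x.
    by rewrite !inE => /or4P[] /eqP->; rewrite A5 // A4.
  split.
  - by rewrite !e // !A03.
  - by move=> x xn; rewrite e //; apply: rng3.
  - by move=> x; rewrite e // i3 inE val_eqE; case: eqP.
  - by move=> x; rewrite e // n3 inE => /eqP->; rewrite eqxx /= eqxx.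
apply: ends_seq.
apply: ends_weaken (within_insertion_loop r1 ts5 cl5 _) _; first by rewrite /= upd_same.
move=> k6 st6 _ [le6 [t [rt ts cl sz]]].
apply: ends_weaken (within_walk rt ts sz) _ => k7 st7 _ [le7 out].
split.
  by move: (pot_max cl) le3 le4 le6 le7 pe5; clear; nia.
exists t; split=> //; split; first by case: rt.
have U : uniq t by case: rt.
move=> s; apply: contraT => st_.
have : size (s :: t) <= #|'I_n|.
  have U' : uniq (s :: t) by rewrite /= st_.
  by rewrite -(card_uniqP U') max_card.
by rewrite /= sz card_ord ltnn.
Qed.

End Main.

(** * Quadratic time: a quadtree of best candidates *)

Notation aCellE := 12 (only parsing).
Notation aCellS := 13 (only parsing).
Notation aLevel := 14 (only parsing).
Notation aRow1 := 15 (only parsing).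
Notation aRow2 := 16 (only parsing).
Notation aMax := 17 (only parsing).
Notation aPos := 18 (only parsing).
Notation aI := 19 (only parsing).
Notation aJ := 20 (only parsing).

(** The numeral with digits k, i, j in base n + 1. Giving every level a full square makes the table
    cubic in size, but only cells that are written cost time. *)
Definition address (n k i j : nat) : nat := (k * n.+1 + i) * n.+1 + j.

Definition address_exp (k i j : wexp) : wexp :=
  let n1 := WOp Add (Var aN) (WConst 1) in
  WOp Add (WOp Mul (WOp Add (WOp Mul k n1) i) n1) j.

Definition set_cell (k i j e s : wexp) : cmd :=
  WSet aCellE (address_exp k i j) e ;; WSet aCellS (address_exp k i j) s.

Definition set_leaf (x y : nat) : cmd :=
  set_cell (WConst 0) (Var x) (Var y) (Var x) (Var y).

Definition child_address (u v : nat) : wexp :=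
  address_exp (WOp Defs.Sub (Var aLevel) (WConst 1))
    (WOp Add (WOp Mul (WConst 2) (Var aI)) (WConst u))
    (WOp Add (WOp Mul (WConst 2) (Var aJ)) (WConst v)).

Definition child (u v : nat) : wexp * wexp :=
  (WGet aCellE (child_address u v), WGet aCellS (child_address u v)).

Definition merge_children : cmd :=
  aBestE ::= WConst 0 ;; aBestS ::= WConst 0 ;;
  offers [:: child 0 0; child 0 1; child 1 0; child 1 1] ;;
  set_cell (Var aLevel) (Var aI) (Var aJ) (Var aBestE) (Var aBestS).

Definition merge (i j : nat) : cmd :=
  aI ::= Var i ;; aJ ::= Var j ;; merge_children.

Definition quad_find : cmd :=
  aBestE ::= WGet aCellE (address_exp (Var aLevel) (WConst 0) (WConst 0)) ;;
  aBestS ::= WGet aCellS (address_exp (Var aLevel) (WConst 0) (WConst 0)).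

(** A site may be the inner or the outer component of a candidate, so each of the two changed sites
    touches a row and a column. *)
Definition cross (f : nat -> nat -> cmd) (x y : nat) : cmd :=
  f x aPos ;; f aPos x ;; f y aPos ;; f aPos y.

Definition set_leaves : cmd :=
  For aPos (Var aN) (cross set_leaf aNew1 aNew2).

Definition merge_level : cmd :=
  For aPos (WOp Add (Var aMax) (WConst 1)) (cross merge aRow1 aRow2).

(** At level k the index of the last block is (n - 1) / 2^k, kept in [aMax]; the loop ends at the
    level with a single block, and [aLevel] then names the root for [quad_find]. *)
Definition quad_repair : cmd :=
  set_leaves ;;
  aLevel ::= WConst 0 ;; aRow1 ::= Var aNew1 ;; aRow2 ::= Var aNew2 ;;
  aMax ::= WOp Defs.Sub (Var aN) (WConst 1) ;;
  While (WLe (WConst 1) (Var aMax))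
    (aLevel ::= WOp Add (Var aLevel) (WConst 1) ;;
     aRow1 ::= WOp Div (Var aRow1) (WConst 2) ;;
     aRow2 ::= WOp Div (Var aRow2) (WConst 2) ;;
     aMax ::= WOp Div (Var aMax) (WConst 2) ;;
     merge_level).

Lemma address_inj n k i j k' i' j' :
  i <= n -> j <= n -> i' <= n -> j' <= n ->
  address n k i j = address n k' i' j' -> [/\ k = k', i = i' & j = j'].
Proof.
move=> ni nj ni' nj' E.
have split_eq a b a' b' : b <= n -> b' <= n ->
    a * n.+1 + b = a' * n.+1 + b' -> a = a' /\ b = b'.
  rewrite -[b <= n]ltnS -[b' <= n]ltnS => bn bn' e; split; first by have := congr1 (divn^~ n.+1) e;
    rewrite !divnMDl // !divn_small // !addn0.
  by have := congr1 (modn^~ n.+1) e; rewrite !modnMDl !modn_small.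
have [E1 ->] := split_eq _ _ _ _ nj nj' E.
by have [-> ->] := split_eq _ _ _ _ ni ni' E1.
Qed.

Lemma address_lt n k i j : k <= n -> i <= n -> j <= n ->
  [/\ address n k i j < n.+1 ^ 3, (k * n.+1 + i) * n.+1 < n.+1 ^ 3,
      k * n.+1 + i < n.+1 ^ 3 & k * n.+1 < n.+1 ^ 3].
Proof. by rewrite /address !expnS expn0 => kn in_ jn; split; nia. Qed.

Definition scratch := [:: aBestE; aBestS; aCandE; aCandS; aCellE; aCellS; aI; aJ].

Section Quad.
Variables (R : realDomainType) (n : nat) (d : 'I_n -> 'I_n -> R) (s0 : 'I_n).
Variables (W : nat) (md : seq nat) (cells : nat).
Hypothesis cells_def : n.+1 ^ 3 = cells.
Hypothesis W_cells : cells + 3 < W.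
Notation mw := (layout n [:: cells; cells; 1; 1; 1; 1; 1; 1; 1]).
Implicit Types (st : state R).
Notation better_in st := (better d (words st aNext) (words st aIn)).

Definition below k i j (p : nat * nat) : bool :=
  (p.1 %/ 2 ^ k == i) && (p.2 %/ 2 ^ k == j).

(* Cell (k, i, j) holds a best candidate (a, s) with a in the i-th and s in the
   j-th block of length 2 ^ k; a diagonal pair stands for the absence of one. *)
Definition good nx inT k i j (c : nat * nat) : Prop :=
  [/\ c.1 < n, c.2 < n, (c.1 == c.2) || below k i j c &
      forall a s, a < n -> s < n -> below k i j (a, s) -> better d nx inT c (a, s)].

Definition cell st k i j : nat * nat :=
  (words st aCellE (address n k i j), words st aCellS (address n k i j)).

Definition good_at st k i j : Prop :=
  good (words st aNext) (words st aIn) k i j (cell st k i j).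

(** Phrased as preservation of all good cells plus one new one, so that consecutive writes
    compose. *)
Definition gains st st' k i j : Prop :=
  forall k' i' j', k' <= n -> i' <= n -> j' <= n ->
    good_at st k' i' j' \/ (k', i', j') = (k, i, j) -> good_at st' k' i' j'.

Lemma gains_write st st' k i j c : k <= n -> i <= n -> j <= n ->
  words st' = upd (upd (words st) aCellE (address n k i j) c.1)
                aCellS (address n k i j) c.2 ->
  good (words st aNext) (words st aIn) k i j c -> gains st st' k i j.
Proof.
move=> kn in_ jn E g k' i' j' kn' in' jn'.
rewrite /good_at /cell E /upd /=.
case: eqP => [/address_inj[] // -> -> -> _|ne]; first by case: (c) g.
by case=> // -[E1 E2 E3]; case: ne; rewrite E1 E2 E3.
Qed.

Lemma good_leaf nx inT x y : x < n -> y < n -> good nx inT 0 x y (x, y).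
Proof.
move=> xn yn; split=> //; first by rewrite /below !divn1 /= !eqxx orbT.
by move=> a s _ _; rewrite /below !divn1 /= => /andP[/eqP-> /eqP->]; apply: better_refl.
Qed.

Lemma below_child k i j a s : below k.+1 i j (a, s) ->
  exists u v, [/\ u < 2, v < 2 & below k (2 * i + u) (2 * j + v) (a, s)].
Proof.
rewrite /below /= !expnSr !divnMA => /andP[/eqP<- /eqP<-].
exists (a %/ 2 ^ k %% 2), (s %/ 2 ^ k %% 2); split; rewrite ?ltn_mod //.
by rewrite ![2 * _]mulnC -!divn_eq !eqxx.
Qed.

Lemma child_below k i j u v p : u < 2 -> v < 2 ->
  below k (2 * i + u) (2 * j + v) p -> below k.+1 i j p.
Proof.
rewrite /below /= !expnSr !divnMA => u2 v2 /andP[/eqP-> /eqP->].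
by rewrite ![2 * _]mulnC !divnMDl // !divn_small // !addn0 !eqxx.
Qed.

Let W0 : 0 < W. Proof. by move: W_cells; clear; lia. Qed.
Let W3 : 3 < W. Proof. by move: W_cells; clear; lia. Qed.
Let n1W : n.+1 < W.
Proof. by move: W_cells; rewrite -cells_def; clear; rewrite !expnS expn0; nia. Qed.

Lemma address_W k i j : k <= n -> i <= n -> j <= n ->
  [/\ address n k i j < cells, address n k i j < W,
      (k * n.+1 + i) * n.+1 < W, k * n.+1 + i < W & k * n.+1 < W].
Proof.
move=> kn in_ jn; have [] := address_lt kn in_ jn; rewrite cells_def.
by move: W_cells; clear => W_cells l1 l2 l3 l4; split; lia.
Qed.

Lemma address_exp_safe st ek ei ej k i j :
  words st aN 0 = n -> k <= n -> i <= n -> j <= n ->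
  wsafe W mw st ek -> wsafe W mw st ei -> wsafe W mw st ej ->
  wval st ek = k -> wval st ei = i -> wval st ej = j ->
  [/\ wsafe W mw st (address_exp ek ei ej),
      wval st (address_exp ek ei ej) = address n k i j &
      wval st (address_exp ek ei ej) < cells].
Proof.
move=> nE kn in_ jn sk si sj vk vi vj.
have [l0 l1 l2 l3 l4] := address_W kn in_ jn.
have W1 : 1 < W by exact: leq_trans W3.
by rewrite /= nE vk vi vj addn1; split.
Qed.

(** [set_cell] evaluates the address a second time after it has written [aCellE]. *)
Definition keeps st e v : Prop :=
  forall st1, agree [:: aCellE] st st1 -> wsafe W mw st1 e /\ wval st1 e = v.

Lemma keeps_var st x : nth 0 mw x = 1 -> x != aCellE -> keeps st (Var x) (words st x 0).
Proof.
move=> x1 xc st1 A; split; first by split; rewrite /= ?x1.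
by rewrite /= A // inE.
Qed.

Lemma within_set_cell st ek ei ej e1 e2 k i j c1 c2 :
  words st aN 0 = n -> k <= n -> i <= n -> j <= n ->
  all (fun e => wcost e <= 2) [:: ek; ei; ej; e1; e2] ->
  keeps st ek k -> keeps st ei i -> keeps st ej j ->
  keeps st e1 c1 -> keeps st e2 c2 ->
  good (words st aNext) (words st aIn) k i j (c1, c2) ->
  ends_within d W mw md st (set_cell ek ei ej e1 e2) 60
    (fun st' => gains st st' k i j).
Proof.
move=> nE kn in_ jn cs Kk Ki Kj K1 K2 g.
apply: within_wp.
  by move: cs => /= /and5P[c1' c2' c3 c4 /andP[c5 _]]; move: c1' c2' c3 c4 c5; clear; lia.
have A0 : agree [:: aCellE] st st by [].
have [sk vk] := Kk _ A0; have [si vi] := Ki _ A0; have [sj vj] := Kj _ A0.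
have [s1 v1] := K1 _ A0.
have [sa va la] := address_exp_safe nE kn in_ jn sk si sj vk vi vj.
split=> //; rewrite va v1; set st1 := State _ _.
have A1 : agree [:: aCellE] st st1.
  by move=> x; rewrite inE => xc; apply: upd_neq.
have [sk' vk'] := Kk _ A1; have [si' vi'] := Ki _ A1; have [sj' vj'] := Kj _ A1.
have [s2 v2] := K2 _ A1.
have nE1 : words st1 aN 0 = n by [].
have [sa' va' la'] := address_exp_safe nE1 kn in_ jn sk' si' sj' vk' vi' vj'.
by split=> //; rewrite va' v2; apply: gains_write g.
Qed.

Lemma within_set_leaf st x y X Y :
  words st aN 0 = n -> x \in [:: aNew1; aNew2; aPos] -> y \in [:: aNew1; aNew2; aPos] ->
  words st x 0 = X -> words st y 0 = Y -> X < n -> Y < n ->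
  ends_within d W mw md st (set_leaf x y) 60
    (fun st' => gains st st' 0 X Y).
Proof.
move=> nE xv yv <- <- Xn Yn.
have nth1 z : z \in [:: aNew1; aNew2; aPos] -> nth 0 mw z = 1 /\ z != aCellE.
  by rewrite !inE => /or3P[] /eqP->.
have K z : z \in [:: aNew1; aNew2; aPos] -> keeps st (Var z) (words st z 0).
  by move=> /nth1[]; apply: keeps_var.
apply: within_set_cell; rewrite ?leq0n ?(ltnW Xn) ?(ltnW Yn) //; try exact: K.
exact: good_leaf.
Qed.

(** Every candidate below the parent lies below one child, whose cell beats it, and the best pair
    beats all four cells. It is one of them or the diagonal starting value. The bounds on [2 * i]
    and [2 * j] keep even a child past the last block inside the table. *)
Lemma within_merge_children st k i j :
  words st aN 0 = n -> in_range n st -> k < n -> i <= n -> j <= n ->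
  words st aLevel 0 = k.+1 -> words st aI 0 = i -> words st aJ 0 = j ->
  2 * i < n -> 2 * j < n ->
  (forall u v, u < 2 -> v < 2 -> good_at st k (2 * i + u) (2 * j + v)) ->
  ends_within d W mw md st merge_children 1000
    (fun st' => gains st st' k.+1 i j).
Proof.
move=> nE rng kn in_ jn kE iE jE i2 j2 gc.
have n0 : 0 < n by apply: leq_ltn_trans i2.
(* Offering the four children costs [201 * 4 + 1], that is 805. *)
apply: (@within_weaken _ _ _ _ _ _ _ _ (3 + (3 + (805 + 60).+1).+1).+1 _
  (fun st' => gains st st' k.+1 i j)) => //.
have W1 : 1 < W by exact: leq_trans W3.
have W2 : 2 < W by exact: leq_trans W3.
have nW : n < W by apply: ltn_trans n1W.
apply: within_seq; apply: within_wp => //; split=> //.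
apply: within_seq; apply: within_wp => //; split=> //.
set st1 := State _ _.
have A1 : agree [:: aBestE; aBestS] st st1.
  move=> x; rewrite !inE !negb_or => /andP[x5 x6].
  exact: etrans (upd_neq _ _ _ x6) (upd_neq _ _ _ x5).
have St u v : u < 2 -> v < 2 -> let c := cell st k (2 * i + u) (2 * j + v) in
    [/\ stable n W [:: cells; cells; 1; 1; 1; 1; 1; 1; 1] st1 (child u v).1,
        stable n W [:: cells; cells; 1; 1; 1; 1; 1; 1; 1] st1 (child u v).2,
        wval st1 (child u v).1 = c.1 & wval st1 (child u v).2 = c.2].
  move=> u2 vv2.
  have iu : 2 * i + u <= n by move: i2 u2; clear; lia.
  have jv : 2 * j + v <= n by move: j2 vv2; clear; lia.
  have uW : u < W by apply: leq_trans W2; apply: ltnW.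
  have vW : v < W by apply: leq_trans W2; apply: ltnW.
  have ea st2 : agree [:: aBestE; aBestS; aCandE; aCandS] st st2 ->
     [/\ wsafe W mw st2 (child_address u v),
      wval st2 (child_address u v) = address n k (2 * i + u) (2 * j + v) &
      wval st2 (child_address u v) < cells].
    move=> A; have e x : x \in [:: aN; aLevel; aI; aJ] -> words st2 x = words st x.
      by rewrite !inE => /or4P[] /eqP->; apply: A.
    apply: address_exp_safe => //=; rewrite ?e // ?(ltnW kn) //.
    - by rewrite iE; split; rewrite ?(leq_ltn_trans iu nW) //; split=> //;
        apply: ltn_trans nW.
    - by rewrite jE; split; rewrite ?(leq_ltn_trans jv nW) //; split=> //;
        apply: ltn_trans nW.
    - by rewrite kE subn1.
    - by rewrite iE.
    - by rewrite jE.
  have A2 : agree [:: aBestE; aBestS; aCandE; aCandS] st st1.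
    by apply: agree_sub A1; apply/allP.
  have [_ va _] := ea _ A2; have [c1 c2 _ _] := gc _ _ u2 vv2.
  have E12 st2 : agree [:: aBestE; aBestS; aCandE; aCandS] st st2 ->
      words st2 aCellE = words st aCellE /\ words st2 aCellS = words st aCellS.
    by move=> A; split; apply: A.
  have [e12 e13] := E12 _ A2.
  have v1 st2 : wval st2 (child u v).1 = words st2 aCellE (wval st2 (child_address u v)).
    by [].
  have v2 st2 : wval st2 (child u v).2 = words st2 aCellS (wval st2 (child_address u v)).
    by [].
  split.
  - split=> [||st2 A]; [by [] | by rewrite v1 va e12 |].
    have A3 := agree_trans A2 A; have [s3 v3 l3] := ea _ A3.
    split; first by split.
    by rewrite !v1 v3 va; have [e12' e13'] := E12 _ A3; rewrite e12' e12.
  - split=> [||st2 A]; [by [] | by rewrite v2 va e13 |].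
    have A3 := agree_trans A2 A; have [s3 v3 l3] := ea _ A3.
    split; first by split.
    by rewrite !v2 v3 va; have [e12' e13'] := E12 _ A3; rewrite e13' e13.
  - by rewrite v1 va e12.
  - by rewrite v2 va e13.
have rng1 : in_range n st1 by move=> x; rewrite A1 //; apply: rng.
pose cs := [:: child 0 0; child 0 1; child 1 0; child 1 1].
have Hcs c : List.In c cs ->
    stable n W [:: cells; cells; 1; 1; 1; 1; 1; 1; 1] st1 c.1 /\
    stable n W [:: cells; cells; 1; 1; 1; 1; 1; 1; 1] st1 c.2.
  have St' u v : u < 2 -> v < 2 ->
    stable n W [:: cells; cells; 1; 1; 1; 1; 1; 1; 1] st1 (child u v).1 /\
    stable n W [:: cells; cells; 1; 1; 1; 1; 1; 1; 1] st1 (child u v).2.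
    by move=> u2 v2; case: (St u v u2 v2).
  by case=> [<-|[<-|[<-|[<-|[]]]]]; apply: St'.
apply: within_seq.
have OF := @within_offers _ _ d _ _ md W1 st1 cs rng1 n0 n0 Hcs.
apply: (within_weaken OF) => // st2 A2.
have cand u v : u < 2 -> v < 2 ->
    (wval st1 (child u v).1, wval st1 (child u v).2) = cell st k (2 * i + u) (2 * j + v).
  by move=> u2 v2; have [_ _ -> ->] := St u v u2 v2.
rewrite /candidates /cs [map _ _]/= !cand //.
have -> : best st1 = (0, 0) by [].
rewrite (A1 aNext) // (A1 aIn) // => -[B bb].
have Av : agree [:: aBestE; aBestS; aCandE; aCandS] st st2.
  apply: (@agree_trans _ _ _ st1); first by apply: agree_sub A1; apply/allP.
  by apply: agree_sub A2; apply/allP.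
have e x : x \in [:: aN; aNext; aIn; aCellE; aCellS; aLevel; aI; aJ] ->
    words st2 x = words st x.
  rewrite !inE => xs; apply: Av; move: xs.
  by do 7?[case/orP; first by move=> /eqP->]; move/eqP->.
have g : good (words st aNext) (words st aIn) k.+1 i j (best st2).
  move: (best st2) B bb => c B /allP bb.
  have ch u v : u < 2 -> v < 2 -> cell st k (2 * i + u) (2 * j + v) = c ->
      [/\ c.1 < n, c.2 < n & (c.1 == c.2) || below k.+1 i j c].
    move=> u2 v2 <-; have [l1 l2 l3 _] := gc _ _ u2 v2; split=> //.
    by case/orP: l3 => [-> //|/(child_below u2 v2) ->]; rewrite orbT.
  have [l1 l2 l3] : [/\ c.1 < n, c.2 < n & (c.1 == c.2) || below k.+1 i j c].
    move: B; rewrite !inE => /or4P[/eqP->//|/eqP cE|/eqP cE|/orP[]/eqP cE].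
    - exact: (ch 0 0).
    - exact: (ch 0 1).
    - exact: (ch 1 0).
    - exact: (ch 1 1).
  split=> // a s an sn /below_child[u [v [u2 v2 b]]].
  have [_ _ _ /(_ a s an sn b)] := gc _ _ u2 v2; apply: better_trans; apply: bb.
  by case: u u2 {b} => [|[|u]] // _; case: v v2 => [|[|v]] // _; rewrite !inE eqxx ?orbT.
have K x : nth 0 mw x = 1 -> x != aCellE -> keeps st2 (Var x) (words st2 x 0).
  exact: keeps_var.
have kE2 : words st2 aLevel 0 = k.+1 by rewrite e.
have iE2 : words st2 aI 0 = i by rewrite e.
have jE2 : words st2 aJ 0 = j by rewrite e.
apply: within_weaken (@within_set_cell st2 _ _ _ _ _ k.+1 i j _ _ _ kn in_ jn _ _ _ _
  (K aBestE _ _) (K aBestS _ _) _) _ _ => //.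
- by rewrite e.
- by rewrite -kE2; apply: K.
- by rewrite -iE2; apply: K.
- by rewrite -jE2; apply: K.
- by rewrite (e aNext) // (e aIn).
- move=> st3 _ G k' i' j' kn' in' jn' H; apply: G => //.
  by case: H => [H|]; [left; rewrite /good_at /cell !e | right].
Qed.

Lemma within_merge st k i j I J :
  words st aN 0 = n -> in_range n st -> k < n ->
  words st aLevel 0 = k.+1 ->
  i \in [:: aRow1; aRow2; aPos] -> j \in [:: aRow1; aRow2; aPos] ->
  words st i 0 = I -> words st j 0 = J -> 2 * I < n -> 2 * J < n ->
  (forall i' j', i' <= n -> j' <= n -> good_at st k i' j') ->
  ends_within d W mw md st (merge i j) 1010
    (fun st' => gains st st' k.+1 I J).
Proof.
move=> nE rng kn kE iv jv iE jE I2 J2 gc.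
have W1 : 1 < W by exact: leq_trans W3.
have nth1 z : z \in [:: aRow1; aRow2; aPos] -> nth 0 mw z = 1 /\ z != aI.
  by rewrite !inE => /or3P[] /eqP->.
apply: (@within_weaken _ _ _ _ _ _ _ _ (4 + (4 + 1000).+1).+1 _
  (fun st' => gains st st' k.+1 I J)) => //.
have [ni zi] := nth1 _ iv; have [nj zj] := nth1 _ jv.
apply: within_seq; apply: within_wp => //; split=> //.
  by split=> //=; rewrite ni.
apply: within_seq; apply: within_wp => //; split=> //.
  by split=> //=; rewrite nj.
set st1 := State _ _.
apply: (within_weaken (@within_merge_children st1 k I J _ _ _ _ _ _ _ _ _ _ _)) => //.
- by move: I2; clear; lia.
- by move: J2; clear; lia.
- by rewrite /st1 /= /upd /= (negbTE zj).
- move=> u v u2 v2; apply: gc.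
    by move: I2 u2; clear; lia.
  by move: J2 v2; clear; lia.
Qed.

(** Shared by the pass over the leaves and the pass over a merged level: [f] only has to make its
    cell good without spoiling others. *)
Lemma within_cross_loop st k f x y X Y bound m T :
  (forall a b, {subset writes (f a b) <= scratch}) ->
  x != aPos -> y != aPos -> x \notin scratch -> y \notin scratch ->
  words st x 0 = X -> words st y 0 = Y -> X < m -> Y < m ->
  (forall st', agree (aPos :: scratch) st st' ->
     wsafe W mw st' bound /\ wval st' bound = m) ->
  (forall st1 a b A B, agree (aPos :: scratch) st st1 ->
     (forall k' i j, k' <= n -> i <= n -> j <= n ->
        good_at st k' i j -> good_at st1 k' i j) ->
     a \in [:: x; y; aPos] -> b \in [:: x; y; aPos] ->
     words st1 a 0 = A -> words st1 b 0 = B -> A < m -> B < m ->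
     ends_within d W mw md st1 (f a b) T (fun st' => gains st1 st' k A B)) ->
  ends_within d W mw md st (For aPos bound (cross f x y))
    (m.+1 * (4 * T + 3 + wcost bound + 16)) (fun st' =>
    forall k' i j, k' <= n -> i <= n -> j <= n ->
      good_at st k' i j \/ (k' = k /\
        ((i \in [:: X; Y]) && (j < m) || (j \in [:: X; Y]) && (i < m))) ->
      good_at st' k' i j).
Proof.
move=> wf xp yp xs ys xE yE Xm Ym Hb Hf.
have wc : {subset writes (cross f x y) <= scratch}.
  by move=> z; rewrite /= !mem_cat => /or4P[]; apply: wf.
have Asub c st1 st2 : {subset writes c <= scratch} ->
    agree (writes c) st1 st2 -> agree scratch st1 st2 by apply: agree_sub.
have Apos st1 st2 : agree scratch st1 st2 -> agree (aPos :: scratch) st1 st2.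
  by apply: agree_sub => z zs; rewrite in_cons zs orbT.
have Afor st1 st2 : agree (aPos :: writes (cross f x y)) st1 st2 ->
    agree (aPos :: scratch) st1 st2.
  apply: agree_sub => z; rewrite in_cons => /orP[zp|/wc zs]; rewrite in_cons.
    by rewrite zp.
  by rewrite zs orbT.
pose I q (st' : state R) := forall k' i j, k' <= n -> i <= n -> j <= n ->
  good_at st k' i j \/ (k' = k /\
    ((i \in [:: X; Y]) && (j < q) || (j \in [:: X; Y]) && (i < q))) ->
  good_at st' k' i j.
apply: (within_for (I := I) (m := m)) => //.
- by apply/negP => /wc.
- by apply: leq_trans W3.
- by move=> j st' _ /Afor A _; apply: Hb.
- by move=> k' i j _ _ _ [//|[_]]; rewrite !ltn0 !andbF.
- move=> q st1 qm /Afor A1 qE I1.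
  have R0 : 4 * T + 3 = (T + (T + (T + T).+1).+1).+1 by clear; lia.
  rewrite R0.
  have step st2 a b A B : agree (aPos :: scratch) st st2 ->
     (forall k' i j, k' <= n -> i <= n -> j <= n ->
        good_at st k' i j -> good_at st2 k' i j) ->
     a \in [:: x; y; aPos] -> b \in [:: x; y; aPos] ->
     words st2 a 0 = A -> words st2 b 0 = B -> A < m -> B < m ->
     ends_within d W mw md st2 (f a b) T (fun st' =>
       [/\ gains st2 st' k A B, agree (aPos :: scratch) st st',
           words st' aPos 0 = words st2 aPos 0
         & forall k' i j, k' <= n -> i <= n -> j <= n ->
             good_at st k' i j -> good_at st' k' i j]).
    move=> A2 mono av bv aE bE Am Bm.
    apply: (within_weaken (Hf st2 a b A B A2 mono av bv aE bE Am Bm)) => // st3 A3 G.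
    have {}A3 := Asub _ _ _ (wf a b) A3.
    split=> //; first exact: agree_trans A2 (Apos _ _ A3).
      by rewrite A3.
    by move=> k' i j kn in_ jn g; apply: G => //; left; apply: mono.
  have xv : x \in [:: x; y; aPos] by rewrite inE eqxx.
  have yv : y \in [:: x; y; aPos] by rewrite !inE eqxx orbT.
  have pv : aPos \in [:: x; y; aPos] by rewrite !inE eqxx !orbT.
  have xE' st2 : agree (aPos :: scratch) st st2 -> words st2 x 0 = X.
    by move=> A; rewrite A // in_cons negb_or xp.
  have yE' st2 : agree (aPos :: scratch) st st2 -> words st2 y 0 = Y.
    by move=> A; rewrite A // in_cons negb_or yp.
  have mono1 k' i j : k' <= n -> i <= n -> j <= n ->
    good_at st k' i j -> good_at st1 k' i j by move=> *; apply: I1 => //; left.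
  apply: within_seq.
  apply: (within_weaken (step st1 x aPos X q A1 mono1 xv pv (xE' _ A1) qE Xm qm)) => //.
  move=> st2 _ [G2 A2 q2 mono2]; rewrite qE in q2.
  apply: within_seq.
  apply: (within_weaken (step st2 aPos x q X A2 mono2 pv xv q2 (xE' _ A2) qm Xm)) => //.
  move=> st3 _ [G3 A3 q3 mono3]; rewrite q2 in q3.
  apply: within_seq.
  apply: (within_weaken (step st3 y aPos Y q A3 mono3 yv pv (yE' _ A3) q3 Ym qm)) => //.
  move=> st4 _ [G4 A4 q4 mono4]; rewrite q3 in q4.
  apply: (within_weaken (step st4 aPos y q Y A4 mono4 pv yv q4 (yE' _ A4) qm Ym)) => //.
  move=> st5 _ [G5 _ _ _] k' i j kn in_ jn H.
  suff: good_at st5 k' i j by [].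
  (* Compared with the previous position, the only cells still to be obtained are the four that this
     iteration writes. *)
  have up : good_at st1 k' i j \/ (k', i, j) \in
     [:: (k, X, q); (k, q, X); (k, Y, q); (k, q, Y)].
    case: H => [g|[ke H]]; first by left; apply: mono1.
    case E : ((i \in [:: X; Y]) && (j < q) || (j \in [:: X; Y]) && (i < q)).
      by left; apply: I1 => //; right; rewrite E.
    right; rewrite ke; case/orP: H => /andP[v]; rewrite ltnS leq_eqVlt =>
      /orP[/eqP->|lt]; try by rewrite v lt ?orbT in E.
      by move: v; rewrite !inE => /orP[]/eqP->; rewrite eqxx ?orbT.
    by move: v; rewrite !inE => /orP[]/eqP->; rewrite eqxx ?orbT.
  case: up => [g|]; last rewrite !inE.
    by apply: G5 => //; left; apply: G4 => //; left; apply: G3 => //; left; apply: G2 => //; left.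
  case/or4P=> /eqP e.
  + by apply: G5 => //; left; apply: G4 => //; left; apply: G3 => //; left; apply: G2 => //; right.
  + by apply: G5 => //; left; apply: G4 => //; left; apply: G3 => //; right.
  + by apply: G5 => //; left; apply: G4 => //; right.
  + by apply: G5 => //; right.
Qed.

(** A level above the leaves is built exactly when the level under it has more than one block. *)
Definition used k : bool := (k == 0) || (0 < n.-1 %/ 2 ^ k.-1).

Lemma used_le k : 0 < n -> used k -> k <= n.
Proof.
case: k => [//|k] n0 /orP[//|]; rewrite /= divn_gt0 ?expn_gt0 // => le.
by apply: leq_trans (leq_pred n); apply: leq_trans le; apply: ltn_expl.
Qed.

(** The last clause says that level [aLevel] has one block. It is conditional on a nonempty tour
    because the zero state has to be clean although no root has been built yet. *)
Definition quad_clean st : Prop :=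
  [/\ forall k i j, used k -> i <= n -> j <= n -> good_at st k i j,
      used (words st aLevel 0) &
      (exists2 x, x < n & 0 < words st aIn x) -> n.-1 < 2 ^ words st aLevel 0].

(** Either the candidates of the cell avoid both changed sites, or the cell lies past the last block
    and has no candidates. *)
Definition untouched x1 x2 k i j : bool :=
  let xs := [:: x1 %/ 2 ^ k; x2 %/ 2 ^ k] in
  [|| (i \notin xs) && (j \notin xs), n.-1 %/ 2 ^ k < i | n.-1 %/ 2 ^ k < j].

(** Validity and cost of a pair depend on data of its own two sites only. The stored pair lies below
    the cell too, unless it is diagonal; then it is invalid and no candidate of the cell is
    valid. *)
Lemma good_frame st st1 x1 x2 k i j :
  words st1 aCellE = words st aCellE -> words st1 aCellS = words st aCellS ->
  (forall y, y != x1 -> y != x2 ->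
     words st1 aNext y = words st aNext y /\ words st1 aIn y = words st aIn y) ->
  untouched x1 x2 k i j -> good_at st k i j -> good_at st1 k i j.
Proof.
move=> eE eS same un; rewrite /good_at.
have -> : cell st1 k i j = cell st k i j by rewrite /cell eE eS.
case: (cell st k i j) => c1 c2 [/= l1 l2 db opt]; split=> // a s an sn b.
have le x : x < n -> x %/ 2 ^ k <= n.-1 %/ 2 ^ k.
  by move=> xn; apply: leq_div2r; rewrite -ltnS prednK // (leq_ltn_trans _ xn).
have keep a' s' : a' < n -> s' < n -> below k i j (a', s') ->
    valid (words st1 aIn) (a', s') = valid (words st aIn) (a', s') /\
    cost d (words st1 aNext) (a', s') = cost d (words st aNext) (a', s').
  move=> an' sn' /andP[/= /eqP ea /eqP es].
  case/or3P: un => [/andP[]|lt|lt]; last 2 first.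
  - by have := le _ an'; rewrite ea leqNgt lt.
  - by have := le _ sn'; rewrite es leqNgt lt.
  rewrite !inE !negb_or -ea -es => /andP[a1 a2] /andP[s1 s2].
  have ne x y : x %/ 2 ^ k != y %/ 2 ^ k -> x != y by apply: contra => /eqP->.
  have [na ia] := same _ (ne _ _ a1) (ne _ _ a2).
  have [ns is_] := same _ (ne _ _ s1) (ne _ _ s2).
  by rewrite /valid /cost /= na ia is_.
have [va ca] := keep _ _ an sn b.
have := opt _ _ an sn b; rewrite /better va ca; case vv: valid => //= /andP[vc].
have bc : below k i j (c1, c2).
  case/orP: db => // /eqP e; move: vc; rewrite e.
  by rewrite (negbTE (valid_diag _ _)).
by have [-> ->] := keep _ _ l1 l2 bc; rewrite vc.
Qed.

Lemma quad_clean_iter st st' : agree [:: aIter] st st' ->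
  quad_clean st -> quad_clean st' /\ 0 = 0.
Proof.
move=> A; have e x : x != aIter -> words st' x = words st x.
  by move=> xi; apply: A; rewrite inE.
by rewrite /quad_clean /good_at /cell !e.
Qed.

Lemma quad_clean_init : quad_clean (initial_state R n s0).
Proof.
split=> //; last by case=> x.
move=> k i j _ _ _; by split=> //=; apply: leq_ltn_trans (ltn_ord s0).
Qed.

Lemma quad_find_spec st :
  words st aN 0 = n -> in_range n st -> quad_clean st ->
  (exists a s, [/\ a < n, s < n & valid (words st aIn) (a, s)]) ->
  ends_within d W mw md st quad_find 100 (fun st' =>
    [/\ quad_clean st', 0 = 0 & optimal d st (best st')]).
Proof.
move=> nE rng [gc uk lt] [a [s [an sn v]]].
have n0 : 0 < n by apply: leq_ltn_trans an.
have W1 : 1 < W by exact: leq_trans W3.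
have {}lt : n.-1 < 2 ^ words st aLevel 0.
  by apply: lt; exists a => //; case/andP: v.
have := gc _ 0 0 uk (leq0n n) (leq0n n).
have kn := used_le n0 uk.
set k := words st aLevel 0 in lt uk kn *.
case=> l1 l2 _ opt.
have small x : x < n -> x %/ 2 ^ k = 0.
  by move=> xn; apply: divn_small; apply: leq_ltn_trans lt; rewrite -ltnS prednK.
have {}opt a' s' : a' < n -> s' < n ->
    better d (words st aNext) (words st aIn) (cell st k 0 0) (a', s').
  by move=> an' sn'; apply: opt => //; rewrite /below /= !small.
pose root := address_exp (Var aLevel) (WConst 0) (WConst 0).
have Sf st1 : words st1 aN = words st aN -> words st1 aLevel = words st aLevel ->
    [/\ wsafe W mw st1 root, wval st1 root = address n k 0 0 & wval st1 root < cells].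
  by move=> e0 e1; apply: address_exp_safe; rewrite /= ?e0 ?e1.
have [sa va la] := Sf st erefl erefl.
apply: within_wp => //; split; [exact: W0 | by split | by [] |].
set st1 := State _ _; have [sa1 va1 la1] := Sf st1 erefl erefl.
split; [exact: W0 | by split | by [] |].
set st2 := State _ _.
have -> : best st2 = (words st aCellE (wval st root), words st1 aCellS (wval st1 root)).
  by [].
rewrite va va1.
split=> //.
split=> //; have := opt _ _ an sn.
by rewrite /better v => /andP[].
Qed.

Lemma within_set_leaves st x1 x2 :
  words st aN 0 = n -> words st aNew1 0 = x1 -> words st aNew2 0 = x2 ->
  x1 < n -> x2 < n ->
  ends_within d W mw md st set_leaves (n.+1 * 261) (fun st' =>
    forall k i j, k <= n -> i <= n -> j <= n ->
      good_at st k i j \/ (k = 0 /\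
        ((i \in [:: x1; x2]) && (j < n) || (j \in [:: x1; x2]) && (i < n))) ->
      good_at st' k i j).
Proof.
move=> nE e1 e2 n1 n2.
apply: (within_weaken (@within_cross_loop st 0 set_leaf aNew1 aNew2 x1 x2 (Var aN) n
  60 _ _ _ _ _ e1 e2 n1 n2 _ _)) => //.
- by move=> a b; apply/allP.
- by move=> st' A; rewrite /= A // nE.
- move=> st1 a b A B A1 _ av bv aE bE An Bn.
  by apply: within_set_leaf => //; rewrite A1.
Qed.

Lemma within_merge_level st k x1 x2 m :
  words st aN 0 = n -> in_range n st -> k < n -> words st aLevel 0 = k.+1 ->
  words st aRow1 0 = x1 -> words st aRow2 0 = x2 -> words st aMax 0 = m ->
  x1 <= m -> x2 <= m -> 2 * m < n ->
  (forall i j, i <= n -> j <= n -> good_at st k i j) ->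
  ends_within d W mw md st merge_level (m.+2 * 4080) (fun st' =>
    forall k' i j, k' <= n -> i <= n -> j <= n ->
      good_at st k' i j \/ (k' = k.+1 /\
        ((i \in [:: x1; x2]) && (j <= m) || (j \in [:: x1; x2]) && (i <= m))) ->
      good_at st' k' i j).
Proof.
move=> nE rng kn kE e1 e2 mE x1m x2m mn gc.
have W1 : 1 < W by exact: leq_trans W3.
have mW : m.+1 < W.
  by apply: leq_ltn_trans n1W; move: mn; clear; lia.
apply: (within_weaken (@within_cross_loop st k.+1 merge aRow1 aRow2 x1 x2
  (WOp Add (Var aMax) (WConst 1)) m.+1 1010 _ _ _ _ _ e1 e2 x1m x2m _ _)) => //.
- by move=> a b; apply/allP.
- by move=> st' A; rewrite /= A // mE addn1.
- move=> st1 a b A B A1 mono av bv aE bE Am Bm.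
  have l2 C : C < m.+1 -> 2 * C < n by move: mn; clear; lia.
  apply: within_merge => //; rewrite ?A1 ?l2 //.
    by move=> x; rewrite A1 //; apply: rng.
  by move=> i j in_ jn; apply: mono => //; [exact: ltnW | exact: gc].
- by rewrite leq_mul2l.
Qed.

Lemma quad_repair_spec st st1 x1 x2 :
  quad_clean st -> words st1 aN 0 = n -> in_range n st1 ->
  agree [:: aNext; aIn; aBestE; aBestS; aNew1; aNew2] st st1 ->
  words st1 aNew1 0 = x1 -> words st1 aNew2 0 = x2 -> x1 < n -> x2 < n ->
  (forall y, y != x1 -> y != x2 ->
     words st1 aNext y = words st aNext y /\ words st1 aIn y = words st aIn y) ->
  ends d W mw md st1 quad_repair (fun k st' =>
    k + 0 <= 0 + n.+1 * (13 * 1000) /\ quad_clean st').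
Proof.
move=> [gc _ _] nE rng A1 e1 e2 n1 n2 same.
have n0 : 0 < n by apply: leq_ltn_trans n1.
have W1 : 1 < W by exact: leq_trans W3.
have W2 : 2 < W by exact: leq_trans W3.
have nW : n < W by apply: ltn_trans n1W.
have un k i j : used k -> i <= n -> j <= n ->
    untouched x1 x2 k i j -> good_at st1 k i j.
  by move=> uk in_ jn u; apply: good_frame u (gc _ _ _ uk in_ jn) => //; apply: A1.
have le_pred x : x < n -> x <= n.-1 by rewrite -[X in _ < X](prednK n0) ltnS.
apply: ends_seq; apply: ends_weaken (within_set_leaves nE e1 e2 n1 n2) _.
move=> k2 st2 A2 [le2 G2].
have E2 : agree (aPos :: scratch) st1 st2.
  by apply: agree_sub A2; apply/allP.
have un2 k i j : used k -> i <= n -> j <= n ->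
    untouched x1 x2 k i j || (k == 0) -> good_at st2 k i j.
  move=> uk in_ jn /orP H; apply: G2 => //; first exact: used_le.
  have [u|] := boolP (untouched x1 x2 k i j); first by left; apply: un.
  case: H => [->//|/eqP->]; rewrite /untouched expn0 !divn1 !negb_or -!leqNgt.
  case/and3P=> ne il jl; right; split=> //.
  have lt y : y <= n.-1 -> y < n by move=> h; rewrite -(prednK n0) ltnS.
  by rewrite !lt // !andbT; apply: contraNT ne; rewrite !inE !negb_or !andbT.
apply: ends_seq; apply: ends_wset; [exact: W0 | exact: W0 | by [] |].
apply: ends_seq; apply: ends_wset; [exact: W0 | by split; rewrite /= ?W0 | by [] |].
apply: ends_seq; apply: ends_wset; [exact: W0 | by split; rewrite /= ?W0 | by [] |].
apply: ends_seq; apply: ends_wset;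
  [exact: W0 | by split=> //; split; rewrite /= ?W0 | by [] |].
set st6 := State _ _.
have A6 : agree [:: aLevel; aRow1; aRow2; aMax] st2 st6.
  move=> x; rewrite !inE !negb_or => /and4P[x1' x2' x3' x4'].
  by rewrite /st6 /= !upd_neq.
have k6 : words st6 aLevel 0 = 0 by [].
have r16 : words st6 aRow1 0 = x1 by rewrite -e1 -(E2 aNew1).
have r26 : words st6 aRow2 0 = x2 by rewrite -e2 -(E2 aNew2).
have m6 : words st6 aMax 0 = n.-1 by rewrite -subn1 -nE -(E2 aN).
clearbody st6.
have A26 : agree [:: aPos, aLevel, aRow1, aRow2, aMax & scratch] st1 st6.
  by apply: agree_trans (agree_sub _ E2) (agree_sub _ A6); apply/allP.
have good6 k i j : used k -> i <= n -> j <= n ->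
    untouched x1 x2 k i j || (k == 0) -> good_at st6 k i j.
  move=> uk in_ jn H; have := un2 k i j uk in_ jn H.
  by rewrite /good_at /cell !A6.
(* Untouched cells are good on every level; the remaining ones are good up to the level k reached so
   far. *)
pose I m (st' : state R) := exists k, [/\ used k,
  [/\ words st' aLevel 0 = k, words st' aRow1 0 = x1 %/ 2 ^ k,
      words st' aRow2 0 = x2 %/ 2 ^ k & words st' aMax 0 = n.-1 %/ 2 ^ k],
  n.-1 %/ 2 ^ k <= m,
  agree [:: aPos, aLevel, aRow1, aRow2, aMax & scratch] st1 st' &
  forall k' i j, used k' -> i <= n -> j <= n ->
    untouched x1 x2 k' i j || (k' <= k) -> good_at st' k' i j].
have I6 : I n.-1 st6.
  exists 0; split=> //; first by rewrite expn0 !divn1.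
    by rewrite expn0 divn1.
  by move=> k i j uk in_ jn; rewrite leqn0; apply: good6.
(* This potential sums the geometric series. When [aMax] falls from M to h, where 2h is at most M,
   it grows by at least 4080 h and so pays for the linear part of [h.+2 * 4080]. The constant rest
   is charged at most n times. *)
pose P (st' : state R) := 4080 * (n - words st' aMax 0).
have iter m (st' : state R) : I m st' -> 0 < words st' aMax 0 ->
    0 < m /\ ends d W mw md st'
      (aLevel ::= WOp Add (Var aLevel) (WConst 1) ;;
       aRow1 ::= WOp Div (Var aRow1) (WConst 2) ;;
       aRow2 ::= WOp Div (Var aRow2) (WConst 2) ;;
       aMax ::= WOp Div (Var aMax) (WConst 2) ;;
       merge_level)
      (fun k st2' => k + P st' <= P st2' + (2 * 4080 + 60) /\ I m.-1 st2').
  case=> k [uk [lE r1E r2E mE] leM AI gI] Mpos.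
  rewrite mE in Mpos.
  have m0 : 0 < m by apply: leq_trans leM.
  split=> //.
  have uk1 : used k.+1 by [].
  have kn : k < n by apply: used_le.
  have lW : k + 1 < W by rewrite addn1; apply: leq_ltn_trans nW.
  pose h := n.-1 %/ 2 ^ k.+1.
  have hE : n.-1 %/ 2 ^ k %/ 2 = h by rewrite /h expnSr divnMA.
  have hn : 2 * h < n.
    rewrite -hE -[X in _ < X](prednK n0) ltnS mulnC.
    by apply: leq_trans (leq_trunc_div _ _) _; apply: leq_div.
  have hM : 2 * h <= n.-1 %/ 2 ^ k by rewrite -hE mulnC leq_trunc_div.
  do 1![apply: ends_seq; apply: ends_wset;
    [exact: W0 | by split=> //; rewrite /= lE | by [] |]].
  do 3![apply: ends_seq; apply: ends_wset; [exact: W0 | by split | by [] |]].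
  set st3 := State _ _.
  have A3 : agree [:: aLevel; aRow1; aRow2; aMax] st' st3.
    move=> x; rewrite !inE !negb_or => /and4P[x1' x2' x3' x4'].
    by rewrite /st3 /= !upd_neq.
  have l3 : words st3 aLevel 0 = k.+1.
    by transitivity (words st' aLevel 0 + 1); [by [] | rewrite lE addn1].
  have r13 : words st3 aRow1 0 = x1 %/ 2 ^ k.+1 by rewrite expnSr divnMA -r1E.
  have r23 : words st3 aRow2 0 = x2 %/ 2 ^ k.+1 by rewrite expnSr divnMA -r2E.
  have m3 : words st3 aMax 0 = h by rewrite -hE -mE.
  clearbody st3.
  have A13 : agree [:: aPos, aLevel, aRow1, aRow2, aMax & scratch] st1 st3.
    by apply: agree_trans AI (agree_sub _ A3); apply/allP.
  have g3 k' i j : good_at st' k' i j -> good_at st3 k' i j.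
    by rewrite /good_at /cell !A3.
  have xh x : x < n -> x %/ 2 ^ k.+1 <= h by move=> xn; apply: leq_div2r; apply: le_pred.
  have n3 : words st3 aN 0 = n by rewrite A13.
  have rng3 : in_range n st3 by move=> x; rewrite A13 //; apply: rng.
  have gk i j : i <= n -> j <= n -> good_at st3 k i j.
    by move=> in_ jn; apply: g3; apply: gI => //; rewrite leqnn orbT.
  apply: ends_weaken (within_merge_level n3 rng3 kn l3 r13 r23 m3 (xh _ n1) (xh _ n2) hn gk) _.
  move=> k4 st4 A4 [le4 G4].
  have {}A4 : agree (aPos :: scratch) st3 st4 by apply: agree_sub A4; apply/allP.
  have m4 : words st4 aMax 0 = h by rewrite A4.
  split.
    rewrite /P m4 mE.
    have nM : n.-1 %/ 2 ^ k <= n by apply: leq_trans (leq_div _ _) (leq_pred n).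
    rewrite /=.
    have key : h.+2 * 4080 + 4080 * (n - n.-1 %/ 2 ^ k) <= 4080 * (n - h) + 2 * 4080.
      by move: (n.-1 %/ 2 ^ k) nM hM; clear; move=> M; nia.
    by move: key le4; clear; move: (_.+2 * _) => a; lia.
  exists k.+1; split=> //.
  - by rewrite !A4.
  - rewrite -/h; move: hM leM Mpos; clear; move: (n.-1 %/ 2 ^ k) => M; lia.
  - by apply: agree_trans A13 (agree_sub _ A4); apply/allP.
  move=> k' i j uk' in_ jn H; apply: G4 => //; first exact: used_le.
  have [|] := boolP (untouched x1 x2 k' i j || (k' <= k)).
    by move=> H'; left; apply: g3; apply: gI.
  rewrite negb_or -ltnNge => /andP[nu lt]; right.
  have ke : k' = k.+1.
    by apply/eqP; rewrite eqn_leq lt andbT; move: H; rewrite (negbTE nu).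
  split=> //; move: nu; rewrite ke /untouched !negb_or -!leqNgt -/h.
  case/and3P=> nu -> ->; rewrite !andbT; apply: contraNT nu.
  by rewrite !inE !negb_or !andbT.
pose c := (aLevel ::= WOp Add (Var aLevel) (WConst 1) ;;
  aRow1 ::= WOp Div (Var aRow1) (WConst 2) ;;
  aRow2 ::= WOp Div (Var aRow2) (WConst 2) ;;
  aMax ::= WOp Div (Var aMax) (WConst 2) ;; merge_level).
have Wh := @ends_while _ _ d W mw md I P st6 (WLe (WConst 1) (Var aMax)) c n.-1
  (2 * 4080 + 60) quad_clean I6.
apply: ends_weaken (Wh _) _ => {Wh}; last first.
  move=> k7 st7 _ [le7 cl]; split=> //.
  have : P st7 <= 4080 * n by rewrite /P leq_mul2l leq_subr orbT.
  move: le7; rewrite prednK //; move: (P st7) (P st6) => p7 p6.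
  rewrite /=; move: le2; clear; lia.
move=> m st' _ Im; split; first by split=> //=; rewrite ?W1 //; split.
rewrite /=; case: ltnP => [pos|]; first exact: iter.
rewrite leqn0 => /eqP M0.
case: Im => k [uk [lE _ _ mE] _ AI gI].
have small : n.-1 < 2 ^ k.
  by rewrite mE in M0; rewrite -[2 ^ k]mul1n -ltn_divLR ?expn_gt0 // M0.
split; rewrite ?lE //.
move=> k' i j uk' in_ jn; apply: gI => //; apply/orP; right.
(* A used level above k would need more than one block at level k or higher, which [small]
   excludes. *)
rewrite leqNgt; apply/negP => lt; case/orP: uk' => [/eqP k0|].
  by rewrite k0 in lt.
rewrite divn_small //; apply: leq_trans small _.
by rewrite leq_exp2l // -ltnS prednK // (leq_ltn_trans _ lt).
Qed.

End Quad.

(** * Word size and total time of the quadtree implementation *)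

Lemma word_bound_gt n b : 0 < n -> n.+1 ^ b <= word_bound b n /\ 2 ^ b <= word_bound b n.
Proof.
move=> n0; rewrite /word_bound mulnC expnM; split.
  by case: b => [|b] //; rewrite leq_exp2r // trunc_log_ltn.
by case: b => [|b] //; rewrite leq_exp2r // -[X in X <= _]expn1 leq_exp2l.
Qed.

Lemma word_bound_split n b c : word_bound (b + c) n = word_bound b n * word_bound c n.
Proof. by rewrite /word_bound mulnDl expnD. Qed.

Definition quad_time (n : nat) : nat :=
  0 + n * (100 + n.+1 * (13 * 1000) + 200) + n.+1 * (13 * 1000) + 200.

Lemma quad_implements :
  implements_cheapest_insertion (insertion_program quad_find quad_repair) quad_time
    (fun n => sumn (layout n [:: n.+1 ^ 3; n.+1 ^ 3; 1; 1; 1; 1; 1; 1; 1])).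
Proof.
(* Three factors hold the table addresses, and two give a factor 4 that covers the additive
   slack. *)
exists 5 => R n d s0 dsym; have n0 : 0 < n by apply: leq_ltn_trans (ltn_ord s0).
have lt : n.+1 ^ 3 + 3 < word_bound 5 n.
  have [le3 _] := word_bound_gt 3 n0; have [_ le2] := word_bound_gt 2 n0.
  have l8 : 8 <= n.+1 ^ 3 by rewrite (@leq_exp2r 2 n.+1 3).
  rewrite (word_bound_split n 3 2).
  apply: leq_trans (leq_mul le3 le2); move: l8; clear; lia.
have W1 : n.+1 < word_bound 5 n.
  by apply: leq_trans lt; rewrite !expnS expn0; clear; nia.
have [k [st [t [E le o c]]]] := @insertion_program_correct _ n d s0 (word_bound 5 n)
  [:: n.+1 ^ 3; n.+1 ^ 3; 1; 1; 1; 1; 1; 1; 1] [::] W1 quad_find quad_repair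
  (quad_clean d) (fun=> 0) 100 (n.+1 * (13 * 1000)) 0 isT isT
  (quad_find_spec [::] erefl lt) (quad_repair_spec [::] erefl lt)
  (@quad_clean_iter R n d) (fun _ _ => isT) (quad_clean_init d s0).
exists (layout n [:: n.+1 ^ 3; n.+1 ^ 3; 1; 1; 1; 1; 1; 1; 1]), [::], k, st, t.
by split=> //; rewrite addn0.
Qed.

Lemma quad_time_O : big_O quad_time (fun n => n ^ 2).
Proof.
exists (60 * 1000), 1 => n n1; rewrite /quad_time -mulnn.
have le : n <= n * n by rewrite leq_pmulr.
by rewrite mulSn !mulnDr (mulnA n n); move: (n * n) le => m; lia.
Qed.

(** * Linear space: conga lines *)

Notation bLevel := 12 (only parsing).
Notation bSrc := 13 (only parsing).
Notation bDst := 14 (only parsing).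
Notation bUsed := 15 (only parsing).
Notation bTop := 16 (only parsing).
Notation bPos := 17 (only parsing).
Notation bCur := 18 (only parsing).
Notation bCount := 19 (only parsing).
Notation bPow := 20 (only parsing).
Notation bSlot := 21 (only parsing).

Definition no_best : cmd := aBestE ::= WConst 0 ;; aBestS ::= WConst 0.

(* Slots 2^(l+1), ..., 2^(l+2) - 1 hold the links of the line of level l; a link
   from an element to itself marks an empty slot.  Elements of level 0 wait for
   the next rebuilding. *)
Definition slots : wexp := WOp Mul (WConst 8) (Var aN).

(** The direction of a link says nothing about which end is in the tour, so both orders are offered;
    at most one is valid. *)
Definition pair_offers (x y : wexp) : cmd := offers [:: (x, y); (y, x)].

Definition conga_find : cmd :=
  no_best ;; For bPos slots (pair_offers (WGet bSrc (Var bPos)) (WGet bDst (Var bPos))).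

Definition mark_new : cmd :=
  For bPos (Var aN) (WSet bUsed (Var bPos) (WConst 0)) ;;
  WSet bUsed (Var aNew1) (WConst 1) ;; WSet bUsed (Var aNew2) (WConst 1).

Definition drop_slot : cmd :=
  WSet bLevel (WGet bSrc (Var bPos)) (WConst 0) ;;
  WSet bSrc (Var bPos) (WConst 0) ;; WSet bDst (Var bPos) (WConst 0).

Definition drop_touched : cmd :=
  For bPos slots
    (If (WLe (WConst 1)
          (WOp Add (WGet bUsed (WGet bSrc (Var bPos)))
            (WGet bUsed (WGet bDst (Var bPos)))))
      drop_slot Skip).

Definition drop_new : cmd :=
  WSet bLevel (Var aNew1) (WConst 0) ;; WSet bLevel (Var aNew2) (WConst 0).

Definition drop : cmd := mark_new ;; drop_touched ;; drop_new.

(** The initial count 2 against the power 1 is fictitious: it forces a first round, so the rebuilt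
    level is at least 1 and level 0 stays reserved for waiting elements. *)
Definition find_top : cmd :=
  bTop ::= WConst 0 ;; bPow ::= WConst 1 ;; bCount ::= WConst 2 ;;
  While (TNot (WLe (Var bCount) (Var bPow)))
    (bTop ::= WOp Add (Var bTop) (WConst 1) ;;
     bPow ::= WOp Mul (Var bPow) (WConst 2) ;;
     bCount ::= WConst 0 ;;
     For bPos (Var aN)
       (If (WLe (WGet bLevel (Var bPos)) (Var bTop))
         (bCount ::= WOp Add (Var bCount) (WConst 1)) Skip)).

Definition raise_levels : cmd :=
  For bPos (Var aN)
    (WSet bUsed (Var bPos) (WConst 0) ;;
     If (WLe (WGet bLevel (Var bPos)) (Var bTop))
       (WSet bLevel (Var bPos) (Var bTop)) Skip).

(** The lines of all levels up to [bTop] lie in the slots below [4 * bPow]. *)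
Definition clear_slots : cmd :=
  For bPos (WOp Mul (WConst 4) (Var bPow))
    (WSet bSrc (Var bPos) (WConst 0) ;; WSet bDst (Var bPos) (WConst 0)).

(** Chooses a member of the level as the start of a new piece of the line. The word n in [bCur]
    stands for no element and ends the construction. *)
Definition pick : cmd :=
  bCur ::= Var aN ;;
  For bPos (Var aN)
    (If (WLe (WGet bUsed (Var bPos)) (WConst 0))
      (If (WLe (WGet bLevel (Var bPos)) (Var bTop)) (bCur ::= Var bPos) Skip) Skip) ;;
  If (WLe (Var aN) (Var bCur)) Skip (WSet bUsed (Var bCur) (WConst 1)).

Definition scan : cmd :=
  no_best ;;
  For bPos (Var aN)
    (If (WLe (WGet bUsed (Var bPos)) (WConst 0))
      (If (WLe (WGet bLevel (Var bCur)) (Var bTop))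
        (pair_offers (Var bCur) (Var bPos))
        (If (WLe (WGet bLevel (Var bPos)) (Var bTop))
          (pair_offers (Var bCur) (Var bPos)) Skip))
      Skip).

(** The best pair consists of the current element and its partner in unknown order, so the partner
    is obtained as the sum minus the current element. *)
Definition advance : cmd :=
  WSet bSrc (Var bSlot) (Var bCur) ;;
  bCur ::= WOp Defs.Sub (WOp Add (Var aBestE) (Var aBestS)) (Var bCur) ;;
  WSet bDst (Var bSlot) (Var bCur) ;;
  bSlot ::= WOp Add (Var bSlot) (WConst 1) ;;
  WSet bUsed (Var bCur) (WConst 1).

Definition conga_step : cmd :=
  scan ;;
  If (WLe (WConst 1) (WGet aIn (Var aBestE)))
    (If (WLe (WGet aIn (Var aBestS)) (WConst 0)) advance pick) pick.

Definition conga_line : cmd :=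
  bSlot ::= WOp Mul (WConst 2) (Var bPow) ;; pick ;;
  While (TNot (WLe (Var aN) (Var bCur))) conga_step.

Definition conga_repair : cmd :=
  drop ;; find_top ;; raise_levels ;; clear_slots ;; conga_line.

Section Conga.
Variables (R : realDomainType) (n : nat) (d : 'I_n -> 'I_n -> R) (s0 : 'I_n).
Variables (W : nat) (md : seq nat).
Hypothesis n_pos : 0 < n.
Hypothesis W_large : 16 * n + 16 < W.
Notation priv := [:: n; 8 * n; 8 * n; n; 1; 1; 1; 1; 1; 1].
Notation mw := (layout n priv).
Implicit Types (st : state R).
Notation better_in st := (better d (words st aNext) (words st aIn)).

Let W0 : 0 < W. Proof. by move: W_large; clear; lia. Qed.
Let W1 : 1 < W. Proof. by move: W_large; clear; lia. Qed.
Let W8 : 8 < W. Proof. by move: W_large; clear; lia. Qed.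
Let nW : n < W. Proof. by move: W_large; clear; lia. Qed.
Let slotsW : 8 * n < W. Proof. by move: W_large; clear; lia. Qed.

Lemma slots_eval st : words st aN 0 = n ->
  wsafe W mw st slots /\ wval st slots = 8 * n.
Proof. by move=> nE; rewrite /= nE. Qed.

Definition slot st e : nat * nat := (words st bSrc e, words st bDst e).

Definition slots_ok st : Prop :=
  forall e, e < 8 * n -> words st bSrc e < n /\ words st bDst e < n.

Definition swap (p : nat * nat) : nat * nat := (p.2, p.1).

(* [p = (x, y)] stands for the link from x to y. *)
Definition covers nx inT (p : nat * nat) (x y : nat) : bool :=
  let b q := better d nx inT q (x, y) && better d nx inT q (y, x) in
  ((p.1 == x) || (p.1 == y)) && (b p || b (swap p)).

Lemma coversC nx inT p x y : covers nx inT p x y = covers nx inT p y x.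
Proof. by rewrite /covers orbC; congr (_ && (_ || _)); rewrite andbC. Qed.

Lemma within_no_best st : ends_within d W mw md st no_best 7 (fun st' => best st' = (0, 0)).
Proof. by apply: within_wp => //; do 2!split. Qed.

Lemma within_pair_offers st x y :
  in_range n st -> (best st).1 < n -> (best st).2 < n ->
  stable n W priv st x -> stable n W priv st y ->
  let p := (wval st x, wval st y) in
  ends_within d W mw md st (pair_offers x y) 403 (fun st' =>
    [/\ best st' \in [:: best st; p; swap p] &
        all (better_in st (best st')) [:: best st; p; swap p]]).
Proof.
move=> rng b1 b2 sx sy p.
have H c : List.In c [:: (x, y); (y, x)] -> stable n W priv st c.1 /\ stable n W priv st c.2.
  by case=> [<-|[<-|[]]].
by apply: (within_weaken (@within_offers _ _ d _ _ md W1 st _ rng b1 b2 H)) => // st' _ [].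
Qed.

Definition within_level (l : nat) (lev : nat -> nat) : nat :=
  \sum_(x < n) (lev x <= l).

(** The least l with 2^l > n. All elements fit into a line of this level, so [find_top] goes no
    further. *)
Definition max_level : nat := (trunc_log 2 n).+1.

(** Slots with equal binary logarithm form one line, and no element is entered twice in it. The
    lower bound on e places the covering link in a line no lower than both elements of the pair
    allow, so clearing the lines up to level l spares the pairs whose levels both exceed l. *)
Definition conga_clean st : Prop :=
  [/\ forall x, x < n -> words st bLevel x <= max_level,
      slots_ok st,
      forall e e', e < 8 * n -> e' < 8 * n -> trunc_log 2 e = trunc_log 2 e' ->
        (slot st e).1 != (slot st e).2 -> (slot st e').1 != (slot st e').2 ->
        (slot st e).2 = (slot st e').2 -> e = e' &
      forall x y, x < n -> y < n -> valid (words st aIn) (x, y) ->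
        exists e, [/\ e < 8 * n,
          2 ^ (minn (words st bLevel x) (words st bLevel y)).+1 <= e &
          covers (words st aNext) (words st aIn) (slot st e) x y]].

Lemma conga_find_spec st :
  words st aN 0 = n -> in_range n st -> conga_clean st ->
  (exists a s, [/\ a < n, s < n & valid (words st aIn) (a, s)]) ->
  ends_within d W mw md st conga_find ((8 * n).+1 * 450) (fun st' =>
    [/\ conga_clean st',
        \sum_(x < n) words st' bLevel x = \sum_(x < n) words st bLevel x
      & optimal d st (best st')]).
Proof.
move=> nE rng cl [a [s [an sn v]]]; have [_ sl _ cov] := cl.
apply: (@within_weaken _ _ _ _ _ _ _ _ (7 + (8 * n).+1 * (403 + wcost slots + 16)).+1 _
  (fun st' => [/\ (best st').1 < n, (best st').2 < n & forall e, e < 8 * n ->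
     better_in st (best st') (slot st e) && better_in st (best st') (swap (slot st e))]));
  last first.
- move=> st' A [l1 l2 opt].
  have e : agree [:: aBestE; aBestS; aCandE; aCandS; bPos] st st'.
    by apply: agree_sub A; apply/allP.
  have opt' x y : x < n -> y < n -> better_in st (best st') (x, y).
    move=> xn yn; have [vxy|nv] := boolP (valid (words st aIn) (x, y)); last first.
      exact: better_invalid.
    have [q [qn _ /andP[_ /orP[]/andP[b _]]]] := cov _ _ xn yn vxy.
      by have /andP[+ _] := opt q qn; move/better_trans; apply.
    by have /andP[_ +] := opt q qn; move/better_trans; apply.
  split=> //.
  + by rewrite /conga_clean /slots_ok /slot !e.
  + by rewrite e.
  + split=> //; have := opt' _ _ an sn.
    by rewrite /better v => /andP[].
- by rewrite /=; clear; lia.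
apply: within_seq; apply: within_weaken (@within_no_best st) _ _ => // st1 A1 B1.
have E1 x : x \notin [:: aBestE; aBestS] -> words st1 x = words st x by apply: A1.
pose I j (st' : state R) := [/\ (best st').1 < n, (best st').2 < n & forall e, e < j ->
  better_in st (best st') (slot st e) && better_in st (best st') (swap (slot st e))].
apply: (within_for (I := I) (m := 8 * n)) => //.
- by move=> j st' _ A _; apply: slots_eval; rewrite A // E1.
- by case: B1 => b5 b6; split; rewrite //= /upd /= ?b5 ?b6.
- move=> j st' jn A jE [l1 l2 opt].
  have e x : x \in [:: aNext; aIn; bSrc; bDst] -> words st' x = words st x.
    by rewrite !inE => /or4P[] /eqP->; rewrite A // E1.
  have [sn' dn'] := sl j jn.
  have St a' : a' \in [:: bSrc; bDst] -> stable n W priv st' (WGet a' (Var bPos)).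
    move=> av; have ea : words st' a' = words st a'.
      by apply: e; move: av; rewrite !inE => /orP[]->; rewrite ?orbT.
    split=> //=; first by rewrite jE ea; move: av; rewrite !inE => /orP[]/eqP->.
    move=> st2 A2; have -> : words st2 bPos = words st' bPos by apply: A2.
    rewrite jE; split; last by rewrite A2 //; move: av; rewrite !inE => /orP[]/eqP->.
    by split=> //; move: av; rewrite !inE => /orP[]/eqP->.
  have rng' : in_range n st' by rewrite /in_range e.
  apply: (within_weaken (within_pair_offers rng' l1 l2 (St bSrc isT) (St bDst isT))) => //.
  move=> st2 _; rewrite /= jE !e // -/(slot st j) => -[B /and4P[b0 b1 b2 _]].
  have [c1 c2] : (best st2).1 < n /\ (best st2).2 < n.
    by move: B; rewrite !inE => /or3P[]/eqP->.
  split=> // q; rewrite ltnS leq_eqVlt => /orP[/eqP->|qj]; first by rewrite b1 b2.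
  have /andP[o1 o2] := opt q qj.
  by rewrite (better_trans b0 o1) (better_trans b0 o2).
Qed.

(** * Dropping the links broken by an insertion *)

Lemma within_mark_new st x1 x2 :
  words st aN 0 = n -> words st aNew1 0 = x1 -> words st aNew2 0 = x2 ->
  x1 < n -> x2 < n ->
  ends_within d W mw md st mark_new (n.+1 * 50) (fun st' =>
    forall x, x < n -> words st' bUsed x = (x == x1) || (x == x2)).
Proof.
move=> nE e1 e2 n1 n2.
apply: (@within_weaken _ _ _ _ _ _ _ _ (n.+1 * (4 + 2 + 16) + (4 + 4).+1).+1 _
  (fun st' => forall x, x < n -> words st' bUsed x = (x == x1) || (x == x2))) => //;
  last by clear; lia.
apply: within_seq.
pose I j (st' : state R) := forall x, x < j -> words st' bUsed x = 0.
apply: (within_for (I := I) (m := n)) => //.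
- by move=> j st' _ A _; rewrite /= A.
- move=> j st' jn A jE I'; apply: within_wp => //; rewrite /= jE; split=> //.
  move=> x; rewrite /= /upd /= ltnS leq_eqVlt => /orP[->//|xj].
  by case: eqP => // _; apply: I'.
- move=> st' A I'.
  have e1' : words st' aNew1 0 = x1 by rewrite A.
  have e2' : words st' aNew2 0 = x2 by rewrite A.
  apply: within_seq; apply: within_wp => //; split; rewrite /= ?e1' //.
  apply: within_wp => //; split; rewrite /= ?[upd _ _ _ _ aNew2 _]/upd /= ?e2' //.
  move=> x xn; rewrite /upd /= I' //.
  by case: (x == x1); case: (x == x2).
Qed.

Definition hit st e : bool :=
  0 < words st bUsed (words st bSrc e) + words st bUsed (words st bDst e).

Definition dropped st x m : bool :=
  has (fun e => hit st e && (words st bSrc e == x)) (iota 0 m).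

Lemma droppedS st x m :
  dropped st x m.+1 = dropped st x m || (hit st m && (words st bSrc m == x)).
Proof. by rewrite /dropped -[m.+1]addn1 iotaD has_cat /= orbF. Qed.

Lemma within_drop_touched st :
  words st aN 0 = n -> slots_ok st ->
  (forall x, x < n -> words st bUsed x <= 1) ->
  ends_within d W mw md st drop_touched ((8 * n).+1 * 60) (fun st' =>
    [/\ forall e, e < 8 * n -> slot st' e = if hit st e then (0, 0) else slot st e
      & forall x, words st' bLevel x =
          if dropped st x (8 * n) then 0 else words st bLevel x]).
Proof.
move=> nE sl u1.
pose I j (st' : state R) :=
  [/\ forall e, slot st' e = if (e < j) && hit st e then (0, 0) else slot st e
    & forall x, words st' bLevel x =
          if dropped st x j then 0 else words st bLevel x].
apply: (@within_weaken _ _ _ _ _ _ _ _ ((8 * n).+1 * (37 + wcost slots + 16)) _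
  (I (8 * n))); last first.
- by move=> st' _ [Is Il]; split=> // e en; rewrite Is en.
- by rewrite leq_mul2l.
apply: (within_for (I := I) (m := 8 * n)) => //.
- by move=> j st' _ A _; apply: slots_eval; rewrite A.
- move=> j st' jn A jE [Is Il]; have [srn dsn] := sl j jn.
  have : slot st' j = slot st j by rewrite Is ltnn.
  case=> sE dE; have uE : words st' bUsed = words st bUsed by apply: A.
  have us := u1 _ srn; have ud := u1 _ dsn.
  apply: within_wp => //; split.
    split; rewrite /= ?jE ?sE ?dE ?uE; first by [].
    by split=> //; apply: leq_ltn_trans (leq_add us ud) (ltn_trans _ W8).
  rewrite /= jE sE dE uE -/(hit st j).
  have stepS e : (e < j.+1) && hit st e = ((e < j) && hit st e) || ((e == j) && hit st j).
    rewrite ltnS leq_eqVlt; case: eqP => [->|_] /=; last by rewrite orbF.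
    by rewrite ltnn.
  case: ifP => hj.
    rewrite /I /slot /upd /= ?jE /=; do 3![split=> //].
    split=> [e|x].
      rewrite stepS hj andbT; case: eqP => [->|_]; first by rewrite orbT.
      by rewrite orbF; apply: Is.
    rewrite droppedS hj /= Il [x == _]eq_sym; case: eqP; rewrite ?orbT ?orbF //.
  split=> [e|x].
    by rewrite stepS hj andbF orbF; apply: Is.
  by rewrite droppedS hj /= orbF; apply: Il.
Qed.

Lemma covers_frame st st1 x1 x2 p x y :
  (forall z, z != x1 -> z != x2 ->
     words st1 aNext z = words st aNext z /\ words st1 aIn z = words st aIn z) ->
  all (fun z => (z != x1) && (z != x2)) [:: p.1; p.2; x; y] ->
  covers (words st1 aNext) (words st1 aIn) p x y =
  covers (words st aNext) (words st aIn) p x y.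
Proof.
case: p => p1 p2 same /= /and5P[/andP[a1 a2] /andP[b1 b2] /andP[c1 c2] /andP[d1 d2] _].
have [na ia] := same _ a1 a2; have [nb ib] := same _ b1 b2.
have [nc ic] := same _ c1 c2; have [nd id_] := same _ d1 d2.
by rewrite /covers /better /valid /cost /swap /= na ia nb ib nc ic nd id_.
Qed.

Definition slots_inj st : Prop :=
  forall e e', e < 8 * n -> e' < 8 * n -> trunc_log 2 e = trunc_log 2 e' ->
    (slot st e).1 != (slot st e).2 -> (slot st e').1 != (slot st e').2 ->
    (slot st e).2 = (slot st e').2 -> e = e'.

(* In each block [2^k, 2^k.+1) of slots at most one link leads to x1 and at
   most one to x2. *)
Lemma card_links st x1 x2 : slots_inj st -> slots_ok st ->
  #|[set x : 'I_n | [exists e : 'I_(8 * n), [&& words st bSrc e == x,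
      words st bSrc e != words st bDst e &
      (words st bDst e == x1) || (words st bDst e == x2)]]]| <= 2 * (max_level + 3).
Proof.
move=> inj sl.
pose E := [set e : 'I_(8 * n) | (words st bSrc e != words st bDst e) &&
   ((words st bDst e == x1) || (words st bDst e == x2))].
pose o := Ordinal n_pos.
apply: (@leq_trans #|[set insubd o (words st bSrc (nat_of_ord e)) | e in E]|).
  apply: subset_leq_card; apply/subsetP => x; rewrite inE.
  case/existsP=> e /and3P[/eqP sx ne dx]; apply/imsetP; exists e.
    by rewrite inE ne.
  by apply: val_inj; rewrite val_insubd sx ltn_ord.
apply: leq_trans (leq_imset_card _ _) _.
(* A slot leading to a changed site is determined by its block and by which of the two sites it
   enters. As e < 8n, its logarithm is at most [max_level + 2]. *)
pose g (e : 'I_(8 * n)) : 'I_(max_level + 2).+1 * bool :=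
  (inord (trunc_log 2 e), words st bDst e == x1).
have lt (e : 'I_(8 * n)) : trunc_log 2 e < (max_level + 2).+1.
  rewrite ltnS /max_level addn2.
  have -> : (trunc_log 2 n).+3 = trunc_log 2 (2 * (2 * (2 * n))).
    by rewrite !trunc_logMp ?muln_gt0.
  by apply: leq_trunc_log; rewrite !mulnA; apply: ltnW.
have ginj : {in E &, injective g}.
  move=> e e'; rewrite !inE => /andP[ne dx] /andP[ne' dx'] [E1 E2].
  apply: val_inj; apply: inj ne ne' _; [exact: ltn_ord | exact: ltn_ord | |].
    by move: (congr1 (@nat_of_ord _) E1); rewrite !inordK.
  move: E2 dx dx'; rewrite /=; case: eqP => [->|_]; case: eqP => [->|_] //= _.
  by move=> /eqP-> /eqP->.
rewrite -(card_in_imset ginj); apply: leq_trans (max_card _) _.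
by rewrite card_prod card_bool card_ord mulnC -addnS.
Qed.

(** Pairs with an element of level 0 are exempt from covering; the next line takes care of them. *)
Definition conga_dirty st : Prop :=
  [/\ forall x, x < n -> words st bLevel x <= max_level,
      slots_ok st, slots_inj st &
      forall x y, x < n -> y < n -> valid (words st aIn) (x, y) ->
        0 < words st bLevel x -> 0 < words st bLevel y ->
        exists e, [/\ e < 8 * n,
          2 ^ (minn (words st bLevel x) (words st bLevel y)).+1 <= e &
          covers (words st aNext) (words st aIn) (slot st e) x y]].

(** At most two links per block lead to a changed site, and the changed sites themselves add 2; each
    such element loses at most [max_level] levels. *)
Definition loss : nat := (2 * (max_level + 3) + 2) * max_level.

(** A pair whose elements both keep a positive level still has its link: the link starts at one of
    them, and a removed link would have sent its origin to level 0. *)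
Lemma within_drop st st1 x1 x2 :
  conga_clean st -> words st1 aN 0 = n ->
  agree [:: aNext; aIn; aBestE; aBestS; aNew1; aNew2] st st1 ->
  words st1 aNew1 0 = x1 -> words st1 aNew2 0 = x2 -> x1 < n -> x2 < n ->
  (forall y, y != x1 -> y != x2 ->
     words st1 aNext y = words st aNext y /\ words st1 aIn y = words st aIn y) ->
  ends_within d W mw md st1 drop (n * 2000) (fun st' =>
    conga_dirty st' /\
    \sum_(x < n) words st bLevel x <= \sum_(x < n) words st' bLevel x + loss).
Proof.
move=> [lv sl inj cov] nE A1 e1 e2 n1 n2 same.
apply: (@within_weaken _ _ _ _ _ _ _ _ (n.+1 * 50 + ((8 * n).+1 * 60 + 20).+1).+1 _
  (fun st' => conga_dirty st' /\
    \sum_(x < n) words st bLevel x <= \sum_(x < n) words st' bLevel x + loss)) => //;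
  last by move: n_pos; clear; lia.
apply: within_seq; apply: within_weaken (within_mark_new nE e1 e2 n1 n2) _ _ => //.
move=> st2 A2 u2.
have {}A2 : agree [:: bPos; bUsed] st1 st2 by apply: agree_sub A2; apply/allP.
have A02 : agree [:: aNext; aIn; aBestE; aBestS; aNew1; aNew2; bPos; bUsed] st st2.
  by apply: agree_trans (agree_sub _ A1) (agree_sub _ A2); apply/allP.
have sl2 : slots_ok st2 by move=> e en; rewrite (A02 bSrc) // (A02 bDst) //; apply: sl.
have nE2 : words st2 aN 0 = n by rewrite A2.
have u21 x : x < n -> words st2 bUsed x <= 1 by move/u2 ->; case: (_ || _).
apply: within_seq; apply: within_weaken (within_drop_touched nE2 sl2 u21) _ _ => //.
move=> st3 A3 [s3 l3].
have {}A3 : agree [:: bPos; bLevel; bSrc; bDst] st2 st3.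
  by apply: agree_sub A3; apply/allP.
have e13 : words st3 aNew1 0 = x1 by rewrite A3 // A2.
have e23 : words st3 aNew2 0 = x2 by rewrite A3 // A2.
apply: within_wp => //; split; [by [] | by [] | by rewrite /= e13 |].
split; [by [] | by [] | by rewrite /= /upd /= e23 |].
set st4 := State _ _.
pose gone x := [|| x == x1, x == x2 | dropped st2 x (8 * n)].
have l4 x : words st4 bLevel x = if gone x then 0 else words st bLevel x.
  rewrite /st4 /= /upd /= e13 e23 l3 /gone A02 //.
  by case: (x == x2); case: (x == x1); case: (dropped _ _ _).
have s4 e : e < 8 * n -> slot st4 e = if hit st2 e then (0, 0) else slot st e.
  by move=> en; rewrite -[slot st4 e]/(slot st3 e) s3 // /slot !A02.
have i4 : words st4 aIn = words st1 aIn.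
  by rewrite -[words st4 _]/(words st3 _) A3 // A2.
have x4 : words st4 aNext = words st1 aNext.
  by rewrite -[words st4 _]/(words st3 _) A3 // A2.
clearbody st4.
have hitE e : e < 8 * n -> hit st2 e =
    [|| words st bSrc e == x1, words st bSrc e == x2,
        words st bDst e == x1 | words st bDst e == x2].
  move=> en; have [a b] := sl2 e en; rewrite /hit !u2 // !A02 //.
  by case: (_ == x1); case: (_ == x2); case: (_ == x1); case: (_ == x2).
have hit_gone e : e < 8 * n -> hit st2 e -> gone (words st bSrc e).
  move=> en h; apply/or3P; apply: Or33; apply/hasP; exists e.
    by rewrite mem_iota.
  by rewrite h A02 // eqxx.
split; last first.
  have le_max x : x < n -> words st bLevel x <= words st4 bLevel x + gone x * max_level.
    by move=> xn; rewrite l4; case: ifP => _; rewrite ?mul1n ?mul0n ?addn0 ?add0n // lv.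
  have le_sum : \sum_(x < n) words st bLevel x <=
      \sum_(x < n) (words st4 bLevel x + gone x * max_level).
    by apply: leq_sum => x _; apply: le_max.
  apply: leq_trans le_sum _.
  rewrite big_split /= leq_add2l -big_distrl /= leq_mul2r; apply/orP; right.
    have -> : \sum_(x < n) gone x = #|[set x : 'I_n | gone x]|.
    by rewrite -sum1dep_card [RHS]big_mkcond; apply: eq_bigr => x _; case: (gone x).
  pose D := [set x : 'I_n | [exists e : 'I_(8 * n), [&& words st bSrc e == x,
      words st bSrc e != words st bDst e &
      (words st bDst e == x1) || (words st bDst e == x2)]]].
  have sub : [set x : 'I_n | gone x] \subset D :|: [set Ordinal n1; Ordinal n2].
    apply/subsetP => x; rewrite !inE -!val_eqE /= => /or3P[-> | -> |]; rewrite ?orbT //.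
    case/hasP=> e; rewrite mem_iota add0n => /= en; rewrite hitE //.
    rewrite A02 // => /andP[h /eqP sx]; rewrite sx in h.
    case/or4P: h => [->|->|h|h]; rewrite ?orbT //.
      (* An empty slot has equal ends. If it is hit, its source is itself a changed site and is
         counted as such. *)
      have [E|ne] := eqVneq (words st bSrc e) (words st bDst e); last first.
        apply/orP; left; apply/existsP; exists (Ordinal en).
        by rewrite /= sx eqxx -sx ne h.
      by rewrite -sx E h orbT.
    have [E|ne] := eqVneq (words st bSrc e) (words st bDst e); last first.
      apply/orP; left; apply/existsP; exists (Ordinal en).
      by rewrite /= sx eqxx -sx ne h orbT.
    by rewrite -sx E h !orbT.
  apply: leq_trans (subset_leq_card sub) _.
  apply: leq_trans (leq_card_setU _ _) _; rewrite leq_add ?card_links //.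
  by rewrite cards2; case: (_ == _).
split.
- by move=> x xn; rewrite l4; case: ifP => // _; apply: lv.
- move=> e en; have := sl e en.
  rewrite -[words st4 bSrc e]/(slot st4 e).1 -[words st4 bDst e]/(slot st4 e).2 s4 //.
  by case: ifP.
- move=> e e' en en' E; rewrite !s4 //; case: ifP => _ //; case: ifP => _ //.
  exact: inj.
- move=> x y xn yn; rewrite i4 x4 !l4.
  case gx: (gone x) => // + + ; case gy: (gone y) => // v lx ly.
  have [x1' x2'] : x != x1 /\ x != x2.
    by move/negbT: gx; rewrite !negb_or => /and3P[].
  have [y1' y2'] : y != x1 /\ y != x2.
    by move/negbT: gy; rewrite !negb_or => /and3P[].
  have v' : valid (words st aIn) (x, y).
    by move: v; rewrite /valid /=; have [_ ->] := same _ x1' x2'; have [_ ->] := same _ y1' y2'.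
  have [e [en le cv]] := cov x y xn yn v'; exists e; split=> //.
  have nh : ~~ hit st2 e.
    apply/negP => /(hit_gone e en) g; case/andP: cv => /orP[]/eqP E _; move: g.
      by rewrite -[words _ _ _]/(slot st e).1 E gx.
    by rewrite -[words _ _ _]/(slot st e).1 E gy.
  rewrite s4 // (negbTE nh) (covers_frame same) //.
  move: nh; rewrite hitE // !negb_or => /and4P[a b c f].
  by rewrite /= a b c f x1' x2' y1' y2'.
Qed.

(** * The level to rebuild *)

Lemma within_level_le l lev : within_level l lev <= n.
Proof.
rewrite /within_level -[X in _ <= X]card_ord -sum1_card; apply: leq_sum => x _.
exact: leq_b1.
Qed.

(** The bound on [2 ^ l] keeps the line within the available slots, and the final disjunction
    records the minimality of l, which the amortization needs. *)
Lemma within_find_top st :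
  words st aN 0 = n ->
  ends_within d W mw md st find_top (max_level.+2 * (n * 200)) (fun st' =>
    exists l, [/\ words st' bTop 0 = l /\ words st' bPow 0 = 2 ^ l,
      0 < l <= max_level, 2 ^ l <= 2 * n,
      within_level l (words st bLevel) <= 2 ^ l &
      l = 1 \/ 2 ^ l.-1 < within_level l.-1 (words st bLevel)]).
Proof.
move=> nE; pose lev := words st bLevel.
pose b := TNot (WLe (Var bCount) (Var bPow)).
apply: (@within_weaken _ _ _ _ _ _ _ _ (3 + (3 + (3 +
   max_level.+2 * (n.+1 * 50 + 40 + tcost b).+1).+1).+1).+1 _ (fun st' =>
    exists l, [/\ words st' bTop 0 = l /\ words st' bPow 0 = 2 ^ l,
      0 < l <= max_level, 2 ^ l <= 2 * n,
      within_level l lev <= 2 ^ l &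
      l = 1 \/ 2 ^ l.-1 < within_level l.-1 lev])) => //; last first.
  by rewrite /b /=; move: n_pos; move: max_level; clear; nia.
have W2 : 2 < W by apply: ltn_trans W8.
do 3![apply: within_seq; apply: within_wp; first by []; split; [by [] | by [] | by [] |]].
set st3 := State _ _.
have A3 : agree [:: bTop; bPow; bCount] st st3.
  move=> x; rewrite !inE !negb_or => /and3P[x1' x2' x3'].
  by rewrite /st3 /= !upd_neq.
have t3 : words st3 bTop 0 = 0 by [].
have p3 : words st3 bPow 0 = 1 by [].
have c3 : words st3 bCount 0 = 2 by [].
clearbody st3.
pose I m (st' : state R) := exists l, [/\ words st' bTop 0 = l /\ words st' bPow 0 = 2 ^ l,
  if l == 0 then words st' bCount 0 = 2 else words st' bCount 0 = within_level l lev,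
  l <= max_level /\ 2 ^ l <= 2 * n, m + l = max_level.+1 &
  l <= 1 \/ 2 ^ l.-1 < within_level l.-1 lev].
apply: (within_while (I := I)) => [|m st' A' [l [[tE pE] cE [lm ln] ml Hl]]].
  exists 0; split; rewrite ?addn0 //; last by left.
  by split=> //; rewrite muln_gt0.
have A1 : agree [:: bTop; bPow; bCount; bPos] st st'.
  by apply: agree_trans (agree_sub _ A3) (agree_sub _ A'); apply/allP.
split; first by do !split.
rewrite /b [test_val _ _ _]/= pE; case: (leqP (words st' bCount 0) (2 ^ l)) => [le|gt] /=.
  exists l; case: l => [|l] in tE pE cE lm ln ml Hl le *.
    by rewrite /= in cE; rewrite cE in le.
  rewrite /= in cE; rewrite cE in le; split=> //.
  by case: Hl => [|]; [case: l {tE pE cE lm ln ml le} => [|l] //; left | right].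
(* Another round starts only if more than 2^l of the n elements have level at most l, or if l =
   0. *)
have ll : 2 ^ l <= n.
  case: l => [|l] in tE pE cE lm ln ml Hl gt *; first by [].
  rewrite /= in cE; rewrite cE in gt.
  by apply: leq_trans (ltnW gt) (within_level_le _ _).
have l1 : l.+1 <= max_level by rewrite ltnS trunc_log_max.
split; first by move: ml l1; clear; lia.
have lW : l + 1 < W.
  rewrite addn1; apply: leq_ltn_trans W_large; apply: leq_trans (ltn_expl l (ltnSn 1)) _.
  by move: ll; clear; lia.
have ln2 : 2 ^ l.+1 <= 2 * n by rewrite expnS leq_mul2l.
have pW : 2 ^ l * 2 < W.
  by rewrite -expnSr; apply: leq_ltn_trans ln2 _; move: W_large; clear; lia.
apply: (@within_weaken _ _ _ _ _ _ _ _ (10 + (10 + (10 + n.+1 * (31 + 2 + 16)).+1).+1).+1 _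
  (I m.-1)) => //; last by clear; lia.
apply: within_seq; apply: within_wp; first by [].
split; [by [] | by split=> //; rewrite /= tE | by [] |].
apply: within_seq; apply: within_wp; first by [].
split; [by [] | by split=> //; rewrite /= /upd /= pE | by [] |].
apply: within_seq; apply: within_wp; first by [].
split; [by [] | by [] | by [] |].
set st4 := State _ _.
have A4 : agree [:: bTop; bPow; bCount] st' st4.
  move=> x; rewrite !inE !negb_or => /and3P[x1' x2' x3'].
  by rewrite /st4 /= !upd_neq.
have t4 : words st4 bTop 0 = l.+1 by transitivity (words st' bTop 0 + 1); [by [] | rewrite tE addn1].
have p4 : words st4 bPow 0 = 2 ^ l.+1.
  by transitivity (words st' bPow 0 * 2); [by [] | rewrite pE expnSr].
have c4 : words st4 bCount 0 = 0 by [].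
clearbody st4.
pose J j (st5 : state R) := words st5 bCount 0 = \sum_(x < j) (lev x <= l.+1).
have e4 x : x \notin [:: bTop; bPow; bCount; bPos] -> words st4 x = words st x.
  move=> xn; rewrite A4 ?A1 //; apply: contra xn; rewrite !inE.
  by case/or3P=> ->; rewrite ?orbT.
apply: (within_for (I := J) (m := n)) => //.
- by move=> j st5 _ A _; rewrite /= A // e4.
- by rewrite /J /= /upd /= big_ord0.
- move=> j st5 jn A jE JE.
  have levE : words st5 bLevel = lev by rewrite A // e4.
  have tE5 : words st5 bTop 0 = l.+1 by rewrite A.
  have bnd : \sum_(x < j) (lev x <= l.+1) <= j.
    rewrite -[X in _ <= X]card_ord -sum1_card; apply: leq_sum => x _.
    exact: leq_b1.
  apply: within_wp; first by [].
  split; first by rewrite /= jE; do !split.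
  rewrite [test_val _ _ _]/= jE levE tE5.
  have step : J j.+1 (State (upd (words st5) bCount 0
      (words st5 bCount 0 + (lev j <= l.+1))) (dists st5)).
    by rewrite /J /= /upd /= JE big_ord_recr.
  case: ifP => lj; rewrite lj in step; last first.
    by rewrite /J /= /upd /=; move: step; rewrite /J /= /upd /= addn0.
  split; [by [] | | by [] | by rewrite /J /= /upd /=; move: step; rewrite /J /= /upd /=].
  split=> //=; rewrite JE addn1.
  by apply: leq_ltn_trans nW; apply: leq_ltn_trans bnd jn.
- move=> st5 A JE; exists l.+1; split.
  + by rewrite !A.
  + exact: JE.
  + by [].
  + by move: ml l1; clear; lia.
  + case: l => [|l] in tE pE cE lm ln ml Hl gt ll l1 lW ln2 pW t4 p4 J JE *; first by left.
    by right; rewrite /= in cE; rewrite -cE.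
Qed.

Lemma within_raise_levels st l :
  words st aN 0 = n -> words st bTop 0 = l ->
  ends_within d W mw md st raise_levels (n.+1 * 60) (fun st' => forall x, x < n ->
    words st' bUsed x = 0 /\ words st' bLevel x = maxn (words st bLevel x) l).
Proof.
move=> nE tE.
pose I j (st' : state R) := forall x, x < n ->
  if x < j then words st' bUsed x = 0 /\ words st' bLevel x = maxn (words st bLevel x) l
  else words st' bLevel x = words st bLevel x.
apply: (@within_weaken _ _ _ _ _ _ _ _ (n.+1 * (30 + 2 + 16)) _ (I n)); last first.
- by move=> st' _ In x xn; have := In x xn; rewrite xn.
- by rewrite leq_mul2l.
apply: (within_for (I := I) (m := n)) => //.
- by move=> j st' _ A _; rewrite /= A.
- move=> j st' jn A jE Ij.
  have tE' : words st' bTop 0 = l by rewrite A.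
  have lE : words st' bLevel j = words st bLevel j by have := Ij j jn; rewrite ltnn.
  apply: within_wp; first by [].
  split; [by split; rewrite //= jE | by [] | by rewrite /= jE |].
  split; first by rewrite /= /upd /= jE; do !split.
  rewrite /= /upd /= jE lE tE'; case: ifP => le.
    split=> // x xn; rewrite /= ltnS leq_eqVlt.
    case: eqP => [->|_] /=; first by split=> //; rewrite (maxn_idPr le).
    exact: Ij.
  move=> x xn; rewrite /= ltnS leq_eqVlt.
  case: eqP => [->|_] /=; last exact: Ij.
  by split=> //; rewrite lE (maxn_idPl _) // ltnW // ltnNge le.
Qed.

Lemma within_clear_slots st p :
  words st bPow 0 = p -> 4 * p <= 8 * n ->
  ends_within d W mw md st clear_slots ((8 * n).+1 * 60) (fun st' => forall e,
    slot st' e = if e < 4 * p then (0, 0) else slot st e).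
Proof.
move=> pE pn.
pose I j (st' : state R) := forall e, slot st' e = if e < j then (0, 0) else slot st e.
apply: (@within_weaken _ _ _ _ _ _ _ _ ((4 * p).+1 * (30 + 4 + 16)) _ (I (4 * p))) => //;
  last by move: pn; clear; nia.
have pW : 4 * p < W by apply: leq_ltn_trans pn slotsW.
have W4 : 4 < W by apply: ltn_trans W8.
apply: (within_for (I := I) (m := 4 * p)) => //.
- move=> j st' _ A _.
  have pE' : words st' bPow 0 = p by rewrite A.
  by rewrite /= pE'.
- move=> j st' jp A jE Ij; have jn : j < 8 * n by apply: leq_trans pn.
  apply: within_wp; first by [].
  split; [by split; rewrite //= jE | by [] | by rewrite /= jE |].
  split; [by split; rewrite //= jE | by [] | by rewrite /= /upd /= jE |].
  move=> e; rewrite /slot /= /upd /= jE ltnS leq_eqVlt.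
  by case: eqP => [->|_] //=; apply: Ij.
Qed.

(** * Laying a new line *)

Definition picked l st (st' : state R) : Prop :=
  let c := words st' bCur 0 in
  if c < n then
    [/\ words st bLevel c <= l, words st bUsed c = 0 &
        words st' bUsed = fun x => if x == c then 1 else words st bUsed x]
  else
    [/\ c = n, words st' bUsed = words st bUsed &
      forall x, x < n -> words st bLevel x <= l -> 0 < words st bUsed x].

Lemma within_pick st l :
  words st aN 0 = n -> words st bTop 0 = l ->
  ends_within d W mw md st pick (n.+1 * 60 + 30) (picked l st).
Proof.
move=> nE tE.
pose I j (st' : state R) := let c := words st' bCur 0 in
  if c < n then words st bLevel c <= l /\ words st bUsed c = 0
  else c = n /\ forall x, x < j -> words st bLevel x <= l -> 0 < words st bUsed x.
apply: (@within_weaken _ _ _ _ _ _ _ _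
  (4 + (n.+1 * (30 + 2 + 16) + 20).+1).+1 _ (picked l st)) => //; last by clear; lia.
apply: within_seq; apply: within_wp; first by [].
split; [by [] | by [] | by [] |].
set st1 := State _ _.
have A1 : agree [:: bCur] st st1.
  by move=> x; rewrite !inE => x1'; rewrite /st1 /= upd_neq.
have c1 : words st1 bCur 0 = n by rewrite -nE.
clearbody st1.
apply: within_seq; apply: (within_for (I := I) (m := n)) => //.
- by move=> j st' _ A _; rewrite /= A // A1.
- by rewrite /I /= /upd /= c1 ltnn.
- move=> j st' jn A jE Ij.
  have tE' : words st' bTop 0 = l by rewrite A // A1.
  have lE : words st' bLevel = words st bLevel by rewrite A // A1.
  have uE : words st' bUsed = words st bUsed by rewrite A // A1.
  have skip : ~~ ((words st bUsed j <= 0) && (words st bLevel j <= l)) ->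
      I j.+1 (State (upd (words st') bPos 0 j.+1) (dists st')).
    move=> nj; move: Ij; rewrite /I /= /upd /=; case: ifP => // _ [cn H]; split=> // x.
    rewrite ltnS leq_eqVlt => /orP[/eqP->|]; last exact: H.
    by move=> lj; move: nj; rewrite lj andbT lt0n leqn0.
  apply: within_wp; first by [].
  split; first by rewrite /= jE; do !split.
  rewrite [test_val _ _ _]/= jE uE; case: ifP => uj; last by apply: skip; rewrite uj.
  split; first by rewrite /= jE; do !split.
  rewrite [test_val _ _ _]/= jE lE tE'; case: ifP => lj; last first.
    by apply: skip; rewrite lj andbF.
  split; [by [] | by split | by [] |].
  rewrite /I /= /upd /= jE jn; split=> //.
  by apply/eqP; rewrite -leqn0.
- move=> st' A In.
  have nE' : words st' aN 0 = n by rewrite A // A1.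
  have uE : words st' bUsed = words st bUsed by rewrite A // A1.
  apply: within_wp; first by [].
  split; first by do !split.
  rewrite [test_val _ _ _]/= nE'; move: In; rewrite /I /picked /=; case: leqP => cn.
    by case=> cE H; rewrite uE; split.
  case=> lc uc; split; [by split | by [] | by [] |].
  by rewrite /upd /= uE; split.
Qed.

Definition eligible l c st y : bool :=
  (words st bUsed y == 0) &&
  ((words st bLevel c <= l) || (words st bLevel y <= l)).

Definition scanned l c st (st' : state R) : Prop :=
  [/\ (best st').1 < n, (best st').2 < n,
      best st' = (0, 0) \/ (exists2 y, (y < n) && eligible l c st y &
        best st' = (c, y) \/ best st' = (y, c)) &
      forall y, y < n -> eligible l c st y ->
        better_in st (best st') (c, y) && better_in st (best st') (y, c)].

Lemma within_scan st l c :
  words st aN 0 = n -> in_range n st -> words st bTop 0 = l ->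
  words st bCur 0 = c -> c < n ->
  ends_within d W mw md st scan (n.+1 * 500) (scanned l c st).
Proof.
move=> nE rng tE cE cn.
pose I j (st' : state R) := [/\ (best st').1 < n, (best st').2 < n,
  best st' = (0, 0) \/ (exists2 y, (y < n) && eligible l c st y &
        best st' = (c, y) \/ best st' = (y, c)) &
  forall y, y < j -> eligible l c st y ->
    better_in st (best st') (c, y) && better_in st (best st') (y, c)].
apply: (@within_weaken _ _ _ _ _ _ _ _ (7 + n.+1 * (440 + 2 + 16)).+1 _ (scanned l c st)) => //;
  last by clear; lia.
apply: within_seq; apply: within_weaken (@within_no_best st) _ _ => // st1 A1 [B1 B2].
apply: (within_for (I := I) (m := n)) => //.
- by move=> j st' _ A _; rewrite /= A // A1.
- by split; rewrite //= /best /= /upd /= ?B1 ?B2 //; left.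
- move=> j st' jn A jE [b1 b2 bc bb].
  have e x : x \in [:: aNext; aIn; bUsed; bLevel; bTop; bCur] -> words st' x = words st x.
    rewrite !inE => xs; rewrite A ?A1 //; move: xs; do 5?[case/orP];
      by move/eqP->.
  have tE' : words st' bTop 0 = l by rewrite e.
  have cE' : words st' bCur 0 = c by rewrite e.
  have rng' : in_range n st' by rewrite /in_range e.
  have skip : ~~ eligible l c st j -> I j.+1 (State (upd (words st') bPos 0 j.+1) (dists st')).
    move=> nj; split=> // y; rewrite ltnS leq_eqVlt => /orP[/eqP->|]; last exact: bb.
    by rewrite (negbTE nj).
  have take : eligible l c st j -> ends_within d W mw md st'
      (pair_offers (Var bCur) (Var bPos)) 403
      (fun st1 => I j.+1 (State (upd (words st1) bPos 0 j.+1) (dists st1))).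
    move=> el.
    have s1 : stable n W priv st' (Var bCur).
      by split; rewrite //= ?cE' // => st2 A2; rewrite A2.
    have s2 : stable n W priv st' (Var bPos).
      by split; rewrite //= ?jE // => st2 A2; rewrite A2.
    apply: (within_weaken (within_pair_offers rng' b1 b2 s1 s2)) => // st2 _.
    rewrite /= cE' jE !e // => -[B /and4P[c0 c1 c2 _]].
    have [d1 d2] : (best st2).1 < n /\ (best st2).2 < n.
      by move: B; rewrite !inE => /or3P[]/eqP->.
    split; [exact: d1 | exact: d2 | |].
    + move: B; rewrite !inE => /or3P[]/eqP E.
      * by rewrite -[best (State _ _)]/(best st2) E.
      * by right; exists j; [rewrite jn | left].
      * by right; exists j; [rewrite jn | right].
    + move=> y; rewrite ltnS leq_eqVlt => /orP[/eqP-> _|yj el']; first by rewrite c1 c2.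
      have /andP[o1 o2] := bb y yj el'.
      by rewrite (better_trans c0 o1) (better_trans c0 o2).
  apply: (@within_weaken _ _ _ _ _ _ _ _ 440 _
    (fun st1 => I j.+1 (State (upd (words st1) bPos 0 j.+1) (dists st1)))) => //.
  have sk : ~~ eligible l c st j -> forall T, 0 < T -> ends_within d W mw md st' Skip T
      (fun st1 => I j.+1 (State (upd (words st1) bPos 0 j.+1) (dists st1))).
    by move=> nel T T0; apply: within_wp => //; apply: skip.
  have u0 : (words st' bUsed j <= 0) = (words st bUsed j == 0) by rewrite e // leqn0.
  apply: (@within_if _ _ _ _ _ _ _ _ _ _ 434) => [|uj|uj].
  - by rewrite /= jE.
  - apply: (@within_weaken _ _ _ _ _ _ _ _ (6 + (6 + 403).+1).+1 _
      (fun st1 => I j.+1 (State (upd (words st1) bPos 0 j.+1) (dists st1)))) => //.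
    apply: within_if => [|lc|lc].
    + by rewrite /= cE'.
    + apply: within_weaken (take _) _ _ => //; rewrite /eligible -u0.
      by move: uj lc; rewrite /= jE cE' tE' (e bLevel) // => -> ->.
    + apply: within_if => [|lj|lj].
      * by rewrite /= jE.
      * apply: take; rewrite /eligible -u0.
        by move: uj lj; rewrite /= jE tE' (e bLevel) // => -> ->; rewrite orbT.
      * apply: sk => //; rewrite /eligible -u0 negb_and.
        move: lc lj; rewrite /= jE cE' tE' (e bLevel) // => /negbTE -> /negbTE ->.
        by rewrite orbT.
  - apply: sk => //; rewrite /eligible -u0 negb_and.
    by move: uj; rewrite /= jE => ->.
Qed.

Definition line_writes :=
  [:: aBestE; aBestS; aCandE; aCandS; bSrc; bDst; bUsed; bPos; bCur; bSlot].

Definition in_line l w e : bool := 2 * 2 ^ l <= e < 2 * 2 ^ l + w.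

Definition covered l w st (st' : state R) x y : Prop :=
  exists2 e, in_line l w e & covers (words st aNext) (words st aIn) (slot st' e) x y.

Definition opposite st x y : bool :=
  valid (words st aIn) (x, y) || valid (words st aIn) (y, x).

Definition used_members l st (st' : state R) : nat :=
  \sum_(x < n) ((words st bLevel x <= l) && (0 < words st' bUsed x)).

(* [w] links have been laid since the state [st] in which the line of level [l]
   was begun. *)
Definition line_links l w st (st' : state R) : Prop :=
  [/\ agree line_writes st st', words st' bSlot 0 = 2 * 2 ^ l + w,
      forall e, ~~ in_line l w e -> slot st' e = slot st e,
      forall e, in_line l w e -> [/\ (slot st' e).1 < n, (slot st' e).2 < n &
        0 < words st' bUsed (slot st' e).2] &
      forall e e', in_line l w e -> in_line l w e' ->
        (slot st' e).2 = (slot st' e').2 -> e = e'].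

(* Every used element other than the current end of the line has seen all
   elements that were then unused. *)
Definition line_covers l w st (st' : state R) (c : nat) : Prop :=
  forall x y, x < n -> y < n -> opposite st x y ->
    (words st bLevel x <= l) || (words st bLevel y <= l) ->
    0 < words st' bUsed x -> x != c -> covered l w st st' x y.

(** Grows at every step that does not end the line. A move from a member to a nonmember gains 1
    through the subtracted term, and a move or restart that reaches a member raises the doubled
    count by 2. As one end of each link is a member, no other move occurs. *)
Definition progress l st (st' : state R) : nat :=
  2 * used_members l st st' - (words st bLevel (words st' bCur 0) <= l).

(** The bound on w keeps the number of links within twice the number of members, hence within the
    [2 * 2 ^ l] slots of the block. *)
Definition line_inv l st (st' : state R) : Prop :=
  let c := words st' bCur 0 in
  exists w, [/\ line_links l w st st', line_covers l w st st' c &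
    if c < n then
      0 < words st' bUsed c /\
      w + (1 + (words st bLevel c <= l)) <= 2 * used_members l st st'
    else [/\ c = n, w <= 2 * used_members l st st' &
      forall x, x < n -> words st bLevel x <= l -> 0 < words st' bUsed x]].

Lemma in_lineS l w e : in_line l w.+1 e = in_line l w e || (e == 2 * 2 ^ l + w).
Proof. by rewrite /in_line addnS ltnS; move: (2 * 2 ^ l) => b; lia. Qed.

Lemma used_membersS l st st1 st2 y : y < n -> words st1 bUsed y = 0 ->
  words st2 bUsed = (fun x => if x == y then 1 else words st1 bUsed x) ->
  used_members l st st2 = used_members l st st1 + (words st bLevel y <= l).
Proof.
move=> yn u1 u2; rewrite /used_members (bigD1 (Ordinal yn)) //= u2 eqxx andbT.
rewrite [in RHS](bigD1 (Ordinal yn)) //= u1 ltnn andbF add0n addnC; congr (_ + _).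
apply: eq_bigr => x; rewrite -val_eqE /= => /negbTE xy.
by rewrite xy.
Qed.

Lemma used_members_le l st st' :
  used_members l st st' <= within_level l (words st bLevel).
Proof. by apply: leq_sum => x _; case: (_ <= l); case: (0 < _). Qed.

Lemma line_links_frame l w st st1 st2 : line_links l w st st1 ->
  agree line_writes st st2 -> words st2 bSlot = words st1 bSlot ->
  words st2 bSrc = words st1 bSrc -> words st2 bDst = words st1 bDst ->
  (forall x, 0 < words st1 bUsed x -> 0 < words st2 bUsed x) ->
  line_links l w st st2.
Proof.
move=> [_ sE so si inj] A2 e21 e13 e14 mono.
have sl e : slot st2 e = slot st1 e by rewrite /slot e13 e14.
split=> // [|e|e|e e']; rewrite ?e21 // ?sl; first exact: so.
  by move=> /si[a b /mono].
exact: inj.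
Qed.

Lemma within_pick_line l w st st' :
  words st aN 0 = n -> words st bTop 0 = l ->
  line_links l w st st' -> line_covers l w st st' n ->
  w <= 2 * used_members l st st' ->
  ends_within d W mw md st' pick (n.+1 * 60 + 30) (fun st2 => line_inv l st st2 /\
    (words st2 bCur 0 < n -> 2 * used_members l st st' < progress l st st2)).
Proof.
move=> nE tE ll lc wU.
have [A sE so si inj] := ll.
have nE' : words st' aN 0 = n by rewrite A.
have tE' : words st' bTop 0 = l by rewrite A.
apply: (within_weaken (within_pick nE' tE')) => // st2 A2.
have {}A2 : agree [:: bUsed; bPos; bCur] st' st2 by apply: agree_sub A2; apply/allP.
have Al : agree line_writes st st2.
  by apply: agree_trans A (agree_sub _ A2); apply/allP.
rewrite /picked /line_inv (A bLevel) //; set c := words st2 bCur 0.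
have cov st3 z y : words st3 bSrc = words st' bSrc -> words st3 bDst = words st' bDst ->
    covered l w st st' z y -> covered l w st st3 z y.
  by move=> e13 e14 [e ie cv]; exists e; rewrite // /slot e13 e14.
case: ltnP => cn.
  case=> lc' uc u2.
  have U2 := used_membersS l st cn uc u2; rewrite lc' in U2.
  split; last by move=> _; rewrite /progress -/c lc' U2; clear; lia.
  exists w; split.
  - apply: (line_links_frame ll Al); [exact: A2 | exact: A2 | exact: A2 |].
    by move=> x; rewrite u2; case: ifP.
  - move=> x y xn yn op el; rewrite u2 => + xc; rewrite (negbTE xc) => ux.
    by apply: cov (lc x y xn yn op el ux _); rewrite ?A2 // neq_ltn xn.
  - split; first by rewrite u2 eqxx.
    by rewrite lc' U2; move: wU; clear; lia.
case=> cE u2 all_used.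
have U2 : used_members l st st2 = used_members l st st' by rewrite /used_members u2.
split=> //; exists w; split.
- by apply: (line_links_frame ll Al); [exact: A2 | exact: A2 | exact: A2 | rewrite u2].
- move=> x y xn yn op el; rewrite u2 => ux xc.
  by apply: cov (lc x y xn yn op el ux _); rewrite ?A2 // neq_ltn xn.
- by split=> //; rewrite ?U2 // => x xn lx; rewrite u2; apply: all_used.
Qed.

Lemma within_advance st c y p :
  words st bSlot 0 = p -> words st bCur 0 = c -> p < 8 * n -> c < n -> y < n ->
  best st = (c, y) \/ best st = (y, c) ->
  ends_within d W mw md st advance 50 (fun st' =>
    [/\ words st' bUsed = (fun x => if x == y then 1 else words st bUsed x),
        words st' bCur 0 = y, words st' bSlot 0 = p.+1,
        slot st' p = (c, y) & forall e, e != p -> slot st' e = slot st e]).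
Proof.
move=> pE cE pn cn yn bE.
have yE : words st aBestE 0 + words st aBestS 0 - c = y.
  by case: bE => -[-> ->]; rewrite ?addnK // addnC addnK.
have sW : words st aBestE 0 + words st aBestS 0 < W.
  case: bE => -[-> ->]; move: W_large cn yn; clear; lia.
have p1W : p + 1 < W by move: W_large pn n_pos; clear; lia.
apply: within_wp => //.
split; [by [] | by [] | by rewrite /= pE |].
split; [by [] | by do !split | by [] |].
split; [by [] | by [] | by rewrite /= /upd /= pE |].
split; [by [] | by split=> //; rewrite /= /upd /= pE | by [] |].
split; [by [] | by [] | by rewrite /= /upd /= cE yE |].
rewrite /slot /= /upd /= pE cE yE eqxx addn1; split=> // e /negbTE ->.
by [].
Qed.

Lemma within_conga_step l st st' :
  words st aN 0 = n -> in_range n st -> words st bTop 0 = l ->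
  within_level l (words st bLevel) <= 2 ^ l -> 4 * 2 ^ l <= 8 * n ->
  line_inv l st st' -> words st' bCur 0 < n ->
  ends_within d W mw md st' conga_step (n.+1 * 700) (fun st2 => line_inv l st st2 /\
    (words st2 bCur 0 < n -> progress l st st' < progress l st st2)).
Proof.
move=> nE rng tE small room [w [ll lc]]; set c := words st' bCur 0.
rewrite -/c => + cn; rewrite cn => -[uc wU].
have [A sE so si inj] := ll.
have nE' : words st' aN 0 = n by rewrite A.
have tE' : words st' bTop 0 = l by rewrite A.
have lE' : words st' bLevel = words st bLevel by rewrite A.
have iE' : words st' aIn = words st aIn by rewrite A.
have xE' : words st' aNext = words st aNext by rewrite A.
have rng' : in_range n st' by rewrite /in_range xE'.
pose Q st2 := line_inv l st st2 /\
    (words st2 bCur 0 < n -> progress l st st' < progress l st st2).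
apply: (@within_weaken _ _ _ _ _ _ _ _ (n.+1 * 500 + (5 + (5 + (n.+1 * 60 + 50)).+1).+1).+1
  _ Q) => //; last by clear; lia.
apply: within_seq; apply: within_weaken (within_scan nE' rng' tE' erefl cn) _ _ => //.
rewrite -/c => st1 A1 [b1 b2 bc bb]; rewrite iE' xE' in bb.
have {}A1 : agree [:: aBestE; aBestS; aCandE; aCandS; bPos] st' st1.
  by apply: agree_sub A1; apply/allP.
have A01 : agree line_writes st st1.
  by apply: agree_trans A (agree_sub _ A1); apply/allP.
have uE1 : words st1 bUsed = words st' bUsed by apply: A1.
have iE1 : words st1 aIn = words st aIn by rewrite A01.
have ll1 : line_links l w st st1.
  by apply: (line_links_frame ll A01); [exact: A1 | exact: A1 | exact: A1 | rewrite uE1].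
have U1 : used_members l st st1 = used_members l st st' by rewrite /used_members uE1.
have cov1 z y : covered l w st st' z y -> covered l w st st1 z y.
  by case=> e ie cv; exists e; rewrite // /slot !(A1 bSrc, A1 bDst).
have lc1 : line_covers l w st st1 c.
  by move=> x y xn yn op el; rewrite uE1 => ux xc; apply: cov1; apply: lc.
have covC z y : covered l w st st1 z y -> covered l w st st1 y z.
  by case=> e ie cv; exists e; rewrite // coversC.
have opC z y : opposite st z y -> opposite st y z by rewrite /opposite orbC.
have pr_le : progress l st st' <= 2 * used_members l st st' - (words st bLevel c <= l).
  by [].
have elE y : eligible l c st' y = (words st' bUsed y == 0) &&
    ((words st bLevel c <= l) || (words st bLevel y <= l)) by rewrite /eligible lE'.
have op_neq y : opposite st c y -> y != c.
  by apply: contraTneq => ->; rewrite /opposite orbb; apply: valid_diag.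
have stop : ~~ valid (words st aIn) (best st1) ->
    ends_within d W mw md st1 pick (n.+1 * 60 + 50) Q.
  move=> nv.
  have lcn : line_covers l w st st1 n.
    move=> x y xn yn op el ux _; case: (eqVneq x c) => [xc|]; last exact: lc1.
    rewrite xc in op el *; have [uy|uy] := posnP (words st' bUsed y).
      have := bb y yn; rewrite elE uy el => /(_ isT) /andP[].
      by move: op nv; rewrite /better => /orP[] -> /negbTE ->.
    by apply: covC; apply: lc1 => //; rewrite ?uE1 ?op_neq // 1?orbC //; apply: opC.
  have wU1 : w <= 2 * used_members l st st1.
    by rewrite U1; move: wU; clear; lia.
  apply: within_weaken (within_pick_line nE tE ll1 lcn wU1) _ _ => //.
    by clear; lia.
  move=> st2 _ [inv pr]; split=> // /pr; rewrite U1; apply: leq_ltn_trans.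
  by apply: leq_trans pr_le _; apply: leq_subr.
have go : valid (words st aIn) (best st1) ->
    ends_within d W mw md st1 advance (n.+1 * 60 + 50) Q.
  move=> v; case: bc => [E|[y /andP[yn ely] bE]].
    by rewrite E in v; case/negP: (valid_diag (words st aIn) 0).
  move: ely; rewrite elE => /andP[/eqP uy el].
  have p1 : words st1 bSlot 0 = 2 * 2 ^ l + w by rewrite A1.
  have c1 : words st1 bCur 0 = c by rewrite A1.
  have Ule := used_members_le l st st'.
  (* There is a free slot: the invariant leaves w strictly below twice the number of used members,
     which is at most [2 * 2 ^ l]. *)
  have w2 : w < 2 * 2 ^ l by move: wU Ule small; clear; lia.
  have pn : 2 * 2 ^ l + w < 8 * n by move: w2 room; clear; lia.
  apply: within_weaken (within_advance p1 c1 pn cn yn bE) _ _ => //.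
  move=> st2 A2 [u2 cur2 s2 new2 old2].
  have {}A2 : agree [:: bSrc; bDst; bCur; bSlot; bUsed] st1 st2.
    by apply: agree_sub A2; apply/allP.
  have A02 : agree line_writes st st2.
    by apply: agree_trans A01 (agree_sub _ A2); apply/allP.
  rewrite uE1 in u2.
  have U2 := used_membersS l st yn uy u2.
  have nin : ~~ in_line l w (2 * 2 ^ l + w) by rewrite /in_line ltnn andbF.
  have oldslot e : e != 2 * 2 ^ l + w -> slot st2 e = slot st' e.
    by move=> ne; rewrite old2 // /slot !(A1 bSrc, A1 bDst).
  have inold e : in_line l w e -> slot st2 e = slot st' e.
    by move=> ie; apply: oldslot; apply: contraNneq nin => <-.
  have cov2 z z' : covered l w st st1 z z' -> covered l w.+1 st st2 z z'.
    case=> e ie cv; exists e; first by rewrite in_lineS ie.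
    by rewrite inold // /slot -(A1 bSrc) // -(A1 bDst).
  have used2 x : 0 < words st' bUsed x -> 0 < words st2 bUsed x.
    by rewrite u2; case: eqP.
  split; last first.
    move=> _; rewrite /progress cur2 -/c U2; move: wU el.
    by case: (words st bLevel c <= l); case: (words st bLevel y <= l) => //=; clear; lia.
  rewrite /line_inv cur2 yn; exists w.+1; split.
  - split; [exact: A02 | by rewrite s2 addnS | | |].
    + move=> e; rewrite in_lineS negb_or => /andP[ne ne'].
      by rewrite oldslot // so.
    + move=> e; rewrite in_lineS => /orP[ie|/eqP->].
        by rewrite inold //; have [a b f] := si e ie; split=> //; apply: used2.
      by rewrite new2 /= cn yn u2 eqxx.
    + have fresh e : in_line l w e -> (slot st' e).2 != y.
        by move=> /si[_ _]; apply: contraTneq => ->; rewrite uy.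
      move=> e e'; rewrite !in_lineS => /orP[ie|/eqP->] /orP[ie'|/eqP->] //.
      * by rewrite !inold //; apply: inj.
      * by rewrite (inold e ie) new2 /= => E; case/eqP: (fresh e ie).
      * by rewrite (inold e' ie') new2 /= => E; case/eqP: (fresh e' ie').
  - move=> x z xn zn op elx; rewrite u2 => ux xy; rewrite (negbTE xy) in ux.
    case: (eqVneq x c) => [xc|xc]; last by apply: cov2; apply: lc1 => //; rewrite uE1.
    rewrite xc in op elx *; have [uz|uz] := posnP (words st' bUsed z).
      have := bb z zn; rewrite elE uz elx => /(_ isT) /andP[bt1 bt2].
      exists (2 * 2 ^ l + w); first by rewrite in_lineS eqxx orbT.
      rewrite new2 /covers /= eqxx /=.
      by case: bE => E; rewrite E in bt1 bt2; rewrite /swap /= bt1 bt2 ?orbT.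
    by apply: cov2; apply: covC; apply: lc1 => //;
      rewrite ?uE1 ?op_neq // 1?orbC //; apply: opC.
  - split; first by rewrite u2 eqxx.
    rewrite U2; move: wU el.
    by case: (words st bLevel c <= l); case: (words st bLevel y <= l) => //=; clear; lia.
apply: within_if => [|v1|v1].
- by do !split.
- apply: within_if => [|v2|v2].
  + by do !split.
  + apply: go; move: v1 v2; rewrite /= iE1 /valid /best /= leqn0 => -> ->; done.
  + apply: stop; move: v2; rewrite /= iE1 /valid /best /= leqn0 => /negbTE ->.
    by rewrite andbF.
- apply: (@within_weaken _ _ _ _ _ _ _ _ (n.+1 * 60 + 50) _ Q) => //;
    last by clear; lia.
  by apply: stop; move: v1; rewrite /= iE1 /valid /best /= => /negbTE ->.
Qed.

Lemma within_conga_line l st :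
  words st aN 0 = n -> in_range n st -> words st bTop 0 = l ->
  words st bPow 0 = 2 ^ l ->
  within_level l (words st bLevel) <= 2 ^ l -> 4 * 2 ^ l <= 8 * n ->
  (forall x, x < n -> words st bUsed x = 0) ->
  ends_within d W mw md st conga_line
    ((2 * within_level l (words st bLevel) + 2) * (n.+1 * 720)) (fun st' =>
      exists w, [/\ line_links l w st st', w <= 2 * 2 ^ l &
        forall x y, x < n -> y < n -> opposite st x y ->
          words st bLevel x <= l -> covered l w st st' x y]).
Proof.
move=> nE rng tE pE small room u0; set N := within_level l _ in small *.
pose Q st' := exists w, [/\ line_links l w st st', w <= 2 * 2 ^ l &
        forall x y, x < n -> y < n -> opposite st x y ->
          words st bLevel x <= l -> covered l w st st' x y].
pose b := TNot (WLe (Var aN) (Var bCur)).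
apply: (@within_weaken _ _ _ _ _ _ _ _
  (10 + (n.+1 * 60 + 30 + (2 * N).+1 * (n.+1 * 700 + tcost b).+1).+1).+1 _ Q) => //;
  last first.
  by rewrite /b /=; move: n_pos; clear; move: N => N; nia.
have W2 : 2 < W by apply: ltn_trans W8.
apply: within_seq; apply: within_wp; first by [].
split; [by [] | split=> //=; rewrite pE | by [] |].
  by move: W_large room; clear; move: (2 ^ l) => p; lia.
set st1 := State _ _.
have A1 : agree line_writes st st1.
  move=> x; rewrite /line_writes !inE !negb_or => xs; apply: upd_neq.
  by move: xs; do 9![case/andP=> _].
have ll1 : line_links l 0 st st1.
  split=> //; first by rewrite addn0 -pE.
  - by move=> e; rewrite /in_line addn0 => /andP[a c]; have := leq_ltn_trans a c; rewrite ltnn.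
  - by move=> e e'; rewrite /in_line addn0 => /andP[a c]; have := leq_ltn_trans a c; rewrite ltnn.
have lc1 : line_covers l 0 st st1 n.
  by move=> x y xn _ _ _; rewrite -[words st1 _]/(words st bUsed) u0.
apply: within_seq.
apply: within_weaken (within_pick_line nE tE ll1 lc1 (leq0n _)) _ _ => //.
move=> st2 _ [inv2 pr2].
(* The progress never exceeds 2N, so with the remaining iterations it must stay above 2N as long as
   the line is not finished. *)
pose I m st' := line_inv l st st' /\
  (words st' bCur 0 < n -> (2 * N).+1 <= m + progress l st st').
apply: (within_while (I := I)) => [|m st' _ [inv pr]].
  by split=> // cn; rewrite -addn1 leq_add2l; apply: leq_ltn_trans (pr2 cn).
have A' : agree line_writes st st' by case: inv => w [[]].
have nE' : words st' aN 0 = n by rewrite A'.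
split; first by do !split.
rewrite /b [test_val _ _ _]/= nE'; case: (leqP n (words st' bCur 0)) => [ge|cn] /=.
  case: inv => w [ll lc]; rewrite ltnNge ge /= => -[cE wU all_used].
  exists w; split=> //.
    apply: leq_trans wU _; rewrite leq_mul2l /=.
    exact: leq_trans (used_members_le _ _ _) small.
  move=> x y xn yn op lx; apply: lc; rewrite ?lx ?all_used //.
  by rewrite cE neq_ltn xn.
split.
  have p2 : progress l st st' <= 2 * N.
    apply: leq_trans (leq_subr _ _) _; rewrite leq_mul2l /=.
    exact: used_members_le.
  by have := leq_trans (pr cn) (leq_add (leqnn m) p2); clear; move: N => N; lia.
apply: within_weaken (within_conga_step nE rng tE small room inv cn) _ _ => //.
move=> st3 _ [inv3 pr3]; split=> // cn3.
by have := pr cn; have := pr3 cn3; clear; move: N => N; lia.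
Qed.

(** A line on N members takes 2N + 2 units of [n.+1 * 720]. When r elements rise, N is at most 2 +
    2r, so the cost is at most 6 + 4r units and each risen level has to pay 4. *)
Definition potential_rate : nat := 4 * (n.+1 * 720).

(** The new line covers the opposite pairs with an element of level at most l. The others keep a
    link from a line above l, which is neither cleared nor overwritten. *)
Lemma conga_repair_spec st st1 x1 x2 :
  conga_clean st -> words st1 aN 0 = n -> in_range n st1 ->
  agree [:: aNext; aIn; aBestE; aBestS; aNew1; aNew2] st st1 ->
  words st1 aNew1 0 = x1 -> words st1 aNew2 0 = x2 -> x1 < n -> x2 < n ->
  (forall y, y != x1 -> y != x2 ->
     words st1 aNext y = words st aNext y /\ words st1 aIn y = words st aIn y) ->
  ends d W mw md st1 conga_repair (fun k st' =>
    k + potential_rate * \sum_(x < n) words st bLevel x <=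
      potential_rate * \sum_(x < n) words st' bLevel x +
        (potential_rate * loss + (max_level + 10) * (n.+1 * 2000))
    /\ conga_clean st').
Proof.
move=> cl nE rng A1 e1 e2 n1 n2 same.
apply: ends_seq; apply: ends_weaken (within_drop cl nE A1 e1 e2 n1 n2 same) _.
move=> k2 st2 A2 [le2 [dirty sum2]].
have {}A2 : agree [:: bPos; bUsed; bLevel; bSrc; bDst] st1 st2.
  by apply: agree_sub A2; apply/allP.
have nE2 : words st2 aN 0 = n by rewrite A2.
apply: ends_seq; apply: ends_weaken (within_find_top nE2) _.
move=> k3 st3 A3 [le3 [l [[tE3 pE3] /andP[l0 lm] ln small Hl]]].
have {}A3 : agree [:: bTop; bPow; bCount; bPos] st2 st3.
  by apply: agree_sub A3; apply/allP.
have nE3 : words st3 aN 0 = n by rewrite A3.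
apply: ends_seq; apply: ends_weaken (within_raise_levels nE3 tE3) _.
move=> k4 st4 A4 [le4 raised].
have {}A4 : agree [:: bPos; bUsed; bLevel] st3 st4 by apply: agree_sub A4; apply/allP.
have pE4 : words st4 bPow 0 = 2 ^ l by rewrite A4.
have room : 4 * 2 ^ l <= 8 * n by move: ln; clear; move: (2 ^ l) => p; lia.
apply: ends_seq; apply: ends_weaken (within_clear_slots pE4 room) _.
move=> k5 st5 A5 [le5 cleared].
have {}A5 : agree [:: bPos; bSrc; bDst] st4 st5 by apply: agree_sub A5; apply/allP.
have [lv2 sl2 inj2 cov2] := dirty.
have lv x : x < n -> words st5 bLevel x = maxn (words st2 bLevel x) l.
  by move=> xn; rewrite A5 //; have [_ ->] := raised x xn; rewrite A3.
have us x : x < n -> words st5 bUsed x = 0.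
  by move=> xn; rewrite A5 //; have [->] := raised x xn.
have sl e : slot st5 e = if e < 4 * 2 ^ l then (0, 0) else slot st2 e.
  by rewrite cleared; case: ifP => // _; rewrite /slot !(A4 bSrc, A4 bDst, A3 bSrc, A3 bDst).
have same_level : within_level l (words st5 bLevel) = within_level l (words st2 bLevel).
  by apply: eq_bigr => x _; rewrite lv // geq_max leqnn andbT.
have nE5 : words st5 aN 0 = n by rewrite A5 // A4.
have rng5 : in_range n st5.
  by move=> x; rewrite A5 // A4 // A3 // A2 //; apply: rng.
have tE5 : words st5 bTop 0 = l by rewrite A5 // A4.
have pE5 : words st5 bPow 0 = 2 ^ l by rewrite A5 // A4.
have small5 : within_level l (words st5 bLevel) <= 2 ^ l by rewrite same_level.
apply: ends_weaken (within_conga_line nE5 rng5 tE5 pE5 small5 room us) _.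
move=> k6 st6 _ [le6 [w [ll w2 cov]]]; rewrite same_level in le6.
have [A6 _ so si inj6] := ll.
have E x : x \in [:: aIn; aNext] -> words st6 x = words st5 x /\ words st5 x = words st2 x.
  by rewrite !inE => /orP[]/eqP->; split; [exact: A6 | rewrite A5 // A4 // A3
    | exact: A6 | rewrite A5 // A4 // A3].
have [i65 i52] := E aIn isT; have [x65 x52] := E aNext isT.
have l6 x : x < n -> words st6 bLevel x = maxn (words st2 bLevel x) l.
  by move=> xn; rewrite A6 // lv.
split.
  (* These r elements rise by at least one level. Minimality of l gives r > 2^(l-1), except for l =
     1, where the line has at most two members anyway. *)
  pose r := within_level l.-1 (words st2 bLevel).
  have rise : \sum_(x < n) words st2 bLevel x + r <= \sum_(x < n) words st6 bLevel x.
    rewrite /r /within_level -big_split /=; apply: leq_sum => x _; rewrite l6 //.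
    by move: l0; clear; case: leqP; lia.
  have Nr : within_level l (words st2 bLevel) <= 2 + 2 * r.
    apply: leq_trans small _; case: Hl => [->|lt]; first exact: leq_addr.
    rewrite -[X in 2 ^ X](prednK l0) expnS; apply: leq_trans (leq_addl _ _).
    by rewrite leq_mul2l ltnW.
  move: sum2 rise Nr le2 le3 le4 le5 le6; rewrite /potential_rate.
  move: (\sum_(x < n) words st bLevel x) (\sum_(x < n) words st2 bLevel x)
    (\sum_(x < n) words st6 bLevel x) r (within_level l _) loss max_level.
  clear => a s2 s6 r N L ml sum2 rise Nr le2 le3 le4 le5 le6.
  have k6' : k6 <= (6 + 4 * r) * (n.+1 * 720).
    by apply: leq_trans le6 _; rewrite leq_mul2r; apply/orP; right; lia.
  have : 4 * (n.+1 * 720) * (a + r) <= 4 * (n.+1 * 720) * (s6 + L).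
    by rewrite leq_mul2l; apply/orP; right; lia.
  move: k6' le2 le3 le4 le5; clear; nia.
have inl e : in_line l w e -> trunc_log 2 e = l.+1 /\ e < 4 * 2 ^ l.
  case/andP=> a c; have lt : e < 4 * 2 ^ l.
    by apply: leq_trans c _; move: w2; clear; move: (2 ^ l) => p; lia.
  by split=> //; apply: trunc_log_eq => //; rewrite !expnS a mulnA lt.
have big_slot e : ~~ in_line l w e -> slot st6 e = if e < 4 * 2 ^ l then (0, 0) else slot st2 e.
  by move=> ie; rewrite so // sl.
split.
- by move=> x xn; rewrite l6 // geq_max lv2 // lm.
- move=> e en; have [ie|ie] := boolP (in_line l w e); first by have [] := si e ie.
  have := big_slot e ie; case: ifP => _ [-> ->] //; exact: sl2.
(* In the block of the new line every slot not written by it has just been cleared, so entries of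
   different lines never share a block. *)
- have mixed e e' : in_line l w e -> ~~ in_line l w e' -> trunc_log 2 e = trunc_log 2 e' ->
      (slot st6 e').1 = (slot st6 e').2.
    move=> /inl[te _] ie' te'; rewrite big_slot //.
    have := @trunc_log_ltn 2 e' isT; rewrite -te' te 2!expnS mulnA => lt.
    by rewrite lt.
  move=> e e' en en' te ne ne' se.
  have [ie|ie] := boolP (in_line l w e); have [ie'|ie'] := boolP (in_line l w e').
  + exact: inj6.
  + by rewrite (mixed e e') ?eqxx in ne'.
  + by rewrite (mixed e' e) ?eqxx in ne.
  + move: ne ne' se; rewrite !big_slot //; case: ifP => // _; case: ifP => // _.
    exact: inj2.
- move=> x y xn yn v; rewrite !l6 //.
  have oxy : opposite st5 x y by rewrite /opposite -i65 v.
  have in_cov z z' : z < n -> words st2 bLevel z <= l ->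
      covered l w st5 st6 z z' -> exists e, [/\ e < 8 * n,
        2 ^ (minn (maxn (words st2 bLevel z) l) (maxn (words st2 bLevel z') l)).+1 <= e &
        covers (words st6 aNext) (words st6 aIn) (slot st6 e) z z'].
    move=> zn lz [e ie cv]; exists e; have [_ lt] := inl e ie; split.
    + exact: leq_trans lt room.
    + case/andP: ie => le _; apply: leq_trans le; rewrite -expnS leq_exp2l // ltnS.
      by rewrite (maxn_idPr lz) geq_minl.
    + by rewrite i65 x65.
  have [lx|] := boolP (words st2 bLevel x <= l).
    by apply: (in_cov x y) => //; apply: cov => //; rewrite lv // (maxn_idPr lx).
  rewrite -ltnNge => lx; have [ly|] := boolP (words st2 bLevel y <= l).
    have [|e [en le cv]] := in_cov y x yn ly.
      by apply: cov => //; rewrite ?lv ?(maxn_idPr ly) // /opposite orbC.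
    by exists e; split; rewrite // 1?minnC // coversC.
  rewrite -ltnNge => ly.
  have [|e [en le cv]] := cov2 x y xn yn _ (leq_ltn_trans (leq0n l) lx)
    (leq_ltn_trans (leq0n l) ly).
    by rewrite -i52 -i65.
  (* Both levels exceed l, so the old link lies at or beyond slot 2^(l+2), just past the cleared
     range. *)
  have big : 4 * 2 ^ l <= e.
    apply: leq_trans le; rewrite (_ : 4 * 2 ^ l = 2 ^ l.+2); last by rewrite !expnS mulnA.
    by rewrite leq_exp2l // ltnS leq_min lx ly.
  have nie : ~~ in_line l w e.
    by apply/negP => /inl[_]; rewrite ltnNge big.
  exists e; split=> //.
    by rewrite (maxn_idPl (ltnW lx)) (maxn_idPl (ltnW ly)).
  by rewrite i65 x65 i52 x52 big_slot // ltnNge big.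
Qed.

Lemma conga_clean_iter st st' : agree [:: aIter] st st' -> conga_clean st ->
  conga_clean st' /\ potential_rate * \sum_(x < n) words st' bLevel x =
                     potential_rate * \sum_(x < n) words st bLevel x.
Proof.
move=> A; have e x : x != aIter -> words st' x = words st x.
  by move=> xi; apply: A; rewrite inE.
by rewrite /conga_clean /slots_ok /slot !e.
Qed.

Lemma conga_clean_init : conga_clean (initial_state R n s0).
Proof. by split. Qed.

Lemma potential_max st : conga_clean st ->
  potential_rate * \sum_(x < n) words st bLevel x <= potential_rate * (n * max_level).
Proof.
case=> lv _ _ _; rewrite leq_mul2l; apply/orP; right.
rewrite -[X in X * _]card_ord -sum_nat_const; apply: leq_sum => x _; exact: lv.
Qed.

End Conga.

(** * Time and space of the linear-space implementation *)

Definition conga_repair_time (n : nat) : nat :=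
  potential_rate n * loss n + (max_level n + 10) * (n.+1 * 2000).

Definition conga_time (n : nat) : nat :=
  potential_rate n * (n * max_level n)
  + n * ((8 * n).+1 * 450 + conga_repair_time n + 200) + conga_repair_time n + 200.

Definition conga_layout (n : nat) : seq nat :=
  layout n [:: n; 8 * n; 8 * n; n; 1; 1; 1; 1; 1; 1].

Lemma conga_implements :
  implements_cheapest_insertion (insertion_program conga_find conga_repair) conga_time
    (fun n => sumn (conga_layout n)).
Proof.
(* One factor exceeds n, and five give a factor 32, which leaves room for slot numbers up to 8n and
   the arithmetic on them. *)
exists 6 => R n d s0 dsym; have n0 : 0 < n by apply: leq_ltn_trans (ltn_ord s0).
have lt : 16 * n + 16 < word_bound 6 n.
  have [le1 _] := word_bound_gt 1 n0; have [_ le5] := word_bound_gt 5 n0.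
  rewrite (word_bound_split n 1 5); apply: leq_trans (leq_mul le1 le5).
  by rewrite expn1; clear; lia.
have W1 : n.+1 < word_bound 6 n by apply: leq_ltn_trans lt; clear; lia.
have find_ok st : words st aN 0 = n -> in_range n st -> conga_clean d st ->
    (exists a s, [/\ a < n, s < n & valid (words st aIn) (a, s)]) ->
    ends_within d (word_bound 6 n) (conga_layout n) [::] st conga_find
      ((8 * n).+1 * 450) (fun st' =>
    [/\ conga_clean d st',
        potential_rate n * \sum_(x < n) words st' bLevel x =
        potential_rate n * \sum_(x < n) words st bLevel x
      & optimal d st (best st')]).
  move=> nE rng cl ex; have H := conga_find_spec [::] n0 lt nE rng cl ex.
  apply: (within_weaken H) => //.
  by move=> st' _ [c -> o].
have [k [st [t [E le o c]]]] := @insertion_program_correct R n d s0 (word_bound 6 n)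
  [:: n; 8 * n; 8 * n; n; 1; 1; 1; 1; 1; 1] [::] W1 conga_find conga_repair
  (conga_clean d) (fun st => potential_rate n * \sum_(x < n) words st bLevel x)
  ((8 * n).+1 * 450) (conga_repair_time n) (potential_rate n * (n * max_level n))
  isT isT find_ok (conga_repair_spec [::] n0 lt)
  (@conga_clean_iter R n d) (@potential_max R n d) (conga_clean_init d s0 n0).
exists (conga_layout n), [::], k, st, t.
by split=> //; rewrite addn0.
Qed.

Lemma conga_time_O : big_O conga_time (fun n => n ^ 2 * trunc_log 2 n ^ 2).
Proof.
(* The threshold is 2 because the truncated logarithm of 1 is 0. *)
exists (500 * 1000), 2 => n n2; set L := trunc_log 2 n.
have L1 : 0 < L by rewrite trunc_log_gt0.
have ml : max_level n <= 2 * L by rewrite /max_level -/L; move: L1; clear; lia.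
have LL : L <= L ^ 2 by rewrite -mulnn leq_pmulr.
have n1 : n.+1 <= 2 * n by move: n2; clear; lia.
have rate : potential_rate n <= 6 * 960 * n.
  by rewrite /potential_rate; move: n1; clear; lia.
have lossL : loss n <= 24 * L ^ 2.
  rewrite /loss -mulnn; apply: (@leq_trans ((12 * L) * (2 * L))).
    by apply: leq_mul => //; move: ml L1; clear; lia.
  by clear; lia.
pose Z := n * L ^ 2.
have nZ : n <= Z by rewrite leq_pmulr // expn_gt0 L1.
have Z1 : 0 < Z by apply: leq_trans nZ; apply: ltnW.
have repair : conga_repair_time n <= 200 * 1000 * Z.
  have a := leq_mul rate lossL.
  have b : (max_level n + 10) * (n.+1 * 2000) <= 12 * L ^ 2 * (2 * n * 2000).
    by apply: leq_mul; [move: ml LL L1; clear; lia | rewrite leq_mul2r n1].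
  apply: leq_trans (leq_add a b) _; rewrite /Z; move: (L ^ 2) => q; clear; nia.
have P : potential_rate n * (n * max_level n) <= 12 * 1000 * (n * Z).
  apply: leq_trans (leq_mul rate (leq_mul (leqnn n) ml)) _.
  have : n * n * L <= n * n * L ^ 2 by rewrite leq_mul2l LL orbT.
  by rewrite /Z mulnA; move: (L ^ 2) => q; clear; nia.
have ZnZ : Z <= n * Z by rewrite leq_pmull // ltnW.
have F : n * ((8 * n).+1 * 450 + conga_repair_time n + 200) <= n * (205 * 1000 * Z).
  by rewrite leq_mul2l; apply/orP; right; move: repair nZ Z1; clear; lia.
have -> : n ^ 2 * L ^ 2 = n * Z by rewrite /Z mulnA mulnn.
rewrite /conga_time.
rewrite mulnCA in F.
apply: leq_trans (leq_add (leq_add (leq_add P F) repair) (leqnn 200)) _.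
by move: ZnZ Z1; move: (n * Z); clear; lia.
Qed.

(** The arrays have 21 n + 15 cells, at most 36 n for positive n. *)
Lemma conga_space_O : big_O (fun n => sumn (conga_layout n)) (fun n => n).
Proof. by exists 36, 1 => n n1; rewrite /=; move: n1; clear; lia. Qed.

Theorem theorem5 :
  (exists (p : cmd) (T S : nat -> nat),
     big_O T (fun n => n ^ 2) /\ implements_cheapest_insertion p T S)
  /\
  (exists (p : cmd) (T S : nat -> nat),
     [/\ big_O T (fun n => n ^ 2 * trunc_log 2 n ^ 2),
         big_O S (fun n => n)
       & implements_cheapest_insertion p T S]).
Proof.
split; do 3!eexists.
  by split; [apply: quad_time_O | apply: quad_implements].
by split; [apply: conga_time_O | apply: conga_space_O | apply: conga_implements].
Qed.
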